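(* Let the space dimension $d\ge 1$ be odd, and let $1<\gamma\le 1+\frac{1}{d-1}$ (no upper restriction on $\gamma$ when $d=1$). Set $\kappa=\frac{\gamma-1}{2}$. Then there does not exist a non-trivial eternal solution $(c,u)\in\mathcal C^1(\mathbb R^{1+d})$ (that is, a classical solution with $c\ge 0$, $c\not\equiv 0$, defined for all $t\in\mathbb R$ and $x\in\mathbb R^d$) of the system $$\partial_t\bar c+(u\cdot\nabla)\bar c+\kappa\,\bar c\,\mathrm{div}\,u=0,\qquad \partial_t u+(u\cdot\nabla)u+\kappa\,\bar c\,\nabla\bar c=0,\qquad \bar c:=\frac{c}{\kappa},$$ such that $c_0:=c(\cdot,0)$ is supported in a compact domain of $\mathbb R^d$ with smooth boundary.
   Context: The system is the symmetric form of the isentropic Euler equations $\partial_t\rho+\mathrm{div}(\rho u)=0$, $\partial_t(\rho u)+\mathrm{Div}(\rho u\otimes u)+\nabla p(\rho)=0$ with polytropic pressure $p(\rho)=A\rho^\gamma$, $A>0$, $\gamma>1$. Here $\rho\ge0$ is the density, $u(x,t)\in\mathbb R^d$ is the velocity, and $c=\sqrt{p'(\rho)}=\sqrt{\gamma A}\,\rho^{\kappa}\ge 0$ is the sound speed. ''Eternal'' means defined for all $t\in\mathbb R$. ''Non-trivial'' means that there is some fluid, i.e. $c\not\equiv0$ (equivalently $\rho\not\equiv 0$). *)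

(* Defs.v *)
From mathcomp Require Import all_boot all_order all_algebra.
From mathcomp Require Import all_classical all_reals all_analysis.

Set Implicit Arguments.
Unset Strict Implicit.
Unset Printing Implicit Defensive.

Import Order.TTheory GRing.Theory Num.Theory.
Import numFieldNormedType.Exports.

Local Open Scope classical_set_scope.
Local Open Scope ring_scope.

(* Functions of class C^k on an open set U.  Only meant for finite-dimensional
   V, where continuity of every directional derivative 'D_v f is the same as
   continuity of the differential. *)
Fixpoint class_C (R : realType) (V W : normedModType R) (k : nat)
    (U : set V) (f : V -> W) : Prop :=
  match k with
  | 0 => forall x, U x -> {for x, continuous f}
  | k'.+1 => (forall x, U x -> differentiable f x) /\
             (forall v : V, class_C k' U ('D_v f))
  end.

Definition smooth_on (R : realType) (V W : normedModType R)
    (U : set V) (f : V -> W) : Prop :=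
  forall k, class_C k U f.

(* K lies locally on one side of its boundary, which is a smooth hypersurface:
   near each boundary point, K is the sublevel set {phi <= 0} of a smooth phi
   with non-vanishing differential.  For K closed, the topological boundary is
   K minus its interior. *)
Definition has_smooth_boundary (R : realType) (V : normedModType R)
    (K : set V) : Prop :=
  forall p, (K `\` K°) p ->
    exists (U : set V) (phi : V -> R),
      [/\ open U, U p, smooth_on U phi,
          exists v, 'D_v phi p != 0 &
          K `&` U = [set x | phi x <= 0] `&` U].

(* The closure of a connected open set. *)
Definition compact_domain (R : realType) (V : normedModType R)
    (K : set V) : Prop :=
  [/\ compact K, regclosed K & connected K°].

Definition fsupport (R : realType) (V : normedModType R) (f : V -> R) : set V :=
  closure [set x | f x != 0].

Section euler.
Variables (R : realType) (d : nat).

(* A point z = (t, x) of R^(1+d): time t, position x. *)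
Local Notation spacetime := (R * 'rV[R]_d)%type.

Definition dt (W : normedModType R) (f : spacetime -> W) : spacetime -> W :=
  'D_((1, 0) : spacetime) f.

Definition dx (W : normedModType R) (i : 'I_d) (f : spacetime -> W) :
    spacetime -> W :=
  'D_((0, delta_mx 0 i) : spacetime) f.

Definition grad (f : spacetime -> R) (z : spacetime) : 'rV[R]_d :=
  \row_i dx i f z.

Definition div (u : spacetime -> 'rV[R]_d) (z : spacetime) : R :=
  \sum_i dx i (fun y => u y 0 i) z.

(* (u . nabla) f *)
Definition advect (W : normedModType R) (u : spacetime -> 'rV[R]_d)
    (f : spacetime -> W) (z : spacetime) : W :=
  \sum_i u z 0 i *: dx i f z.

Definition euler_system (kappa : R) (c : spacetime -> R)
    (u : spacetime -> 'rV[R]_d) : Prop :=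
  let cbar := fun z => c z / kappa in
  forall z,
    dt cbar z + advect u cbar z + kappa * cbar z * div u z = 0 /\
    dt u z + advect u u z + (kappa * cbar z) *: grad cbar z = 0.

Definition eternal_solution (kappa : R) (c : spacetime -> R)
    (u : spacetime -> 'rV[R]_d) : Prop :=
  [/\ class_C 1 setT c, class_C 1 setT u, forall z, 0 <= c z &
      euler_system kappa c u].

Definition nontrivial (c : spacetime -> R) : Prop := exists z, c z != 0.

End euler.

(* Main.v *)
Require Import Defs.
From mathcomp Require Import all_boot all_order all_algebra all_fingroup.
From mathcomp Require Import all_classical all_reals all_analysis.
From mathcomp Require Import ring lra.
Set Implicit Arguments.
Unset Strict Implicit.
Unset Printing Implicit Defensive.
Import Order.TTheory GRing.Theory Num.Theory.
Import numFieldNormedType.Exports.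
Local Open Scope classical_set_scope.
Local Open Scope ring_scope.

(** Put b = c / kappa and m = 1 / kappa.  Three facts about an eternal C^1
    flow with compact initial fluid region are incompatible when d >= 3.

    - Vacuum moves along straight lines.  Where b = 0 the momentum equation
      is Burgers' equation; a Gronwall argument along the line x + t v shows
      that a vacuum particle of velocity v follows that line for all times,
      past and future, inside vacuum ([vacuum_line]).  So the label
      x - t u(t, x) of a vacuum point is its position at time 0, and the
      fluid region stays bounded at bounded times ([finite_propagation]).

    - The fluid region does not become large.  Let psi be a cutoff equal to 1
      on the fluid, and elsewhere locally constant or a function of the label.
      Following straight lines from time 0 to time tau turns the integral of
      psi(tau) into the integral of psi(0) det(1 + tau Du(0)) ([vol_det]), a
      polynomial in tau of degree at most d.  It is nonnegative for every real
      tau because the flow is eternal, so for odd d its coefficient of degree d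
      vanishes, and the volume is O(t^(d-1)) ([vol_bound]).

    - The pressure disperses.  The virial-type energy, the integral of
      b^m |x - t u|^2 / 2 + t^2 b^(m+2) / (2 (m+2)), grows at most like
      t^(2 (m-d)/m) when m >= d, so that the integral of b^(m+2) is
      O(t^(-2d/m)) ([pressure_decay]).

    The mass, the integral of b^m, is constant.  Splitting the fluid
    according to whether b exceeds s gives b^m <= s^(-2) b^(m+2) + s^m psi
    ([dens_young]).  With s = e t^(-(d-1)/m) the second term integrates to a
    constant multiple of e^m and the first to O(e^(-2) t^(-2/m)), so a small e
    and then a large t contradict a positive mass ([no_dispersion]).  The
    bound on gamma makes m >= 2 (d - 1), whence m >= d and m >= 2.

    When d = 1 there is no bound on gamma, and another argument is used:
    two straight lines of different velocities meet in the plane, so all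
    vacuum has one velocity U, and the fluid stays in an interval moving with
    U.  The integral Y of (x - t U) (u - U) satisfies Y' >= K Y^2 with K > 0,
    by the momentum equation and Cauchy-Schwarz.  An eternal solution of this
    inequality is zero, hence so is Y', an integral which dominates that of
    kappa b^2 / 2 ([no_1d_flow]).

    Since u is only C^1, its Jacobian determinants cannot be differentiated,
    although [vol_det] is classically an integration by parts with second
    derivatives.  It is obtained instead from a Stokes formula on a
    cubical grid, which is an exact algebraic identity between finite
    differences ([cup_stokes]); the mesh then tends to 0. *)

(** * A discrete Stokes formula *)

Section cubical_stokes.
Variables (G : zmodType) (R : comNzRingType) (n : nat).
Variables (F : 'I_n.+1 -> G -> R) (e : 'I_n.+1 -> G).

(** The vertices of the monotone edge path of a cube which takes the directions
    in the order s; [stairs1] is the same path with its first edge left out. *)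
Definition stairs (s : 'S_n.+1) (k : nat) : G := \sum_(j < n.+1 | (j < k)%N) e (s j).

Definition stairs1 (s : 'S_n.+1) (k : nat) : G :=
  \sum_(j < n.+1 | (0 < j < k)%N) e (s j).

Definition incr (s : 'S_n.+1) (k : 'I_n.+1) (g : G) : R :=
  F k (g + stairs s k.+1) - F k (g + stairs s k).

Definition incr1 (s : 'S_n.+1) (k : 'I_n.+1) (g : G) : R :=
  F k (g + stairs1 s k.+1) - F k (g + stairs1 s k).

(** The cup product of the coboundaries of the functions F, evaluated on the
    cube with corner g. It is the finite-difference analogue of the determinant
    of the differentials. *)
Definition cup (g : G) : R := \sum_(s : 'S_n.+1) (-1) ^+ s * \prod_k incr s k g.

Definition wall (s : 'S_n.+1) (g : G) : R :=
  F ord0 g * \prod_(k | k != ord0) incr1 s k g.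

Lemma stairsS s k : (0 < k)%N -> stairs s k = e (s ord0) + stairs1 s k.
Proof.
move=> k0; rewrite /stairs (bigD1 ord0)//=; congr (_ + _).
by apply: eq_bigl => j; rewrite andbC -lt0n.
Qed.

Lemma incr1E s (k : 'I_n.+1) g : k != ord0 -> incr s k g = incr1 s k (g + e (s ord0)).
Proof. by rewrite -lt0n => k0; rewrite /incr /incr1 !stairsS// !addrA. Qed.

Lemma incr0E s g : incr s ord0 g = F ord0 (g + e (s ord0)) - F ord0 g.
Proof.
rewrite /incr /stairs [X in _ - F _ (_ + X)]big1 ?addr0//.
rewrite (bigD1 ord0)//= big1 ?addr0// => j /andP[].
by rewrite ltnS leqn0 => /eqP j0 /eqP[]; apply: val_inj.
Qed.

(** Interpolates between the product of the increments along the shortened path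
    from g and the one along the shortened path from the end of the first edge:
    the factors up to m start from g, the others are shifted. *)
Definition hyb s g (m : nat) : R :=
  \prod_(k | k != ord0) (if (k <= m)%N then incr1 s k g else incr1 s k (g + e (s ord0))).

Lemma stairs1_swap s (m : 'I_n.+1) (k : nat) : (k <= m)%N ->
  stairs1 (tperm ord0 m * s) k = stairs1 s k.
Proof.
move=> km; apply: eq_bigr => j /andP[j0 jk]; rewrite permM tpermD//.
  by rewrite eq_sym -val_eqE/= -lt0n.
by rewrite -val_eqE/= gtn_eqF// (leq_trans jk).
Qed.

Lemma stairs_swap s (m : 'I_n.+1) (k : nat) : (m < k)%N ->
  stairs (tperm ord0 m * s) k = stairs s k.
Proof.
move=> mk; have k0 : (0 < k)%N by apply: leq_ltn_trans mk.
rewrite /stairs [RHS](reindex_inj (@perm_inj _ (tperm ord0 m)))/=.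
apply: eq_big => [j|j _]; last by rewrite permM.
by case: tpermP => [->|->|//]; rewrite ?k0 ?mk.
Qed.

(** The m-th factor of the difference is a mixed second difference in the
    directions s 0 and s m. It is symmetric in these two, and the other factors
    do not change when they are exchanged, while the sign of s does. *)
Lemma hyb_swap (m : 'I_n.+1) g : m != ord0 ->
  \sum_(s : 'S_n.+1) (-1) ^+ s * (hyb s g m - hyb s g m.-1) = 0 :> R.
Proof.
move=> m0; have mpos : (0 < m)%N by rewrite lt0n.
pose T (s : 'S_n.+1) := \prod_(k | k != ord0)
  (if (k < m)%N then incr1 s k g else
   if k == m then incr1 s k g - incr1 s k (g + e (s ord0))
   else incr1 s k (g + e (s ord0))).
have TE s : hyb s g m - hyb s g m.-1 = T s.
  rewrite /hyb /T (bigD1 m)//= [X in _ - X](bigD1 m)//= [RHS](bigD1 m)//=.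
  rewrite leqnn eqxx ltnn leqNgt prednK// leqnn/=.
  rewrite [RHS]mulrBl; congr (_ * _ - _ * _); apply: eq_bigr => k /andP[k0 km].
    by rewrite (negbTE km) ltn_neqAle val_eqE (negbTE km).
  by rewrite (negbTE km) -ltnS prednK.
have Tswap s : T (tperm ord0 m * s)%g = T s.
  apply: eq_bigr => k k0; have [km|km|/val_inj ->] := ltngtP k m.
  - by rewrite /incr1 !stairs1_swap// ltnW.
  - rewrite -val_eqE/= gtn_eqF// -!incr1E// /incr !stairs_swap//.
    by rewrite ltnS ltnW.
  - rewrite eqxx -!incr1E// /incr1 /incr stairs_swap// (@stairsS _ m)//.
    rewrite [stairs s m]stairsS//.
    have stS s' : stairs1 s' m.+1 = stairs1 s' m + e (s' m).
      rewrite {1}/stairs1 (bigD1 m)/=; last by rewrite mpos/=.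
      rewrite addrC; congr (_ + _); rewrite /stairs1; apply: eq_bigl => j.
      rewrite -andbA ltnS -(inj_eq val_inj)/= [(j < m)%N]ltn_neqAle.
      by case: (0 < j)%N; case: (j <= m)%N; case: (_ == _ :> nat).
    rewrite stairsS// !stS (@stairs1_swap s m m)// !permM tpermL tpermR.
    set p := stairs1 s m.
    rewrite !addrA [g + p + _]addrAC [g + e (s m) + p]addrAC.
    ring.
have odd1 (s : 'S_n.+1) : (tperm ord0 m * s)%g = ~~ s :> bool.
  by rewrite odd_permM odd_tperm eq_sym m0.
under eq_bigr => s _ do rewrite TE.
rewrite (bigID (fun s : 'S_n.+1 => odd_perm s))/=.
rewrite [X in _ + X](reindex_inj (mulgI (tperm ord0 m)))/=.
under [X in _ + X]eq_bigl do rewrite odd1 negbK.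
rewrite -big_split/= big1// => s so.
by rewrite Tswap odd1 so/= expr0 expr1 mulN1r mul1r addNr.
Qed.

(** In the terms with F ord0 g, the increments after the first edge have to be
    moved back to the corner g. Moving them one at a time costs nothing, by
    [hyb_swap]. No regularity is involved, which is what makes the limit valid
    for C^1 functions. *)
Lemma cup_stokes g :
  cup g = \sum_(s : 'S_n.+1) (-1) ^+ s * (wall s (g + e (s ord0)) - wall s g).
Proof.
have h0 s : hyb s g 0 = \prod_(k | k != ord0) incr1 s k (g + e (s ord0)).
  by apply: eq_bigr => k; rewrite leqn0 -(inj_eq val_inj)/= => /negbTE ->.
have hn s : hyb s g n = \prod_(k | k != ord0) incr1 s k g.
  by apply: eq_bigr => k _; rewrite -ltnS ltn_ord.
have key : \sum_(s : 'S_n.+1) (-1) ^+ s * (hyb s g n - hyb s g 0) = 0 :> R.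
  under eq_bigr => s _ do rewrite -(telescope_sumr (hyb s g) (leq0n n)) mulr_sumr.
  rewrite exchange_big/= big_nat big1// => i /andP[_ i_n].
  have im : (i.+1 < n.+1)%N by rewrite ltnS.
  have /= := @hyb_swap (Ordinal im) g isT; exact.
apply/eqP; rewrite /cup -subr_eq0 -sumrB; apply/eqP.
transitivity (F ord0 g * \sum_(s : 'S_n.+1) (-1) ^+ s * (hyb s g n - hyb s g 0)); last first.
  by rewrite key mulr0.
rewrite mulr_sumr; apply: eq_bigr => s _.
rewrite (bigD1 ord0)//= incr0E /wall h0 hn.
under eq_bigr => k k0 do rewrite incr1E//.
move: (\prod_(k | _) _) (\prod_(k | _) _) => A B.
move: (F _ _) (F _ _) ((-1) ^+ _) => x y z.
ring.
Qed.
End cubical_stokes.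

(** * Riemann sums *)

Section grid.
Variables (R : realType) (d : nat).
Local Notation E := 'rV[R]_d.

(** The n-th grid has mesh 1/(n+1) and fills the cube [-(n+1), n+1]^d. *)
Definition mesh n : R := n.+1%:R^-1.
Definition gsize n := (2 * (n.+1 * n.+1))%N.
Definition gpt n (i : nat) : R := i%:R * mesh n - n.+1%:R.
Definition gridpt n (k : {ffun 'I_d -> 'I_(gsize n).+1}) : E := \row_j gpt n (k j).
Definition gsum n (f : E -> R) : R := mesh n ^+ d * \sum_(k : {ffun 'I_d -> 'I_(gsize n).+1}) f (gridpt k).

Lemma mesh_gt0 n : 0 < mesh n. Proof. by rewrite invr_gt0. Qed.

Lemma mesh_le1 n : mesh n <= 1.
Proof. by rewrite invf_le1// ler1n. Qed.

Lemma mesh_mul n : mesh n * n.+1%:R = 1.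
Proof. by rewrite mulVf// pnatr_eq0. Qed.

Lemma gptS n i : gpt n i.+1 = gpt n i + mesh n.
Proof. by rewrite /gpt -natr1 mulrDl mul1r addrAC. Qed.

Lemma gpt0 n : gpt n 0 = - n.+1%:R. Proof. by rewrite /gpt mul0r sub0r. Qed.

Lemma gpt_last n : gpt n (gsize n) = n.+1%:R.
Proof.
rewrite /gpt /gsize !natrM -!mulrA [n.+1%:R * mesh n]mulrC mesh_mul mulr1.
by rewrite mulrDl mul1r addrK.
Qed.

Lemma le_coord (x : E) i : `|x 0 i| <= `|x|.
Proof.
rewrite [leRHS]/Num.norm /= mx_normrE; apply/bigmax_geP; right => /=.
by exists (0, i).
Qed.

Lemma norm_le_coord (x : E) r : 0 <= r -> (forall i, `|x 0 i| <= r) -> `|x| <= r.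
Proof.
move=> r0 xr; rewrite [leLHS]/Num.norm /= mx_normrE; apply/bigmax_leP; split => //.
by move=> [i j] _; rewrite ord1.
Qed.

Lemma gsumD n f g : gsum n (fun x => f x + g x) = gsum n f + gsum n g.
Proof. by rewrite /gsum big_split mulrDr. Qed.

Lemma gsumZ n a f : gsum n (fun x => a * f x) = a * gsum n f.
Proof. by rewrite /gsum -mulr_sumr mulrCA. Qed.

Lemma gsumB n f g : gsum n (fun x => f x - g x) = gsum n f - gsum n g.
Proof. by rewrite /gsum sumrB mulrBr. Qed.

Lemma gsum_sum n I (r : seq I) (P : pred I) (f : I -> E -> R) :
  gsum n (fun x => \sum_(i <- r | P i) f i x) = \sum_(i <- r | P i) gsum n (f i).
Proof. by rewrite /gsum exchange_big/= mulr_sumr. Qed.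

Lemma le_gsum n f g : (forall x, f x <= g x) -> gsum n f <= gsum n g.
Proof.
move=> fg; rewrite /gsum ler_pM2l ?exprn_gt0 ?mesh_gt0//.
by apply: ler_sum => k _.
Qed.

(** A shift by one mesh permutes the grid cyclically, and the points which wrap
    around lie where f vanishes. *)
Lemma gsum_shift n f j : (forall x, n.+1%:R <= `|x| -> f x = 0) ->
  gsum n (fun x => f (x + mesh n *: delta_mx 0 j)) = gsum n f.
Proof.
move=> f0; rewrite /gsum; congr (_ * _).
pose h (k : {ffun 'I_d -> 'I_(gsize n).+1}) :=
  [ffun i => if i == j then ordS (k i) else k i].
pose h' (k : {ffun 'I_d -> 'I_(gsize n).+1}) :=
  [ffun i => if i == j then ord_pred (k i) else k i].
have hK : cancel h h'.
  by move=> k; apply/ffunP => i; rewrite !ffunE; case: eqP => // _; rewrite ordSK.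
rewrite [RHS](reindex_inj (can_inj hK))/=; apply: eq_bigr => k _.
have [kj|kj] := eqVneq (k j : nat) (gsize n).
  rewrite f0; last first.
    apply: le_trans (le_coord _ j); rewrite !mxE !eqxx mulr1 kj gpt_last.
    by apply: le_trans (ler_norm _); rewrite lerDl ltW// mesh_gt0.
  rewrite f0//; apply: le_trans (le_coord _ j).
  by rewrite !mxE ffunE eqxx/= kj modnn gpt0 normrN ler_norm.
congr f; apply/rowP => i; rewrite !mxE ffunE eqxx/=.
have [->|ij] := eqVneq i j; last by rewrite mulr0 addr0.
rewrite mulr1 -gptS/= modn_small// ltnS ltn_neqAle kj/=.
by rewrite -ltnS ltn_ord.
Qed.

Lemma gsum_prod n (g : 'I_d -> R -> R) :
  gsum n (fun x => \prod_j g j (x 0 j)) =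
  \prod_j (mesh n * \sum_(i < (gsize n).+1) g j (gpt n i)).
Proof.
rewrite /gsum big_split/= prodr_const card_ord; congr (_ * _).
rewrite bigA_distr_bigA/=; apply: eq_bigr => k _; apply: eq_bigr => j _.
by rewrite mxE.
Qed.

(** The count telescopes: each grid point of [-r, r] raises the clamped
    function G by exactly one mesh. *)
Lemma gsum1_up n (r : R) : 0 <= r ->
  mesh n * \sum_(i < (gsize n).+1) (`|gpt n i| <= r)%R%:R <= 2 * r + 1.
Proof.
move=> r0; pose G (x : R) : R := Num.max (- r) (Num.min x (r + 1)).
have step x : mesh n * (`|x| <= r)%R%:R <= G (x + mesh n) - G x.
  have := mesh_gt0 n; have := mesh_le1 n; rewrite /G.
  have [xr|_] := boolP (`|x| <= r); last first.
    rewrite mulr0 subr_ge0 => _ m0.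
    rewrite ge_max le_max lexx/= le_max; apply/orP; right.
    by rewrite le_min !ge_min lexx orbT andbT lerDl (ltW m0).
  move: xr; rewrite ler_norml => /andP[x1 x2] m1 m0.
  have -> : Num.min (x + mesh n) (r + 1) = x + mesh n by apply/min_idPl; lra.
  have -> : Num.min x (r + 1) = x by apply/min_idPl; lra.
  have -> : Num.max (- r) (x + mesh n) = x + mesh n by apply/max_idPr; lra.
  have -> : Num.max (- r) x = x by apply/max_idPr; lra.
  by rewrite mulr1; lra.
rewrite mulr_sumr.
apply: (@le_trans _ _ (\sum_(i < (gsize n).+1) (G (gpt n i + mesh n) - G (gpt n i)))).
  by apply: ler_sum => i _; exact: step.
rewrite (eq_bigr (fun i : 'I__ => G (gpt n i.+1) - G (gpt n i))); last first.
  by move=> i _; rewrite gptS.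
rewrite -(big_mkord xpredT (fun i => G (gpt n i.+1) - G (gpt n i))) telescope_sumr//.
have Gup x : G x <= r + 1.
  by rewrite /G ge_max ge_min lexx orbT andbT; lra.
have Glo x : - r <= G x by rewrite /G le_max lexx.
by have := Gup (gpt n (gsize n).+1); have := Glo (gpt n 0); lra.
Qed.

Lemma gsum1_low n (a b : R) : - n.+1%:R <= a -> a <= b -> b <= n.+1%:R ->
  b - a <= mesh n * \sum_(i < (gsize n).+1) (a - mesh n <= gpt n i <= b)%R%:R.
Proof.
move=> na ab bn; pose G (x : R) : R := Num.max a (Num.min x b).
have Ga x : x <= a -> G x = a.
  by move=> xa; rewrite /G (max_idPl _)// ge_min xa.
have Gb x : b <= x -> G x = b.
  by move=> bx; rewrite /G (min_idPr _)// (max_idPr _).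
have Gm x y : x <= y -> G y - G x <= y - x.
  move=> xy; rewrite /G; case: (leP x b); case: (leP y b); case: (leP a x);
    case: (leP a y); rewrite ?(max_idPr ab) => *; try lra;
    by case: leP; case: leP; lra.
have step x : G (x + mesh n) - G x <= mesh n * (a - mesh n <= x <= b)%R%:R.
  have m0 := mesh_gt0 n.
  have [/andP[xa xb]|] := boolP (a - mesh n <= x <= b).
    by rewrite mulr1 (le_trans (Gm _ _ _))//; lra.
  rewrite negb_and -!ltNge mulr0 => /orP[xa|bx].
    by rewrite !Ga ?subrr//; lra.
  by rewrite !Gb ?subrr//; lra.
rewrite mulr_sumr.
apply: (@le_trans _ _ (\sum_(i < (gsize n).+1) (G (gpt n i + mesh n) - G (gpt n i)))); last first.
  by apply: ler_sum => i _; exact: step.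
rewrite (eq_bigr (fun i : 'I__ => G (gpt n i.+1) - G (gpt n i))); last first.
  by move=> i _; rewrite gptS.
rewrite -(big_mkord xpredT (fun i => G (gpt n i.+1) - G (gpt n i))) telescope_sumr//.
rewrite Gb ?Ga// ?gpt0// gptS gpt_last.
by rewrite (le_trans bn)// lerDl ltW// mesh_gt0.
Qed.

Definition bsupp (r B : R) (f : E -> R) :=
  (forall x, `|f x| <= B) /\ (forall x, r < `|x| -> f x = 0).

Lemma gsum_bound n (r B : R) f : 0 <= r -> bsupp r B f -> `|gsum n f| <= B * (2 * r + 1) ^+ d.
Proof.
move=> r0 [fB fr].
have B0 : 0 <= B by apply: le_trans (normr_ge0 (f 0)) (fB 0).
pose g (x : E) : R := \prod_j (`|x 0 j| <= r)%R%:R.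
have fg x : `|f x| <= B * g x.
  have [xr|xr] := leP `|x| r.
    rewrite /g big1 ?mulr1// => j _.
    by rewrite (le_trans (le_coord x j) xr).
  rewrite fr// normr0 mulr_ge0//; apply: prodr_ge0 => j _; exact: ler0n.
have gn : gsum n (fun x => B * g x) <= B * (2 * r + 1) ^+ d.
  rewrite gsumZ ler_wpM2l// (gsum_prod n (fun=> fun y => (`|y| <= r)%R%:R)).
  rewrite -[X in _ <= _ ^+ X](card_ord d) -prodr_const; apply: ler_prod => j _.
  by rewrite gsum1_up// mulr_ge0 ?(ltW (mesh_gt0 n))// sumr_ge0.
rewrite ler_norml -[X in X <= _]opprK lerNl opprK; apply/andP; split.
  apply: le_trans gn; rewrite -mulN1r -gsumZ; apply: le_gsum => x.
  by rewrite mulN1r (le_trans _ (fg x))// -normrN ler_norm.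
by apply: le_trans gn; apply: le_gsum => x; rewrite (le_trans _ (fg x))// ler_norm.
Qed.

End grid.

(** * The integral of continuous functions with compact support *)

Section uniform.
Variable (R : realType).

(** Convergence at each point jointly in the point and the parameter is uniform
    on compact sets. *)
Lemma cvg0_unif (T : topologicalType) (K : set T) I (F : set_system I) {FF : Filter F}
    (q : T -> I -> R) : compact K ->
  (forall x, K x -> (fun p => q p.1 p.2) @ filter_prod (nbhs x) F --> (0 : R)) ->
  forall e, 0 < e -> \forall i \near F, forall x, K x -> `|q x i| <= e.
Proof.
move=> /compact_near_coveringP cK q0 e e0.
apply: (cK _ F (fun i x => `|q x i| <= e)) => x Kx.
by have /cvgr0Pnorm_le/(_ e e0) := q0 x Kx.
Qed.

Lemma is_derive_line (V W : normedModType R) (f : V -> W) (z v : V) (s : R) :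
  derivable f (z + s *: v) v ->
  is_derive s 1 (fun r : R => f (z + r *: v)) ('D_v f (z + s *: v)).
Proof.
move=> fv; have eqf : (fun h : R => h^-1 *: (f (z + (h *: 1 + s) *: v) - f (z + s *: v))) =
    (fun h : R => h^-1 *: (f (h *: v + (z + s *: v)) - f (z + s *: v))).
  apply/funext => h; congr (_ *: (f _ - _)).
  by rewrite [h *: 1]mulr1 scalerDl addrCA.
by split; [rewrite /derivable | rewrite /derive]; rewrite eqf.
Qed.

(** By the mean value theorem a difference quotient is a nearby value of the
    derivative, so continuity of the derivative allows the base point to
    move. *)
Lemma strict_derive (V : normedModType R) (f : V -> R) (v z0 : V) :
  (forall z, derivable f z v) -> {for z0, continuous ('D_v f)} ->
  (fun p : V * R => p.2^-1 * (f (p.1 + p.2 *: v) - f p.1)) @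
    filter_prod (nbhs z0) (0^')%classic --> 'D_v f z0.
Proof.
move=> df cf; apply/cvgrPdist_le => e e0.
have /cvgrPdist_le/(_ _ e0) : 'D_v f (p.1 + p.2 *: v) @[p --> (z0, 0 : R)] --> 'D_v f z0.
  have c1 : (p.1 + p.2 *: v) @[p --> (z0, 0 : R)] --> z0.
    rewrite -[X in _ --> nbhs X](addr0 z0) -[X in _ --> nbhs (_ + X)](scale0r v).
    by apply: cvgD; [exact: cvg_fst | apply: (@cvgZr_tmp _ _ _ _ _ snd); exact: cvg_snd].
  exact: (@cvg_comp _ _ _ _ _ _ _ _ c1 cf).
case=> -[A B]/= [Az /nbhs_ballP[r r0 Br]] AB.
exists (A, [set s : R | `|s| < r /\ s != 0]) => /=.
  split => //; rewrite /dnbhs/=; near=> s; split; last by near: s; exact: nbhs_dnbhs_neq.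
  by near: s; apply: dnbhs0_lt.
move=> [z s]/= [Azz [sr s0]].
pose g (t : R) := f (z + t *: v).
have dg (t : R) : is_derive t (1 : R) g ('D_v f (z + t *: v)) by exact: is_derive_line.
have cg (a b : R) : {within `[a, b], continuous g}.
  apply: continuous_subspaceT => t; apply: differentiable_continuous.
  by apply/derivable1_diffP; have [] := dg t.
have [c cs ->] : exists2 c, `|c| <= `|s| & s^-1 * (f (z + s *: v) - f z) = 'D_v f (z + c *: v).
  have [s1|s1|s1] := ltgtP s 0; last by rewrite s1 eqxx in s0.
    have [c] := MVT s1 (fun t _ => dg t) (cg _ _).
    rewrite in_itv/= => /andP[c1 c2]; rewrite {1 2}/g scale0r addr0 sub0r => E.
    exists c; first by rewrite !ltr0_norm// lerN2 ltW.
    by rewrite -opprB E !mulrN opprK mulrC mulfK.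
  have [c] := MVT s1 (fun t _ => dg t) (cg _ _).
  rewrite in_itv/= => /andP[c1 c2]; rewrite {1 2}/g scale0r addr0 subr0 => E.
  exists c; first by rewrite !gtr0_norm// ltW.
  by rewrite E mulrC mulfK.
apply: (AB (z, c)); split => //=; apply: Br.
by rewrite /ball/= sub0r normrN (le_lt_trans cs).
Unshelve. all: by end_near. Qed.

End uniform.

Section functional.
Variables (R : realType) (d : nat).
Local Notation E := 'rV[R]_d.

Lemma closed_ball_compact (r : R) : compact [set x : E | `|x| <= r].
Proof.
apply: bounded_closed_compact.
  by exists r; split; rewrite ?num_real// => s rs x /= /le_trans -> //; apply: ltW.
apply: (@preimage_closed _ _ (fun x : E => `|x|) [set y | y <= r]).
  by move=> x _; exact: norm_continuous.
exact: closed_le.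
Qed.

Lemma compact_box (tau rho : R) : compact ([set t : R | `|t| <= tau] `*` [set x : E | `|x| <= rho]).
Proof.
apply: compact_setX; last exact: closed_ball_compact.
rewrite (_ : [set t : R | _] = `[- tau, tau]%classic); first exact: segment_compact.
by apply/seteqP; split => t /=; rewrite in_itv/= ler_norml.
Qed.

(** Stated with a moving base point, because the difference quotients to which
    it is applied converge in that sense by [strict_derive]. *)
Lemma gsum_cvg0 (q : E -> nat -> R) r :
  (forall x : E, (fun p => q p.1 p.2) @ filter_prod (nbhs x) \oo --> (0 : R)) ->
  (forall n x, r < `|x| -> q x n = 0) ->
  gsum n (q ^~ n) @[n --> \oo] --> (0 : R).
Proof.
move=> q0 qr; apply/cvgr0Pnorm_le => e e0.
pose r' := Num.max r 0; have r'0 : 0 <= r' by rewrite le_max lexx orbT.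
pose C := (2 * r' + 1) ^+ d; have C0 : 0 < C by apply: exprn_gt0; lra.
have H := cvg0_unif (@closed_ball_compact r') (fun x _ => q0 x) (divr_gt0 e0 C0).
have {}H := H _; near=> n; have qn : forall x : E, `|x| <= r' -> `|q x n| <= e / C by near: n; exact: H.
 rewrite -[leRHS](divfK (lt0r_neq0 C0)); apply: gsum_bound => //.
split => x; last by move=> rx; apply: qr; apply: le_lt_trans rx; rewrite le_max lexx.
have [/qn//|rx] := leP `|x| r'.
by rewrite qr ?normr0 ?divr_ge0 ?ltW//; apply: le_lt_trans rx; rewrite le_max lexx.
Unshelve. all: by end_near. Qed.

(** An ultrafilter finer than the Frechet filter: along it every bounded
    sequence of Riemann sums has a limit. The integral is defined as this
    limit. All its properties used here hold for the Riemann sums themselves,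
    among them exact invariance under translations by the mesh. *)
Definition gridU : set_system nat := sval (cid (ultraFilterLemma eventually_filter)).

Lemma gridU_ultra : UltraFilter gridU.
Proof. by rewrite /gridU; case: cid => U []. Qed.

Lemma gridU_oo : gridU --> \oo.
Proof. by rewrite /gridU; case: cid => U []. Qed.

Instance gridU_proper : ProperFilter gridU.
Proof. by have [] := gridU_ultra. Qed.

Definition Lint (f : E -> R) : R := lim (gsum n f @[n --> gridU]).

(** The integrands: continuous with compact support, so that their Riemann sums
    are bounded. *)
Definition ccf (f : E -> R) := continuous f /\ exists r, forall x, r < `|x| -> f x = 0.

Lemma ccf_bsupp f : ccf f -> exists r B : R, 0 <= r /\ bsupp r B f.
Proof.
move=> [cf [r fr]]; pose r' := Num.max r 0; have r'0 : 0 <= r' by rewrite le_max lexx orbT.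
exists r'.
have [x x0 fx] : exists2 x, x \in [set x : E | `|x| <= r'] &
    forall t, t \in [set x : E | `|x| <= r'] -> `|f t| <= `|f x|.
  apply: (@EVT_max_rV _ _ (fun x => `|f x|) _ _ (@closed_ball_compact r')).
    by exists 0; rewrite /= normr0.
  by apply: continuous_subspaceT => x; apply: continuous_comp; [exact: cf|exact: norm_continuous].
exists `|f x|; split => //; split => y; last first.
  by move=> ry; apply: fr; apply: le_lt_trans ry; rewrite le_max lexx.
have [yr|yr] := leP `|y| r'; first by apply: fx; rewrite inE.
by rewrite fr ?normr0//; apply: le_lt_trans yr; rewrite le_max lexx.
Qed.

Lemma Lint_cvg f : ccf f -> gsum n f @[n --> gridU] --> Lint f.
Proof.
move=> /ccf_bsupp[r [B [r0 fB]]]; set C := B * (2 * r + 1) ^+ d.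
have cC := @segment_compact R (- C) C; rewrite compact_ultra in cC.
have GU : UltraFilter (gsum n f @[n --> gridU]).
  split=> [|G PG sG]; first exact: fmap_proper_filter.
  rewrite eqEsubset; split => // A GA.
  have [//|FnA] := in_ultra_setVsetC ([set n | A (gsum n f)]) gridU_ultra.
  have /(filterI GA) : G (~` A) by apply: sG.
  by rewrite setICr => /filter_not_empty.
have [|l [_ fl]] := cC _ GU.
  apply: (@filterS _ gridU _ setT) => [n _/=|]; last exact: filterT.
  by rewrite in_itv/= -ler_norml; exact: (gsum_bound n r0 fB).
by apply/cvg_ex; exists l.
Qed.

End functional.

Section calculus.
Variable R : realType.

Lemma strict_derive_cvg (V : normedModType R) (f : V -> R) (v z0 : V) I
    (F : set_system I) {FF : Filter F} (z : I -> V) (h : I -> R) :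
  (forall z, derivable f z v) -> {for z0, continuous ('D_v f)} ->
  z @ F --> z0 -> h @ F --> (0^')%classic ->
  (fun i => (h i)^-1 * (f (z i + h i *: v) - f (z i))) @ F --> 'D_v f z0.
Proof.
move=> df cf zz hh.
exact: (cvg_comp (fun i => (z i, h i)) _ (cvg_pair zz hh) (strict_derive df cf)).
Qed.

Lemma cvg_pt (U W : topologicalType) I (F : set_system I) {FF : Filter F}
    (f : I -> U) (g : I -> W) (a : U) (b : W) :
  f @ F --> a -> g @ F --> b -> (fun i => (f i, g i)) @ F --> (a, b).
Proof. by move=> fa gb; apply: (@cvg_pair _ _ _ _ (nbhs a) (nbhs b)). Qed.

Lemma mesh_cvg0 : mesh R @ \oo --> (0 : R).
Proof. exact: cvg_harmonic. Qed.

Lemma mesh_cvg : mesh R @ \oo --> (0^')%classic.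
Proof.
move=> A /= [e e0 eA]; suff : \forall n \near \oo, A (mesh R n) by [].
near=> n; apply: eA => /=; last by rewrite gt_eqF ?mesh_gt0.
by near: n; move/cvgrPdist_lt: mesh_cvg0; apply.
Unshelve. all: by end_near. Qed.

Lemma cvg_sum_seq I (T : eqType) (F : set_system I) {FF : Filter F} (s : seq T) (P : pred T)
    (f : T -> I -> R) (l : T -> R) :
  (forall t, P t -> f t @ F --> l t) ->
  (fun i => \sum_(t <- s | P t) f t i) @ F --> \sum_(t <- s | P t) l t.
Proof.
move=> fl; elim: s => [|t s ih].
  by rewrite big_nil; under eq_fun do rewrite big_nil; exact: cvg_cst.
rewrite big_cons; under eq_fun do rewrite big_cons.
by case: (boolP (P t)) => // Pt; apply: cvgD => //; exact: fl.
Qed.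

Lemma cvg_prod_seq I (T : eqType) (F : set_system I) {FF : Filter F} (s : seq T) (P : pred T)
    (f : T -> I -> R) (l : T -> R) :
  (forall t, P t -> f t @ F --> l t) ->
  (fun i => \prod_(t <- s | P t) f t i) @ F --> \prod_(t <- s | P t) l t.
Proof.
move=> fl; elim: s => [|t s ih].
  by rewrite big_nil; under eq_fun do rewrite big_nil; exact: cvg_cst.
rewrite big_cons; under eq_fun do rewrite big_cons.
by case: (boolP (P t)) => // Pt; apply: cvgM => //; exact: fl.
Qed.

Lemma continuous_det (T : topologicalType) n (M : T -> 'M[R]_n) :
  (forall i j, continuous (fun x => M x i j)) -> continuous (fun x => \det (M x)).
Proof.
move=> cM x; rewrite /continuous_at /determinant.
apply: cvg_sum_seq => s _; apply: cvgMl_tmp; apply: cvg_prod_seq => k _; exact: cM.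
Qed.

End calculus.

Section functional.
Variables (R : realType) (d : nat).
Local Notation E := 'rV[R]_d.
Local Notation ST := (R * E)%type.

#[local] Existing Instance gridU_proper.

Lemma ccfD (f g : E -> R) : ccf f -> ccf g -> ccf (fun x => f x + g x).
Proof.
move=> [cf [r fr]] [cg [s gs]]; split; first by move=> x; apply: (@continuousD _ _ _ f g x); [exact: cf|exact: cg].
exists (Num.max r s) => x; rewrite gt_max => /andP[rx sx].
by rewrite fr// gs// addr0.
Qed.

Lemma ccfMl (f g : E -> R) : continuous f -> ccf g -> ccf (fun x => f x * g x).
Proof.
move=> cf [cg [s gs]]; split; first by move=> x; apply: (@continuousM _ _ f g x); [exact: cf|exact: cg].
by exists s => x sx; rewrite gs// mulr0.
Qed.

Lemma ccfMr (f g : E -> R) : ccf f -> continuous g -> ccf (fun x => f x * g x).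
Proof.
move=> [cf [r fr]] cg; split; first by move=> x; apply: (@continuousM _ _ f g x); [exact: cf|exact: cg].
by exists r => x rx; rewrite fr// mul0r.
Qed.

Lemma ccfZ a (f : E -> R) : ccf f -> ccf (fun x => a * f x).
Proof. by move=> cf; apply: (@ccfMl (fun=> a) f) => //; exact: cst_continuous. Qed.

Lemma ccfB (f g : E -> R) : ccf f -> ccf g -> ccf (fun x => f x - g x).
Proof.
move=> cf cg; rewrite (_ : (fun x => _) = (fun x => f x + -1 * g x)).
  by apply: ccfD => //; exact: ccfZ.
by apply/funext => x; rewrite mulN1r.
Qed.

Lemma ccf0 : ccf (fun _ : E => 0 : R).
Proof. by split; [exact: cst_continuous | exists 0]. Qed.

Lemma ccf_sum I (s : seq I) (P : pred I) (f : I -> E -> R) : (forall i, ccf (f i)) ->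
  ccf (fun x => \sum_(i <- s | P i) f i x).
Proof.
move=> cf; elim: s => [|i s ih].
  rewrite (_ : (fun x => _) = fun=> 0); [exact: ccf0 | by apply/funext => x; rewrite big_nil].
rewrite (_ : (fun x => _) = fun x => if P i then f i x + \sum_(j <- s | P j) f j x else \sum_(j <- s | P j) f j x).
  by case: (P i) => //; exact: (ccfD (cf i) ih).
by apply/funext => x; rewrite big_cons.
Qed.

Lemma Lint_eq (f : E -> R) l : gsum n f @[n --> gridU] --> l -> Lint f = l.
Proof. exact: cvg_lim. Qed.

Lemma LintD (f g : E -> R) : ccf f -> ccf g -> Lint (fun x => f x + g x) = Lint f + Lint g.
Proof.
move=> cf cg; apply: Lint_eq; under eq_fun do rewrite gsumD.
by apply: cvgD; exact: Lint_cvg.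
Qed.

Lemma LintZ a (f : E -> R) : ccf f -> Lint (fun x => a * f x) = a * Lint f.
Proof.
move=> cf; apply: Lint_eq; under eq_fun do rewrite gsumZ.
by apply: cvgMl_tmp; exact: Lint_cvg.
Qed.

Lemma LintB (f g : E -> R) : ccf f -> ccf g -> Lint (fun x => f x - g x) = Lint f - Lint g.
Proof.
move=> cf cg; apply: Lint_eq; under eq_fun do rewrite gsumB.
by apply: cvgB; exact: Lint_cvg.
Qed.

Lemma Lint0 : Lint (fun _ : E => 0 : R) = 0.
Proof.
rewrite -[RHS](mul0r (Lint (fun _ : E => 0))) -LintZ ?mul0r//; last exact: ccf0.
Qed.

Lemma Lint_sum I (s : seq I) (P : pred I) (f : I -> E -> R) : (forall i, ccf (f i)) ->
  Lint (fun x => \sum_(i <- s | P i) f i x) = \sum_(i <- s | P i) Lint (f i).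
Proof.
move=> cf; elim: s => [|i s ih].
  by under eq_fun do rewrite big_nil; rewrite Lint0 big_nil.
under eq_fun do rewrite big_cons; rewrite big_cons; case: (P i) => //.
by rewrite LintD ?ih//; exact: ccf_sum.
Qed.

Lemma le_Lint (f g : E -> R) : ccf f -> ccf g -> (forall x, f x <= g x) -> Lint f <= Lint g.
Proof.
move=> cf cg fg; apply: (ler_cvg_to (Lint_cvg cf) (Lint_cvg cg)).
by apply: nearW => n; exact: le_gsum.
Qed.

Lemma Lint_ge0 (f : E -> R) : ccf f -> (forall x, 0 <= f x) -> 0 <= Lint f.
Proof. by move=> cf f0; rewrite -Lint0; apply: le_Lint => //; exact: ccf0. Qed.

Lemma Lint_bound (f : E -> R) r B : 0 <= r -> ccf f -> bsupp r B f ->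
  `|Lint f| <= B * (2 * r + 1) ^+ d.
Proof.
move=> r0 cf fB; apply: (cvgr_to_le (cvg_norm (Lint_cvg cf))).
by apply: nearW => n; exact: gsum_bound.
Qed.

(** The integrand q may vary with the mesh: this is how sums of difference
    quotients become integrals of derivatives. *)
Lemma Lint_cvg_of (f : E -> R) (q : E -> nat -> R) r : ccf f ->
  (forall x : E, (fun p => q p.1 p.2) @ filter_prod (nbhs x) \oo --> f x) ->
  (forall n x, r < `|x| -> q x n = 0) ->
  gsum n (q ^~ n) @[n --> gridU] --> Lint f.
Proof.
move=> cf qf qr; have [cf' [s fs]] := cf.
have : gsum n (fun x => q x n - f x) @[n --> \oo] --> (0 : R).
  apply: (@gsum_cvg0 _ _ (fun x n => q x n - f x) (Num.max r s)).
    move=> x; rewrite -[X in _ --> X](subrr (f x)); apply: cvgB; first exact: qf.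
    by apply: (cvg_comp _ _ (@cvg_fst _ _ _ _ _)); exact: cf'.
  by move=> n x; rewrite gt_max => /andP[rx sx]; rewrite qr// fs// subr0.
move=> /(cvg_trans (cvg_app _ gridU_oo)) q0.
rewrite -[X in _ --> X](add0r (Lint f)).
rewrite (_ : (fun n => _) = (fun n => gsum n (fun x => q x n - f x) + gsum n f)).
  by apply: cvgD => //; exact: Lint_cvg.
by apply/funext => n; rewrite gsumB subrK.
Qed.

(** The grid points of a cube around x0 number at least e^d / mesh^d, which
    bounds the Riemann sums below uniformly. *)
Lemma Lint_gt0 (f : E -> R) x0 : ccf f -> (forall x, 0 <= f x) -> 0 < f x0 -> 0 < Lint f.
Proof.
move=> cf f0 fx0; have [cf' _] := cf.
have [e e0 fe] : exists2 e : R, 0 < e & forall x, `|x0 - x| <= e -> f x0 / 2 <= f x.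
  have /nbhs_ballP[e/= e0 be] : \forall x \near x0, f x0 / 2 <= f x.
    by apply: (cvgr_ge _ (cf' x0)); rewrite ltr_pdivrMr//; lra.
  exists (e / 2); first by rewrite divr_gt0.
  move=> x xe; apply: be; rewrite -ball_normE/= (le_lt_trans xe)//.
  by rewrite ltr_pdivrMr//; lra.
apply: (@lt_le_trans _ _ (f x0 / 2 * e ^+ d)).
  by rewrite mulr_gt0 ?exprn_gt0// divr_gt0.
apply: (cvgr_to_ge (Lint_cvg cf)).
have : \forall n \near \oo, mesh R n < e / 2.
  have /cvgr0Pnorm_lt/(_ (e / 2)) := @mesh_cvg0 R; rewrite divr_gt0// => /(_ isT).
  by apply: filterS => n; rewrite gtr0_norm// mesh_gt0.
move=> nm; have nN : \forall n \near \oo, `|x0| + e <= n.+1%:R.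
  near=> n; apply: le_trans (_ : n%:R <= _); last by rewrite ler_nat.
  by near: n; exact: nbhs_infty_ger.
apply: gridU_oo; near=> n.
have m1 : mesh R n < e / 2 by near: n.
have N1 : `|x0| + e <= n.+1%:R by near: n.
pose g j (y : R) : R := (x0 0 j - e / 2 - mesh R n <= y <= x0 0 j + e / 2)%R%:R.
have gf (x : E) : f x0 / 2 * \prod_j g j (x 0 j) <= f x.
  have [xe|/negP xe] := boolP [forall j, x0 0 j - e / 2 - mesh R n <= x 0 j <= x0 0 j + e / 2].
    rewrite big1 ?mulr1; last by move=> j _; rewrite /g (forallP xe j).
    apply: fe; apply: norm_le_coord; first exact: ltW.
    move=> j; rewrite !mxE; have := forallP xe j; rewrite ler_norml => /andP[]; lra.
  have [j xj] : exists j, ~~ (x0 0 j - e / 2 - mesh R n <= x 0 j <= x0 0 j + e / 2).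
    by apply/existsP; rewrite -negb_forall; apply/negP.
  by rewrite (bigD1 j)//= {1}/g (negbTE xj) mul0r mulr0.
apply: le_trans (le_gsum n gf); rewrite gsumZ ler_wpM2l//; first by rewrite divr_ge0// ltW.
rewrite gsum_prod -[X in _ ^+ X <= _](card_ord d) -prodr_const.
apply: ler_prod => j _; rewrite (ltW e0)/=.
have := le_coord x0 j; rewrite ler_norml => /andP[h1 h2].
have : (x0 0 j + e / 2) - (x0 0 j - e / 2) <=
    mesh R n * \sum_(i < (gsize n).+1) g j (gpt R n i) by apply: gsum1_low; lra.
by apply: le_trans; lra.
Unshelve. all: by end_near. Qed.

End functional.

(** * Functions on spacetime with compact support in space *)

Section spacetime.
Variables (R : realType) (d : nat).
Local Notation E := 'rV[R]_d.
Local Notation ST := (R * E)%type.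
#[local] Existing Instance gridU_proper.

(** A record, so that differentiability and continuity goals are not compared
    with it by unfolding. *)
Record C1 (V W : normedModType R) (f : V -> W) : Prop := C1I {
  C1_diff : forall z, differentiable f z;
  C1_cont : forall v, continuous ('D_v f) }.

Lemma class_C1 (V W : normedModType R) (f : V -> W) : class_C 1 setT f -> C1 f.
Proof. by case=> df cf; split => [z|v z]; [exact: df|exact: cf]. Qed.

Lemma C1_differentiable (V W : normedModType R) (f : V -> W) z : C1 f -> differentiable f z.
Proof. by move/C1_diff; apply. Qed.

Lemma C1_derivable (V W : normedModType R) (f : V -> W) z v : C1 f -> derivable f z v.
Proof. by move=> cf; apply: diff_derivable; exact: C1_differentiable. Qed.

Lemma C1_continuous (V W : normedModType R) (f : V -> W) : C1 f -> continuous f.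
Proof. by move=> cf z; apply: differentiable_continuous; exact: C1_differentiable. Qed.

Lemma C1_D (V W : normedModType R) (f : V -> W) v : C1 f -> continuous ('D_v f).
Proof. by move/C1_cont; apply. Qed.

(** Compact support in space, uniformly on bounded time intervals: this allows
    differentiation in time under the integral over space. *)
Definition tcs (f : ST -> R) :=
  forall tau, exists r, forall t x, `|t| <= tau -> r < `|x| -> f (t, x) = 0.

Lemma cvg_slice (t : R) (x : E) : (fun y : E => (t, y)) @ x --> (t, x).
Proof.
have h1 : (fun _ : E => t) @ nbhs x --> t by exact: cvg_cst.
have h2 : (fun y : E => y) @ nbhs x --> x by [].
have h3 := cvg_pt h1 h2; exact: h3.
Qed.

Lemma slice_continuous (W : topologicalType) (f : ST -> W) t : continuous f -> continuous (fun x => f (t, x)).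
Proof. by move=> cf x; exact: (cvg_comp _ _ (@cvg_slice t x) (cf (t, x))). Qed.

Lemma slice_ccf (f : ST -> R) t : continuous f -> tcs f -> ccf (fun x => f (t, x)).
Proof.
move=> cf sf; split; first exact: slice_continuous.
by have [r fr] := sf `|t|; exists r => x; exact: fr.
Qed.

Lemma tcs_D (f : ST -> R) v : tcs f -> tcs ('D_v f).
Proof.
move=> sf tau; have [r fr] := sf (tau + 1); exists r => t x tt rx.
rewrite -[RHS](derive_cst (0 : R) (t, x) v); apply: near_eq_derive.
exists ([set s : R | `|s| < tau + 1], [set y : E | r < `|y|]) => /=.
  split; apply: open_nbhs_nbhs; split => //=.
  - apply: (@open_comp _ _ (fun s : R => `|s|) [set y | y < tau + 1]); last exact: open_lt.
    by move=> s _; exact: norm_continuous.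
  - by rewrite (le_lt_trans tt)// ltrDl.
  - apply: (@open_comp _ _ (fun s : E => `|s|) [set y | r < y]); last exact: open_gt.
    by move=> s _; exact: norm_continuous.
by move=> [s y]/= [s1 y1]; rewrite fr// ltW.
Qed.

Lemma norm_mesh_delta n j : `|mesh R n *: (delta_mx 0 j : E)| <= 1.
Proof.
apply: norm_le_coord => // i; rewrite !mxE eqxx/= normrM (ger0_norm (ltW (mesh_gt0 R n))).
by rewrite normr_nat; case: (_ == _); rewrite ?mulr1 ?mulr0 ?mesh_le1.
Qed.

(** The difference quotient in the direction j has Riemann sum 0 by
    [gsum_shift]. *)
Lemma Lint_dx (f : ST -> R) t j : C1 f -> tcs f -> Lint (fun x => dx j f (t, x)) = 0.
Proof.
move=> cf sf; have [r fr] := sf `|t|.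
pose v : ST := (0, delta_mx 0 j).
pose q (x : E) n := (mesh R n)^-1 * (f ((t, x) + mesh R n *: v) - f (t, x)).
have qE x n : q x n = (mesh R n)^-1 * (f (t, x + mesh R n *: delta_mx 0 j) - f (t, x)).
  by rewrite /q /v; congr (_ * (f (_, _) - _)) => /=; rewrite scaler0 addr0.
have cq : gsum n (q ^~ n) @[n --> gridU] --> Lint (fun x => dx j f (t, x)).
  apply: (@Lint_cvg_of _ _ _ _ (r + 1)).
  - by apply: slice_ccf; [exact: C1_D|exact: tcs_D].
  - move=> x; apply: (strict_derive_cvg (z := fun p => (t, p.1)) (h := fun p => mesh R p.2)).
    + by move=> z; exact: C1_derivable.
    + exact: C1_D.
    + exact: (cvg_pt (cvg_cst t) (@cvg_fst _ _ (nbhs x) \oo _)).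
    + exact: (cvg_comp _ _ (@cvg_snd _ _ (nbhs x) \oo _) (@mesh_cvg R)).
  - move=> n x rx; rewrite qE !fr ?subrr ?mulr0//; first lra.
    have h := norm_mesh_delta n j.
    by have := ler_normB (x + mesh R n *: (delta_mx 0 j : E)) (mesh R n *: delta_mx 0 j);
      rewrite addrK; lra.
apply: (cvg_unique (@norm_hausdorff _ _) cq).
apply: (cvg_trans (near_eq_cvg _) (cvg_cst (0 : R))).
have /gridU_oo : \forall n \near \oo, r + 1 <= n.+1%:R.
  near=> n; apply: le_trans (_ : n%:R <= _); last by rewrite ler_nat.
  by near: n; exact: nbhs_infty_ger.
apply: filterS => n rn /=; rewrite (_ : (fun x => q x n) = fun x => (mesh R n)^-1 *
    (f (t, x + mesh R n *: delta_mx 0 j) - f (t, x))); last by apply/funext => x.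
rewrite gsumZ gsumB (gsum_shift (f := fun x => f (t, x))) ?subrr ?mulr0// => x nx.
by rewrite fr//; lra.
Unshelve. all: by end_near. Qed.

(** The difference quotients in time converge uniformly on a ball containing
    their supports. *)
Lemma is_derive_Lint (f : ST -> R) t : C1 f -> tcs f ->
  is_derive t (1 : R) (fun s => Lint (fun x => f (s, x))) (Lint (fun x => dt f (t, x))).
Proof.
move=> cf sf; have cD := @C1_D _ _ f (1, 0) cf; have sD := @tcs_D f (1, 0) sf.
have [r0 fr0] := sf (`|t| + 1); pose r := Num.max r0 0.
have fr s x : `|s| <= `|t| + 1 -> r < `|x| -> f (s, x) = 0.
  by move=> st; rewrite gt_max => /andP[rx _]; exact: fr0.
have [r1 Dr0] := sD `|t|; pose r' := Num.max r r1.
have r'0 : 0 <= r' by rewrite /r' /r !le_max lexx !orbT.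
pose q (x : E) (h : R) := h^-1 * (f ((t, x) + h *: (1, 0)) - f (t, x)) - dt f (t, x).
have qE x h : q x h = h^-1 * (f (h + t, x) - f (t, x)) - dt f (t, x).
  rewrite /q; congr (_ * (f (_, _) - _) - _) => /=; first by rewrite [h *: 1]mulr1 addrC.
  by rewrite scaler0 addr0.
have cvgD : (fun h : R => h^-1 *: (Lint (fun x => f (h *: 1 + t, x)) - Lint (fun x => f (t, x)))) @
    (0^')%classic --> Lint (fun x => dt f (t, x)).
  apply/cvgrPdist_le => e e0.
  pose C := (2 * r' + 1) ^+ d; have C0 : 0 < C by apply: exprn_gt0; lra.
  have hq0 (x : E) : [set x : E | `|x| <= r'] x ->
      (fun p => q p.1 p.2) @ filter_prod (nbhs x) (0^')%classic --> (0 : R).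
    move=> _; rewrite /q -[X in _ --> X](subrr (dt f (t, x))); apply: cvgB.
      apply: (strict_derive_cvg (z := fun p => (t, p.1)) (h := fun p => p.2)).
      + by move=> z; exact: C1_derivable.
      + exact: C1_D.
      + exact: (cvg_pt (cvg_cst t) (@cvg_fst _ _ (nbhs x) (0^')%classic _)).
      + exact: (@cvg_snd _ _ (nbhs x) (0^')%classic _).
    have cs := slice_continuous (f := dt f) (t := t) cD.
    exact: (cvg_comp _ _ (@cvg_fst _ _ (nbhs x) (0^')%classic _) (cs x)).
  have H := cvg0_unif (@closed_ball_compact R d r') hq0 (divr_gt0 e0 C0).
  near=> h.
  have hq : forall x : E, `|x| <= r' -> `|q x h| <= e / C by near: h; exact: H.
  have h1 : `|h| <= 1 by near: h; exact: dnbhs0_le.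
  have cs s : ccf (fun x => f (s, x)) by apply: slice_ccf => //; exact: C1_continuous.
  have cDt : ccf (fun x => dt f (t, x)) by exact: slice_ccf.
  rewrite [h *: 1]mulr1 distrC -[h^-1 *: _]/(h^-1 * _) -LintB// -LintZ; last exact: ccfB.
  rewrite -LintB//; last by apply: ccfZ; exact: ccfB.
  rewrite -[leRHS](divfK (lt0r_neq0 C0)); apply: Lint_bound => //.
    by apply: ccfB => //; apply: ccfZ; exact: ccfB.
  split => x; rewrite -qE; last first.
    rewrite gt_max => /andP[rx r1x]; rewrite qE [dt f _]Dr0// !fr ?subrr ?mulr0 ?subr0//.
      by rewrite lerDl.
    by rewrite addrC (le_trans (ler_normD _ _))// lerD2l.
  have [/hq//|] := leP `|x| r'.
  rewrite gt_max => /andP[rx r1x]; rewrite qE [dt f _]Dr0// !fr ?subrr ?mulr0 ?subr0 ?normr0//.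
  - by rewrite divr_ge0// ltW.
  - by rewrite lerDl.
  - by rewrite addrC (le_trans (ler_normD _ _))// lerD2l.
by split; [apply/cvg_ex; eexists; exact: cvgD | exact: cvg_lim cvgD].
Unshelve. all: by end_near. Qed.

End spacetime.

(** * Transported densities have constant integrals *)

Section transport_invariance.
Variables (R : realType) (d : nat).
Local Notation E := 'rV[R]_d.
Local Notation ST := (R * E)%type.
#[local] Existing Instance gridU_proper.

(** The coordinate directions of spacetime, the time direction being scaled by
    D: with a time step D / (n+1), the grid with mesh 1/(n+1) leads from t0 to
    t0 + D in n+1 steps. *)
Definition dir (D : R) (j : 'I_d.+1) : ST :=
  if unlift ord0 j is Some i then (0, delta_mx 0 i) else (D, 0).

Definition st_jacobian (f : 'I_d.+1 -> ST -> R) z : 'M[R]_d.+1 :=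
  \matrix_(i, j) 'D_(dir 1 j) (f i) z.

Definition sp_jacobian (f : 'I_d.+1 -> ST -> R) z : 'M[R]_d :=
  \matrix_(i, j) dx j (f (lift ord0 i)) z.

Lemma dir0 D : dir D ord0 = (D, 0). Proof. by rewrite /dir unlift_none. Qed.

Lemma dirS D j : dir D (lift ord0 j) = (0, delta_mx 0 j).
Proof. by rewrite /dir liftK. Qed.

Lemma det_dir (f : 'I_d.+1 -> ST -> R) D z : (forall i, C1 (f i)) ->
  \det (st_jacobian f z) = 0 -> \det (\matrix_(i, j) 'D_(dir D j) (f i) z) = 0.
Proof.
move=> cf J0; rewrite (_ : (\matrix_(i, j) _) =
    st_jacobian f z *m diag_mx (\row_j (if j == ord0 then D else 1))).
  by rewrite det_mulmx J0 mul0r.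
apply/matrixP => i j; rewrite [LHS]mxE mul_mx_diag [RHS]mxE [X in X * _]mxE [X in _ * X]mxE.
have [j' ->|->] := unliftP ord0 j; first by rewrite !dirS mulr1.
rewrite eqxx !dir0 !deriveE; [|exact: C1_differentiable..].
have -> : (D, 0) = D *: ((1, 0) : ST) by congr (_, _); rewrite ?[_ *: _]mulr1 ?scaler0.
by rewrite linearZ/= [_ *: _]mulrC.
Qed.

(** The form f_0 df_1 ... df_d has differential det(D f) = 0, so its integrals
    over time slices agree. The proof replaces the form by its
    finite-difference version on a grid of spacetime. By [cup_stokes] the
    change of the sum over one time step is a sum of cup products, the
    contributions of the spatial walls being cancelled by translation
    invariance. Cup products are o(mesh^(d+1)) because their leading term is
    the vanishing Jacobian, and n+1 time steps add up to o(1). *)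
Lemma transport_invariance (f : 'I_d.+1 -> ST -> R) : (forall i, C1 (f i)) ->
  tcs (f ord0) -> (forall z, \det (st_jacobian f z) = 0) ->
  forall t0 t1, Lint (fun x => f ord0 (t0, x) * \det (sp_jacobian f (t0, x))) =
                Lint (fun x => f ord0 (t1, x) * \det (sp_jacobian f (t1, x))).
Proof.
move=> cf sf J0 t0 t1; pose D := t1 - t0.
pose e n j := mesh R n *: dir D j.
pose N n : R := (mesh R n)^-1.
pose tau := `|t0| + `|D|.
have [r0 fr0] := sf tau; pose r := Num.max r0 0.
have fr t x : `|t| <= tau -> r < `|x| -> f ord0 (t, x) = 0.
  by move=> tt; rewrite gt_max => /andP[rx _]; exact: fr0.
have r_ge0 : 0 <= r by rewrite le_max lexx orbT.
have cst0 I (F : set_system I) (FF : Filter F) (z : I -> ST) (h : I -> nat) (z0 : ST)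
    (P : pred 'I_d.+1) (s : 'S_d.+1) : z @ F --> z0 -> h @ F --> \oo ->
    (fun i => z i + \sum_(j | P j) e (h i) (s j)) @ F --> z0.
  move=> zz hh.
  have h0 : (fun i => \sum_(j | P j) e (h i) (s j)) @ F --> (0 : ST).
    have -> : (fun i => \sum_(j | P j) e (h i) (s j)) =
        (fun i => mesh R (h i) *: \sum_(j | P j) dir D (s j)).
      by apply/funext => i; rewrite scaler_sumr.
    have := @cvgZr_tmp R ST I F FF _ _ (\sum_(j | P j) dir D (s j))
      (cvg_comp _ _ hh (@mesh_cvg0 R)).
    by rewrite scale0r.
  by have := @cvgD R ST I F FF _ _ _ _ zz h0; rewrite addr0.
pose q0 (s : 'S_d.+1) k (z : ST) n := N n * incr f (e n) s k z.
pose q1 (s : 'S_d.+1) k (z : ST) n := N n * incr1 f (e n) s k z.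
have q0cvg I (F : set_system I) (FF : Filter F) (z : I -> ST) (h : I -> nat) (z0 : ST) s k :
    z @ F --> z0 -> h @ F --> \oo ->
    (fun i => q0 s k (z i) (h i)) @ F --> 'D_(dir D (s k)) (f k) z0.
  move=> zz hh; rewrite /q0 /incr.
  have -> : (fun i => N (h i) * (f k (z i + stairs (e (h i)) s k.+1) - f k (z i + stairs (e (h i)) s k)))
      = (fun i => (mesh R (h i))^-1 * (f k ((z i + stairs (e (h i)) s k) + mesh R (h i) *: dir D (s k))
           - f k (z i + stairs (e (h i)) s k))).
    apply/funext => i; rewrite -addrA; congr (_ * (f k (_ + _) - _)).
    rewrite /stairs (bigD1 k)//= addrC; congr (_ + _); apply: eq_bigl => j.
    by rewrite ltnS ltn_neqAle andbC.
  apply: (strict_derive_cvg (z := fun i => z i + stairs (e (h i)) s k) (h := fun i => mesh R (h i))).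
  - by move=> ?; exact: C1_derivable.
  - exact: C1_D.
  - exact: cst0.
  - exact: (cvg_comp _ _ hh (@mesh_cvg R)).
have q1cvg I (F : set_system I) (FF : Filter F) (z : I -> ST) (h : I -> nat) (z0 : ST) s k :
    k != ord0 -> z @ F --> z0 -> h @ F --> \oo ->
    (fun i => q1 s k (z i) (h i)) @ F --> 'D_(dir D (s k)) (f k) z0.
  move=> k0 zz hh; rewrite /q1 /incr1.
  have -> : (fun i => N (h i) * (f k (z i + stairs1 (e (h i)) s k.+1) - f k (z i + stairs1 (e (h i)) s k)))
      = (fun i => (mesh R (h i))^-1 * (f k ((z i + stairs1 (e (h i)) s k) + mesh R (h i) *: dir D (s k))
           - f k (z i + stairs1 (e (h i)) s k))).
    apply/funext => i; rewrite -addrA; congr (_ * (f k (_ + _) - _)).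
    rewrite /stairs1 (bigD1 k)/=; last by rewrite ltnS leqnn andbT lt0n.
    rewrite addrC; congr (_ + _); apply: eq_bigl => j.
    rewrite -andbA ltnS -(inj_eq val_inj)/= [(j < k)%N]ltn_neqAle.
    by case: (0 < j)%N; case: (j <= k)%N; case: (_ == _ :> nat).
  apply: (strict_derive_cvg (z := fun i => z i + stairs1 (e (h i)) s k) (h := fun i => mesh R (h i))).
  - by move=> ?; exact: C1_derivable.
  - exact: C1_D.
  - exact: cst0.
  - exact: (cvg_comp _ _ hh (@mesh_cvg R)).
pose cupN (z : ST) n := N n ^+ d.+1 * cup f (e n) z.
pose W n (z : ST) := \sum_(s : 'S_d.+1 | s ord0 == ord0) (-1) ^+ s * wall f (e n) s z.
pose A n t := gsum n (fun x => N n ^+ d * W n (t, x)).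
(* Rescaled, the cup product tends to the Jacobian, which is zero. *)
have cupNcvg I (F : set_system I) (FF : Filter F) (z : I -> ST) (h : I -> nat) (z0 : ST) :
    z @ F --> z0 -> h @ F --> \oo -> (fun i => cupN (z i) (h i)) @ F --> (0 : R).
  move=> zz hh; rewrite -(@det_dir f D z0 cf (J0 z0)) /determinant.
  have -> : (fun i => cupN (z i) (h i)) =
      (fun i => \sum_(s : 'S_d.+1) (-1) ^+ s * \prod_k q0 s k (z i) (h i)).
    apply/funext => i; rewrite /cupN /cup mulr_sumr; apply: eq_bigr => s _.
    by rewrite /q0 big_split/= prodr_const card_ord mulrCA.
  apply: cvg_sum_seq => s _; apply: cvgMl_tmp; apply: cvg_prod_seq => k _.
  by rewrite mxE; exact: q0cvg.
(* The permutations with s ord0 = ord0 take the time direction first; they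
   correspond to the terms of the spatial determinant. *)
have WNcvg t (x : E) :
   (fun p => N p.2 ^+ d * W p.2 (t, p.1)) @ filter_prod (nbhs x) \oo -->
   f ord0 (t, x) * \det (sp_jacobian f (t, x)).
  have z0cvg : (fun p : E * nat => (t, p.1)) @ filter_prod (nbhs x) \oo --> (t, x).
    exact: (cvg_pt (cvg_cst t) (@cvg_fst _ _ (nbhs x) \oo _)).
  have hcvg : (fun p : E * nat => p.2) @ filter_prod (nbhs x) \oo --> \oo.
    exact: (@cvg_snd _ _ (nbhs x) \oo _).
  have -> : f ord0 (t, x) * \det (sp_jacobian f (t, x)) =
     \sum_(s : 'S_d.+1 | s ord0 == ord0) (-1) ^+ s * (f ord0 (t, x) *
       \prod_(k | k != ord0) 'D_(dir D (s k)) (f k) (t, x)).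
    pose J := \matrix_(i, j) (if i == ord0 then (j == ord0)%:R else 'D_(dir D j) (f i) (t, x)).
    have -> : \det (sp_jacobian f (t, x)) = \det J.
      rewrite (expand_det_row J ord0) (bigD1 ord0)//= mxE !eqxx mul1r.
      rewrite big1 ?addr0; last by move=> j /negbTE j0; rewrite !mxE eqxx j0 mul0r.
      rewrite /cofactor expr0 mul1r; congr (\det _); apply/matrixP => i j.
      by rewrite !mxE eq_sym (negbTE (neq_lift _ _)) dirS.
    rewrite [in LHS]/determinant (bigID (fun s : 'S_d.+1 => s ord0 == ord0))/=.
    rewrite [X in _ * (_ + X)]big1 ?addr0; last first.
      by move=> s /negbTE s0; rewrite (bigD1 ord0)//= mxE eqxx s0 mul0r mulr0.
    rewrite mulr_sumr; apply: eq_bigr => s /eqP s0.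
    rewrite mulrCA; congr (_ * (_ * _)); rewrite (bigD1 ord0)//= mxE eqxx s0 eqxx mul1r.
    by apply: eq_bigr => k k0; rewrite mxE (negbTE k0).
  have -> : (fun p : E * nat => N p.2 ^+ d * W p.2 (t, p.1)) =
     (fun p => \sum_(s : 'S_d.+1 | s ord0 == ord0) (-1) ^+ s * (f ord0 (t, p.1) *
       \prod_(k | k != ord0) q1 s k (t, p.1) p.2)).
    apply/funext => p; rewrite /W mulr_sumr; apply: eq_bigr => s _.
    rewrite /q1 big_split/= prodr_const /wall mulrCA; congr (_ * _).
    rewrite mulrCA; congr (_ * (_ ^+ _ * _)).
    by rewrite cardC1 card_ord.
  apply: cvg_sum_seq => s _; apply: cvgMl_tmp; apply: cvgM.
    have cfx := slice_continuous (f := f ord0) (t := t) (C1_continuous (cf ord0)).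
    exact: (cvg_comp _ _ (@cvg_fst _ _ (nbhs x) \oo _) (cfx x)).
  by apply: cvg_prod_seq => k k0; exact: q1cvg.
have cupsupp t x n : `|t| <= tau -> `|t + mesh R n * D| <= tau -> r + 1 < `|x| -> cupN (t, x) n = 0.
  move=> tt tt' rx; rewrite /cupN /cup big1 ?mulr0// => s _.
  rewrite (bigD1 ord0)//= incr0E [X in _ - X]fr//; last by lra.
  rewrite /e; have [j ->|->] := unliftP ord0 (s ord0).
    rewrite dirS (_ : (t, x) + _ = (t, x + mesh R n *: delta_mx 0 j)); last first.
      by congr (_, _); rewrite /= scaler0 addr0.
    rewrite fr ?subrr ?mul0r ?mulr0//.
    have h := @norm_mesh_delta R d n j.
    by have := ler_normB (x + mesh R n *: (delta_mx 0 j : E)) (mesh R n *: delta_mx 0 j);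
      rewrite addrK; lra.
  rewrite dir0 (_ : (t, x) + _ = (t + mesh R n * D, x)); last first.
    by congr (_, _); rewrite /= scaler0 addr0.
  by rewrite fr ?subrr ?mul0r ?mulr0//; lra.
(* One time step: the sum over s with s ord0 <> ord0 vanishes by
   translation. *)
have step t n : `|t| <= tau -> r < n.+1%:R ->
    A n (t + mesh R n * D) - A n t = mesh R n * gsum n (fun x => cupN (t, x) n).
  move=> tt rn; have Ndm : N n ^+ d = mesh R n * N n ^+ d.+1.
    by rewrite exprS mulrA mulfV ?mul1r// gt_eqF// mesh_gt0.
  rewrite /A /cupN !gsumZ mulrA -Ndm -mulrBr; congr (_ * _).
  have -> : (fun x => cup f (e n) (t, x)) = (fun x => \sum_(s : 'S_d.+1)
     (-1) ^+ s * (wall f (e n) s ((t, x) + e n (s ord0)) - wall f (e n) s (t, x))).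
    by apply/funext => x; rewrite cup_stokes.
  rewrite [RHS]gsum_sum [RHS](bigID (fun s : 'S_d.+1 => s ord0 == ord0))/= [X in _ = _ + X]big1 ?addr0; last first.
    move=> s s0; rewrite gsumZ gsumB; have [j sj|sj] := unliftP ord0 (s ord0); last first.
      by rewrite sj eqxx in s0.
    have -> : (fun x => wall f (e n) s ((t, x) + e n (s ord0))) =
        (fun x => wall f (e n) s (t, x + mesh R n *: delta_mx 0 j)).
      apply/funext => x; rewrite sj /e dirS; congr (wall _ _ _ (_, _)).
      by rewrite /= scaler0 addr0.
    rewrite (gsum_shift (f := fun x => wall f (e n) s (t, x))) ?subrr ?mulr0// => x nx.
    by rewrite /wall fr ?mul0r//; exact: lt_le_trans nx.
  rewrite /W !gsum_sum -sumrB; apply: eq_bigr => s /eqP s0.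
  rewrite !gsumZ gsumB [RHS]mulrBr s0; congr (_ * gsum n _ - _).
  apply/funext => x; rewrite /e dir0; congr (wall _ _ _ (_, _)).
  by rewrite /= scaler0 addr0.
have Acvg t : `|t| <= tau -> A n t @[n --> gridU] --> Lint (fun x => f ord0 (t, x) * \det (sp_jacobian f (t, x))).
  move=> tt; apply: (@Lint_cvg_of _ _ _ (fun x n => N n ^+ d * W n (t, x)) r).
  - have [cl [s ls]] := @slice_ccf R d (f ord0) t (C1_continuous (cf ord0)) sf.
    split; last by exists s => x sx; rewrite ls// mul0r.
    have cJ := @continuous_det R E _ (fun x => sp_jacobian f (t, x)).
    move=> x; apply: (@continuousM _ _ (fun x => f ord0 (t, x)) (fun x => \det (sp_jacobian f (t, x)))); first exact: cl.
    apply: cJ => i j; rewrite (_ : (fun x => _) = fun x => dx j (f (lift ord0 i)) (t, x)).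
      by apply: slice_continuous; exact: C1_D.
    by apply/funext => y; rewrite mxE.
  - exact: WNcvg.
  - move=> n x rx; rewrite /W big1 ?mulr0// => s _.
    by rewrite /wall fr// mul0r mulr0.
have tD (a : R) : 0 <= a -> a <= 1 -> `|t0 + a * D| <= tau.
  move=> a0 a1; rewrite (le_trans (ler_normD _ _))// lerD2l normrM ger0_norm//.
  by rewrite ler_piMl.
have t0tau : `|t0| <= tau by rewrite lerDl.
have t1tau : `|t1| <= tau by have := tD 1 ler01 (lexx _); rewrite mul1r addrC subrK.
suff A01 : A n t1 - A n t0 @[n --> gridU] --> (0 : R).
  apply/eqP; rewrite eq_sym -subr_eq0; apply/eqP.
  exact: (cvg_unique (@norm_hausdorff _ _) (cvgB (Acvg _ t1tau) (Acvg _ t0tau)) A01).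
suff : A n t1 - A n t0 @[n --> \oo] --> (0 : R).
  by move=> h X hX; apply: gridU_oo; exact: h.
apply/cvgr0Pnorm_le => eps eps0.
pose C := (2 * (r + 1) + 1) ^+ d; have C0 : 0 < C by apply: exprn_gt0; lra.
have cK : compact ([set t : R | `|t| <= tau] `*` [set x : E | `|x| <= r + 1]) by exact: compact_box.
have cup0 (z : ST) : ([set t : R | `|t| <= tau] `*` [set x : E | `|x| <= r + 1]) z ->
    (fun p => cupN p.1 p.2) @ filter_prod (nbhs z) \oo --> (0 : R).
  move=> _; apply: cupNcvg.
    exact: (@cvg_fst _ _ (nbhs z) \oo _).
  exact: (@cvg_snd _ _ (nbhs z) \oo _).
have H := cvg0_unif cK cup0 (divr_gt0 eps0 C0).
near=> n.
have cupe : forall z : ST, ([set t : R | `|t| <= tau] `*` [set x : E | `|x| <= r + 1]) z ->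
   `|cupN z n| <= eps / C by near: n; exact: H.
have rn : r < n.+1%:R.
  apply: (@le_lt_trans _ _ n%:R); last by rewrite ltr_nat.
  by near: n; exact: nbhs_infty_ger.
have m0 := mesh_gt0 R n.
have -> : A n t1 = A n (t0 + n.+1%:R * (mesh R n * D)).
  by rewrite mulrA [n.+1%:R * _]mulrC mesh_mul mul1r addrC subrK.
have telesc k : (k <= n.+1)%N ->
    `|A n (t0 + k%:R * (mesh R n * D)) - A n t0| <= k%:R * (mesh R n * eps).
  elim: k => [|k ih] kn; first by rewrite !mul0r addr0 subrr normr0.
  have ka (i : nat) : (i <= n.+1)%N -> `|t0 + i%:R * (mesh R n * D)| <= tau.
    move=> i_n; rewrite mulrA; apply: tD; first by rewrite mulr_ge0 ?ler0n// ltW.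
    by rewrite /mesh ler_pdivrMr ?ltr0n// mul1r ler_nat.
  have -> : t0 + k.+1%:R * (mesh R n * D) = t0 + k%:R * (mesh R n * D) + mesh R n * D.
    by rewrite -natr1 mulrDl mul1r addrA.
  rewrite -[X in `|X|](subrKA (A n (t0 + k%:R * (mesh R n * D)))).
  rewrite (le_trans (ler_normD _ _))// step//; last by apply: ka; exact: ltnW.
  rewrite -natr1 mulrDl mul1r [leLHS]addrC; apply: lerD; first exact: ih (ltnW kn).
  rewrite normrM (gtr0_norm m0) ler_wpM2l//; first exact: ltW.
  rewrite -[leRHS](divfK (lt0r_neq0 C0)); apply: gsum_bound; first lra.
  have e1 : `|t0 + k%:R * (mesh R n * D)| <= tau by apply: ka; exact: ltnW.
  have e2 : `|t0 + k%:R * (mesh R n * D) + mesh R n * D| <= tau.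
    by have := ka _ kn; rewrite -natr1 mulrDl mul1r addrA.
  split => x; last by move=> rx; exact: cupsupp.
  have [xr|xr] := leP `|x| (r + 1); first exact: cupe.
  by rewrite cupsupp// normr0 divr_ge0// ltW.
apply: le_trans (telesc _ (leqnn _)) _.
by rewrite mulrA [n.+1%:R * _]mulrC mesh_mul mul1r.
Unshelve. all: by end_near. Qed.

End transport_invariance.

(** * Differential inequalities and straight lines *)

Section ode.
Variable R : realType.

Lemma le_of_derive (f df : R -> R) (a b : R) : a <= b ->
  (forall x, a <= x <= b -> is_derive x (1 : R) f (df x)) ->
  (forall x, a <= x <= b -> 0 <= df x) -> f a <= f b.
Proof.
move=> ab fd df0; have cf : {within `[a, b], continuous f}.
  apply: derivable_within_continuous => x; rewrite in_itv/= => xab.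
  by have [] := fd x xab.
have [x xab|c + E] := MVT_segment ab (f := f) (df := df) _ cf.
  by apply: fd; move: xab; rewrite in_itv/= => /andP[? ?]; rewrite !ltW.
by rewrite in_itv/= => cab; rewrite -subr_ge0 E mulr_ge0 ?subr_ge0// df0.
Qed.

(** Compares f with exp (K s) and exp (- K s) on the two sides of s0. *)
Lemma gronwall0 (f df : R -> R) (a b s0 K : R) : a <= s0 <= b ->
  (forall s, a <= s <= b -> is_derive s (1 : R) f (df s)) ->
  (forall s, a <= s <= b -> 0 <= f s) ->
  (forall s, a <= s <= b -> `|df s| <= K * f s) ->
  f s0 = 0 -> forall s, a <= s <= b -> f s = 0.
Proof.
move=> /andP[as0 s0b] fd f0 fK fs0 s /andP[as_ sb].
have eD (e : R) x : is_derive x (1 : R) (fun y => expR (e * y)) (e * expR (e * x)).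
  by apply: is_derive_eq; rewrite mulrC [_ *: _]mulr1 ?scaler1.
apply/eqP; rewrite eq_le f0 ?as_//= andbT.
have [ss0|ss0] := leP s s0.
  have := @le_of_derive (fun y => f y * expR (K * y))
     (fun y => f y * (K * expR (K * y)) + expR (K * y) * df y) s s0 ss0.
  rewrite fs0 mul0r pmulr_lle0 ?expR_gt0//; apply=> x /andP[sx xs].
    have xab : a <= x <= b by rewrite (le_trans as_)//= (le_trans xs).
    by apply: (@is_deriveM _ _ f _ x 1 _ _ (fd _ xab) (eD _ _)).
  have xab : a <= x <= b by rewrite (le_trans as_)//= (le_trans xs).
  rewrite mulrCA mulrA [_ * df x]mulrC -mulrDl mulr_ge0 ?expR_ge0//.
  by have := fK x xab; rewrite ler_norml mulrC => /andP[]; lra.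
have := @le_of_derive (fun y => - (f y * expR (- K * y)))
   (fun y => - (f y * (- K * expR (- K * y)) + expR (- K * y) * df y)) s0 s (ltW ss0).
rewrite fs0 mul0r oppr0 oppr_ge0 pmulr_lle0 ?expR_gt0//; apply=> x /andP[sx xs].
  have xab : a <= x <= b by rewrite (le_trans as0)//= (le_trans xs).
  apply: is_deriveN.
  by apply: (@is_deriveM _ _ f _ x 1 _ _ (fd _ xab) (eD _ _)).
have xab : a <= x <= b by rewrite (le_trans as0)//= (le_trans xs).
rewrite mulrCA mulrA [_ * df x]mulrC -mulrDl oppr_ge0 pmulr_lle0 ?expR_gt0//.
by have := fK x xab; rewrite ler_norml mulrC => /andP[]; lra.
Qed.

End ode.

Section spacetime_calculus.
Variables (R : realType) (d : nat).
Local Notation E := 'rV[R]_d.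
Local Notation ST := (R * E)%type.

Lemma derive_split (f : ST -> R) (a : R) (v : E) z : C1 f ->
  'D_((a, v) : ST) f z = a * dt f z + \sum_j v 0 j * dx j f z.
Proof.
move=> cf; have df := C1_differentiable z cf.
have -> : (a, v) = a *: ((1, 0) : ST) + \sum_j v 0 j *: ((0, delta_mx 0 j) : ST).
  have -> : \sum_j v 0 j *: ((0, delta_mx 0 j) : ST) = (0, v).
    rewrite {2}(row_sum_delta v); elim/big_ind2 : _ => //.
      by move=> x1 x2 y1 y2 -> ->; congr (_, _); rewrite /= ?addr0.
    by move=> i _; congr (_, _); rewrite /= scaler0.
  by congr (_, _); rewrite /= ?scaler0 ?add0r// addr0 [_ *: _]mulr1.
rewrite deriveE// linearD linearZ linear_sum/= /dt deriveE//; congr (_ + _).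
by apply: eq_bigr => j _; rewrite linearZ /dx deriveE.
Qed.

Lemma C1_coord (u : ST -> E) i : C1 u -> C1 (fun z => u z 0 i).
Proof.
move=> cu; apply: C1I => [z|v].
  exact: (differentiable_comp (C1_differentiable z cu) (differentiable_coord _ 0 i)).
rewrite (_ : 'D_v _ = fun z => 'D_v u z 0 i).
  move=> z; have h1 := (@C1_D _ _ _ u v cu z); have h2 := (@coord_continuous R 1 d 0 i ('D_v u z)); exact: (cvg_comp _ _ h1 h2).
by apply/funext => z; rewrite derive_mx ?mxE//; exact: C1_derivable.
Qed.

Lemma derive_coord (u : ST -> E) i v z : C1 u ->
  'D_v u z 0 i = 'D_v (fun z => u z 0 i) z.
Proof. by move=> cu; rewrite derive_mx ?mxE//; exact: C1_derivable. Qed.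

Definition line (t0 : R) (y0 v : E) (s : R) : ST := (s, y0 + (s - t0) *: v).

Lemma lineE t0 y0 v s : line t0 y0 v s = (0, y0 - t0 *: v) + s *: ((1, v) : ST).
Proof.
congr (_, _); first by rewrite /= add0r [_ *: _]mulr1.
by rewrite scalerBl /= -addrA [- _ + _]addrC.
Qed.

Lemma is_derive_lineC1 (f : ST -> R) t0 y0 v (s : R) : C1 f ->
  is_derive s (1 : R) (fun r => f (line t0 y0 v r)) ('D_((1, v) : ST) f (line t0 y0 v s)).
Proof.
move=> cf; rewrite lineE (_ : (fun r => _) = fun r => f ((0, y0 - t0 *: v) + r *: ((1, v) : ST))).
  by apply: is_derive_line; exact: C1_derivable.
by apply/funext => r; rewrite lineE.
Qed.

Lemma line_continuous t0 y0 v : continuous (line t0 y0 v).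
Proof.
rewrite (_ : line _ _ _ = fun s => (0, y0 - t0 *: v) + s *: ((1, v) : ST)); last first.
  by apply/funext => s; rewrite lineE.
move=> s; apply: (@continuousD R ST R (fun=> (0, y0 - t0 *: v)) (fun s => s *: ((1, v) : ST))).
  exact: cst_continuous.
exact: scalel_continuous.
Qed.

End spacetime_calculus.

(** * Vacuum moves along straight lines *)

Lemma compact_bound (T : topologicalType) (R : realType) (K : set T) (f : T -> R) :
  compact K -> continuous f -> exists2 M, 0 <= M & forall x, K x -> `|f x| <= M.
Proof.
move=> cK cf; have [->|/set0P K0] := eqVneq K set0; first by exists 0.
have [|c _ cM] := compact_EVT_max (f := fun x => `|f x|) K0 cK.
  apply: continuous_subspaceT => x.
  by apply: (cvg_comp _ _ (cf x)); exact: norm_continuous.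
by exists `|f c| => // x Kx; apply: cM; rewrite inE.
Qed.

Section flow.
Variables (R : realType) (d : nat).
Local Notation E := 'rV[R]_d.
Local Notation ST := (R * E)%type.

(** The equations for b = c / k, written by components. *)
Record euler_flow (k : R) (b : ST -> R) (u : ST -> E) : Prop := EulerFlow {
  flow_gt0 : 0 < k;
  flow_b_C1 : C1 b;
  flow_u_C1 : C1 u;
  flow_b_ge0 : forall z, 0 <= b z;
  flow_mass : forall z, dt b z + \sum_j u z 0 j * dx j b z + k * b z * div u z = 0;
  flow_momentum : forall z i, dt (fun y => u y 0 i) z +
    \sum_j u z 0 j * dx j (fun y => u y 0 i) z + k * b z * dx i b z = 0 }.

Variables (k : R) (b : ST -> R) (u : ST -> E).
Hypothesis fl : euler_flow k b u.

Local Notation uc i := (fun y : ST => u y 0 i).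

Let k_gt0 := flow_gt0 fl.
Let b_C1 := flow_b_C1 fl.
Let u_C1 := flow_u_C1 fl.
Let b_ge0 := flow_b_ge0 fl.
Let uc_C1 i : C1 (uc i). Proof. exact: C1_coord. Qed.
Let dxb j : continuous (dx j b). Proof. exact: (@C1_D _ _ _ b _ b_C1). Qed.
Let dxu i j : continuous (dx j (uc i)). Proof. exact: (@C1_D _ _ _ (uc i) _ (uc_C1 i)). Qed.

Lemma continuous_sum_ord (T : topologicalType) n (f : 'I_n -> T -> R) :
  (forall i, continuous (f i)) -> continuous (fun x => \sum_i f i x).
Proof. by move=> cf x; apply: cvg_sum_seq => i _; exact: cf. Qed.

Lemma continuous_normr (T : topologicalType) (f : T -> R) : continuous f -> continuous (fun x => `|f x|).
Proof. by move=> cf x; apply: (cvg_comp _ _ (cf x)); exact: norm_continuous. Qed.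

Lemma div_continuous : continuous (div u).
Proof. by apply: continuous_sum_ord => i; exact: dxu. Qed.

(** One continuous function bounding all the coefficients which occur in the
    Gronwall estimates. *)
Definition slope (z : ST) : R := \sum_i \sum_j `|dx j (uc i) z| + k * \sum_i `|dx i b z|
  + \sum_i `|dx i b z| + k * `|div u z|.

Lemma slope_continuous : continuous slope.
Proof.
have cb : continuous (fun z => \sum_i `|dx i b z|).
  by apply: continuous_sum_ord => i; exact: continuous_normr.
have ck (f : ST -> R) : continuous f -> continuous (fun z => k * f z).
  by move=> cf z; apply: cvgMl_tmp; exact: cf.
move=> z; apply: (@continuousD _ _ _ (fun z => \sum_i \sum_j `|dx j (uc i) z| + k * \sum_i `|dx i b z|
  + \sum_i `|dx i b z|) (fun z => k * `|div u z|)); last first.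
  by apply: ck; apply: continuous_normr; exact: div_continuous.
apply: (@continuousD _ _ _ (fun z => \sum_i \sum_j `|dx j (uc i) z| + k * \sum_i `|dx i b z|)
  (fun z => \sum_i `|dx i b z|)); last exact: cb.
apply: (@continuousD _ _ _ (fun z => \sum_i \sum_j `|dx j (uc i) z|) (fun z => k * \sum_i `|dx i b z|)).
  by apply: continuous_sum_ord => i; apply: continuous_sum_ord => j; exact: continuous_normr.
exact: ck.
Qed.

Lemma slope_ge0 z : 0 <= slope z.
Proof.
rewrite /slope !addr_ge0 ?mulr_ge0// ?(ltW k_gt0)// ?sumr_ge0// => i _.
by rewrite sumr_ge0.
Qed.

Lemma derive_uc_line (v : E) z i : 'D_((1, v) : ST) (uc i) z =
  \sum_j (v 0 j - u z 0 j) * dx j (uc i) z - k * b z * dx i b z.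
Proof.
rewrite (derive_split _ _ _ (uc_C1 i)) mul1r; have /eqP := flow_momentum fl z i.
rewrite addr_eq0 => /eqP <-; under [X in _ = X + _]eq_bigr do rewrite mulrBl.
by rewrite sumrB; lra.
Qed.

Lemma derive_b_line (v : E) z : 'D_((1, v) : ST) b z =
  \sum_j (v 0 j - u z 0 j) * dx j b z - k * b z * div u z.
Proof.
rewrite (derive_split _ _ _ b_C1) mul1r; have /eqP := flow_mass fl z.
rewrite addr_eq0 => /eqP <-; under [X in _ = X + _]eq_bigr do rewrite mulrBl.
by rewrite sumrB; lra.
Qed.

(** On the line, g = |u - v|^2 + b^2 satisfies |g'| <= 2 slope g, since along
    the direction (1, v) the equations express the derivatives of u and b by
    terms linear in u - v and b; g vanishes at t0. *)
Lemma vacuum_line t0 y0 : b (t0, y0) = 0 -> forall s,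
  b (line t0 y0 (u (t0, y0)) s) = 0 /\ u (line t0 y0 (u (t0, y0)) s) = u (t0, y0).
Proof.
move=> b0; set v := u (t0, y0); set l := line t0 y0 v.
pose g s := \sum_i (u (l s) 0 i - v 0 i) ^+ 2 + b (l s) ^+ 2.
pose dg s := \sum_i 2 * (u (l s) 0 i - v 0 i) * 'D_((1, v) : ST) (uc i) (l s)
   + 2 * b (l s) * 'D_((1, v) : ST) b (l s).
have g_ge0 s : 0 <= g s by rewrite addr_ge0 ?sqr_ge0// sumr_ge0// => i _; exact: sqr_ge0.
have gD s : is_derive s (1 : R) g (dg s).
  have h1 (f : ST -> R) (a : R) : C1 f -> is_derive s (1 : R) (fun s => (f (l s) - a) ^+ 2)
      (2 * (f (l s) - a) * 'D_((1, v) : ST) f (l s)).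
    move=> cf; have h := @is_derive_lineC1 _ _ f t0 y0 v s cf.
    have H := @is_deriveX _ _ (fun s => f (l s) - a) 2 s 1 _ (is_deriveB h (is_derive_cst a s 1)).
    rewrite subr0 /= in H; apply: (is_derive_eq H).
    by rewrite expr1.
  have h2 := h1 b 0 b_C1; rewrite (_ : (fun s => _) = fun s => b (l s) ^+ 2) in h2; last first.
    by apply/funext => r; rewrite subr0.
  rewrite subr0 in h2; apply: is_deriveD.
  have h3 := is_derive_sum (fun i => h1 (uc i) (v 0 i) (uc_C1 i)).
  by rewrite (_ : (fun s => _) = \sum_(i < d) (fun s => (u (l s) 0 i - v 0 i) ^+ 2)) //; apply/funext => r; rewrite fct_sumE.
have gu i s : (u (l s) 0 i - v 0 i) ^+ 2 <= g s.
  rewrite /g (bigD1 i)//= -addrA lerDl addr_ge0 ?sqr_ge0// sumr_ge0// => j _; exact: sqr_ge0.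
have gb s : b (l s) ^+ 2 <= g s.
  by rewrite /g lerDr sumr_ge0// => j _; exact: sqr_ge0.
have am (x y G : R) : x ^+ 2 <= G -> y ^+ 2 <= G -> `|x| * `|y| <= G.
  move=> xG yG; have hx : `|x| ^+ 2 <= G by rewrite real_normK ?num_real.
  have hy : `|y| ^+ 2 <= G by rewrite real_normK ?num_real.
  by have := sqr_ge0 (`|x| - `|y|); rewrite sqrrB; lra.
have mono (X B D G : R) : 0 <= D -> X * B <= G -> X * (k * B * D) <= G * (k * D).
  move=> D0 XB; have -> : X * (k * B * D) = X * B * (k * D) by ring.
  by rewrite ler_wpM2r// mulr_ge0// ltW.
have dgK s : `|dg s| <= 2 * slope (l s) * g s.
  have hu i : `|2 * (u (l s) 0 i - v 0 i) * 'D_((1, v) : ST) (uc i) (l s)| <=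
     2 * g s * (\sum_j `|dx j (uc i) (l s)| + k * `|dx i b (l s)|).
    rewrite derive_uc_line !normrM ger0_norm// -!mulrA ler_wpM2l//.
    apply: (@le_trans _ _ (`|u (l s) 0 i - v 0 i| * (\sum_j `|u (l s) 0 j - v 0 j| * `|dx j (uc i) (l s)|
        + k * `|b (l s)| * `|dx i b (l s)|))).
      rewrite ler_wpM2l// (le_trans (ler_normB _ _))// lerD//.
        rewrite (le_trans (ler_norm_sum _ _ _))//; apply: ler_sum => j _.
        by rewrite normrM distrC.
      by rewrite !normrM (gtr0_norm k_gt0) mulrA.
    rewrite !mulrDr; apply: lerD.
      rewrite !mulr_sumr; apply: ler_sum => j _; rewrite mulrA ler_wpM2r//.
      exact: am.
    by apply: mono => //; exact: am.
  have hb : `|2 * b (l s) * 'D_((1, v) : ST) b (l s)| <=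
     2 * g s * (\sum_j `|dx j b (l s)| + k * `|div u (l s)|).
    rewrite derive_b_line !normrM ger0_norm// -!mulrA ler_wpM2l//.
    apply: (@le_trans _ _ (`|b (l s)| * (\sum_j `|u (l s) 0 j - v 0 j| * `|dx j b (l s)|
        + k * `|b (l s)| * `|div u (l s)|))).
      rewrite ler_wpM2l// (le_trans (ler_normB _ _))// lerD//.
        rewrite (le_trans (ler_norm_sum _ _ _))//; apply: ler_sum => j _.
        by rewrite normrM distrC.
      by rewrite !normrM (gtr0_norm k_gt0) mulrA.
    rewrite !mulrDr; apply: lerD.
      rewrite !mulr_sumr; apply: ler_sum => j _; rewrite mulrA ler_wpM2r//.
      exact: am.
    by apply: mono => //; exact: am.
  rewrite /dg (le_trans (ler_normD _ _))// (le_trans (lerD (ler_norm_sum _ _ _) hb))//.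
  rewrite (le_trans (lerD (ler_sum _ (fun i _ => hu i)) (lexx _)))//.
  rewrite -mulr_sumr big_split/= -mulr_sumr -mulrDr [leRHS]mulrAC ler_wpM2l//; last first.
    by rewrite /slope !addrA lexx.
  by rewrite mulr_ge0.
have g0 s : g s = 0.
  pose A := Num.min s t0; pose B := Num.max s t0.
  have sAB : A <= s <= B by rewrite /A /B ge_min le_max lexx.
  have tAB : A <= t0 <= B by rewrite /A /B ge_min le_max lexx !orbT.
  have cl : continuous (fun s => slope (l s)).
    by move=> r; exact: (cvg_comp _ _ (@line_continuous R d t0 y0 v r) (@slope_continuous _)).
  have [M M0 Mb] := compact_bound (@segment_compact R A B) cl.
  apply: (@gronwall0 R g dg A B t0 (2 * M) tAB) => //.
    move=> r rAB; apply: le_trans (dgK r) _; rewrite ler_wpM2r// ler_wpM2l//.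
    by have := Mb r; rewrite /= in_itv/= => /(_ rAB); rewrite ger0_norm// slope_ge0.
  rewrite /g /l /line subrr scale0r addr0 b0 expr0n addr0 big1// => i _.
  by rewrite subrr expr0n.
move=> s; have [h1 h2] : b (l s) ^+ 2 <= 0 /\ forall i, (u (l s) 0 i - v 0 i) ^+ 2 <= 0.
  by rewrite -(g0 s).
split; first by apply/eqP; rewrite -sqrf_eq0 eq_le h1 sqr_ge0.
apply/rowP => i; apply/eqP; rewrite -subr_eq0 -sqrf_eq0 eq_le sqr_ge0 andbT.
exact: h2.
Qed.

End flow.

(** * Finite speed of propagation *)

Section propagation.
Variables (R : realType) (d : nat).
Local Notation E := 'rV[R]_d.
Local Notation ST := (R * E)%type.
Variables (k : R) (b : ST -> R) (u : ST -> E).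
Hypothesis fl : euler_flow k b u.

Local Notation uc i := (fun y : ST => u y 0 i).

Let k_gt0 := flow_gt0 fl.
Let b_C1 := flow_b_C1 fl.
Let u_C1 := flow_u_C1 fl.
Let b_ge0 := flow_b_ge0 fl.
Let uc_C1 i : C1 (uc i). Proof. exact: C1_coord. Qed.

Lemma u_lipschitz (M rho s : R) (y0 y1 : E) :
  (forall y : E, `|y| <= rho -> slope k b u (s, y) <= M) ->
  `|y0| <= rho -> `|y1| <= rho -> `|u (s, y1) - u (s, y0)| <= M * `|y1 - y0|.
Proof.
move=> sM y0r y1r; have M0 : 0 <= M by apply: le_trans (slope_ge0 fl (s, y0)) (sM _ y0r).
apply: norm_le_coord; first by rewrite mulr_ge0.
move=> i; rewrite !mxE; set w : ST := (0, y1 - y0).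
have gD (r : R) : is_derive r (1 : R) (fun r => u ((s, y0) + r *: w) 0 i) ('D_w (uc i) ((s, y0) + r *: w)).
  apply: (@is_derive_line R _ _ (uc i) (s, y0) w r); exact: C1_derivable (uc_C1 i).
have cg : {within `[0 : R, 1], continuous (fun r => u ((s, y0) + r *: w) 0 i)}.
  by apply: derivable_within_continuous => r _; have [] := gD r.
have [c] := MVT_segment ler01 (fun r _ => gD r) cg.
rewrite in_itv/= => /andP[c0 c1]; rewrite scale1r scale0r addr0 subr0 mulr1.
have -> : (s, y0) + w = (s, y1) by congr (_, _); rewrite /= ?addr0// addrC subrK.
move=> ->; have -> : (s, y0) + c *: w = (s, y0 + c *: (y1 - y0)) by congr (_, _); rewrite /= scaler0 addr0.
rewrite (derive_split _ _ _ (uc_C1 i)) mul0r add0r (le_trans (ler_norm_sum _ _ _))//.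
apply: (@le_trans _ _ (\sum_j `|dx j (uc i) (s, y0 + c *: (y1 - y0))| * `|y1 - y0|)).
  apply: ler_sum => j _; rewrite normrM mulrC ler_wpM2l//; exact: le_coord.
rewrite -mulr_suml ler_wpM2r//; apply: le_trans (sM (y0 + c *: (y1 - y0)) _); last first.
  have -> : y0 + c *: (y1 - y0) = (1 - c) *: y0 + c *: y1.
    by rewrite scalerBr scalerBl scale1r addrCA addrC addrAC.
  rewrite (le_trans (ler_normD _ _))// !normrZ ger0_norm ?subr_ge0// ger0_norm//.
  have := ler_wpM2l c0 y1r; have := ler_wpM2l (_ : 0 <= 1 - c) y0r; rewrite subr_ge0 => /(_ c1); lra.
rewrite /slope -!addrA [X in _ <= X + _](bigD1 i)//= -!addrA lerDl.
rewrite !addr_ge0 ?sumr_ge0// ?mulr_ge0 ?(ltW k_gt0)// ?sumr_ge0// => j _.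
by rewrite sumr_ge0.
Qed.

(** If vacuum surrounds x at time 0, it surrounds the particle from x at time
    t. Particles of the tube may drift away from the central line at a speed at
    most M times their distance to it, so the tube is narrowed by the factor
    exp (- La) to absorb the drift. In the tube the transport equation for b
    has a bounded zeroth-order coefficient, and the positive maximum of b exp
    (- K s) could only be attained at s = 0, where b vanishes. *)
Lemma vacuum_tube (x : E) (t : R) : (\forall y \near x, b (0, y) = 0) ->
  \forall z \near (t, x + t *: u (0, x)), b z = 0.
Proof.
move=> /nbhs_ballP[e' /= e'0 be']; set v := u (0, x); set l : R -> E := fun s => x + s *: v.
have b0 : b (0, x) = 0 by apply: be'; exact: ballxx.
have lE s : line 0 x v s = (s, l s) by rewrite /line subr0.
have vl s : u (s, l s) = v by rewrite -lE; have [] := vacuum_line fl b0 s.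
pose tau := `|t| + 1; pose rho := `|x| + tau * `|v| + 1.
have tau0 : 0 < tau by rewrite ltr_wpDl.
have [M M0 Mb] := compact_bound (@compact_box R d tau rho) (slope_continuous fl).
have sM s y : `|s| <= tau -> `|y| <= rho -> slope k b u (s, y) <= M.
  by move=> st yr; rewrite (le_trans (ler_norm _))// Mb.
have lrho s : `|s| <= tau -> `|l s| <= rho - 1.
  by move=> st; rewrite /rho addrK (le_trans (ler_normD _ _))// lerD2l normrZ ler_wpM2r.
have Lip s y : `|s| <= tau -> `|y| <= rho -> `|u (s, y) - v| <= M * `|y - l s|.
  move=> st yr; rewrite -(vl s); apply: (@u_lipschitz M rho) => //.
    by move=> y' y'r; exact: sM.
  by rewrite (le_trans (lrho s st))// lerBlDr lerDl.
pose La := tau * M; pose K := tau * M + 1.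
have La0 : 0 <= La by rewrite mulr_ge0// ltW.
pose e := Num.min (e' / 2) 1.
have e0 : 0 < e by rewrite lt_min divr_gt0//=.
have e1 : e <= 1 by rewrite ge_min lexx orbT.
have ee' : e < e' by rewrite gt_min ltr_pdivrMr// ltr_pMr// ltr1n.
have cl : continuous (fun p : ST => p.2 - l p.1).
  move=> p; apply: cvgB; first exact: cvg_snd.
  apply: cvgD; first exact: cvg_cst.
  by apply: (@cvgZr_tmp _ _ _ _ _ fst); exact: cvg_fst.
have cn : continuous (fun p : ST => `|p.2 - l p.1|).
  by move=> p; exact: (cvg_norm (cl p)).
have main t' (y : E) : `|t'| <= tau -> `|y - l t'| <= e * expR (- La) -> b (t', y) = 0.
  move=> t't yl.
  (* Time is t' s with s in [0, 1]: this treats both signs of t' at once. *)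
  pose Q : set (R * E) := [set p | [/\ 0 <= p.1, p.1 <= 1 & `|p.2 - l (t' * p.1)| <= e * expR (- La * p.1)]].
  have Qt p : Q p -> `|t' * p.1| <= tau.
    by case=> p0 p1 _; rewrite normrM (ger0_norm p0) (le_trans (ler_piMr _ p1)).
  have Qr p : Q p -> `|p.2| <= rho.
    move=> Qp; have [p0 p1 pe] := Qp; have ll := lrho _ (Qt p Qp).
    have : `|p.2 - l (t' * p.1)| <= 1.
      rewrite (le_trans pe)// mulr_ile1// ?expR_ge0//; first exact: ltW.
      by rewrite -expR0 ler_expR mulNr oppr_le0 mulr_ge0.
    by have := ler_normD (p.2 - l (t' * p.1)) (l (t' * p.1)); rewrite subrK; lra.
  have cphi : continuous (fun p : ST => (t' * p.1, p.2) : ST).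
    move=> p; have h1 : (fun q : ST => t' * q.1) @ nbhs p --> t' * p.1.
      by apply: cvgMl_tmp; exact: cvg_fst.
    have h2 : (fun q : ST => q.2) @ nbhs p --> p.2 by exact: cvg_snd.
    exact: (cvg_pt h1 h2).
  have ce (a : R) : continuous (fun p : ST => expR (a * p.1)).
    move=> p; have h1 : (fun q : ST => a * q.1) @ nbhs p --> a * p.1.
      by apply: cvgMl_tmp; exact: cvg_fst.
    exact: (cvg_comp _ _ h1 (@continuous_expR _ _)).
  have cF : continuous (fun p : ST => `|p.2 - l (t' * p.1)| - e * expR (- La * p.1)).
    move=> p; apply: (@continuousD _ _ _ (fun p : ST => `|p.2 - l (t' * p.1)|)
      (fun p : ST => - (e * expR (- La * p.1)))).
      exact: (@cvg_comp _ _ _ _ (fun q : ST => `|q.2 - l q.1|) _ _ _ (cphi p) (cn _)).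
    by apply: cvgN; apply: cvgMl_tmp; exact: ce.
  have clQ : closed Q.
    have -> : Q = [set p | 0 <= p.1] `&` ([set p | p.1 <= 1] `&`
        [set p | `|p.2 - l (t' * p.1)| - e * expR (- La * p.1) <= 0]).
      by apply/seteqP; split => p /=; rewrite subr_le0; [by case | by case=> ? []].
    apply: closedI; last apply: closedI.
    - apply: (@preimage_closed _ _ (fun p : ST => p.1) [set y | 0 <= y]); last exact: closed_ge.
      by move=> p _; exact: cvg_fst.
    - apply: (@preimage_closed _ _ (fun p : ST => p.1) [set y | y <= 1]); last exact: closed_le.
      by move=> p _; exact: cvg_fst.
    - apply: (@preimage_closed _ _ (fun p : ST => `|p.2 - l (t' * p.1)| - e * expR (- La * p.1)) [set y | y <= 0]); last exact: closed_le.
      by move=> p _; exact: cF.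
  have cQ : compact Q.
    apply: (subclosed_compact clQ (@compact_box R d 1 rho)) => p Qp; split; last exact: Qr.
    by have [p0 p1 _] := Qp; rewrite /= ger0_norm.
  pose G (p : ST) := b (t' * p.1, p.2) * expR (- K * p.1).
  have cG : continuous G.
    move=> p; apply: (@continuousM _ _ (fun p : ST => b (t' * p.1, p.2)) (fun p : ST => expR (- K * p.1))).
      exact: (cvg_comp _ _ (cphi p) (@C1_continuous _ _ _ b b_C1 _)).
    exact: ce.
  have Q0 : Q !=set0.
    by exists (1, y); split => //=; rewrite !mulr1.
  have [|[s ys] cQc cmax] := compact_EVT_max (f := G) Q0 cQ.
    exact: continuous_subspaceT.
  suff bs : b (t' * s, ys) = 0.
    have /cmax : (1, y) \in Q by rewrite inE; split => //=; rewrite !mulr1.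
    rewrite /G/= bs mul0r mulr1 pmulr_lle0 ?expR_gt0// => bl.
    by apply/eqP; rewrite eq_le bl b_ge0.
  rewrite inE in cQc; have [/= s0 s1 ysl] := cQc.
  have st := Qt _ cQc; have ysr := Qr _ cQc; rewrite /= in st ysr.
  apply/eqP/negPn/negP => bn0; have bp : 0 < b (t' * s, ys) by rewrite lt_def bn0 b_ge0.
  have sp : 0 < s.
    rewrite lt_def s0 andbT; apply/negP => /eqP s00; move: bn0 ysl.
    rewrite s00 !mulr0 expR0 mulr1 /l scale0r addr0 => /negP bn0 ysl; apply: bn0.
    by apply/eqP/be'; rewrite -ball_normE/= distrC (le_lt_trans ysl).
  set zs : ST := (t' * s, ys); set us := u zs.
  (* From a positive maximum with s > 0, move backwards in s along the particle
     path: the point stays in the tube, while G increases at first order. *)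
  pose w : ST := (- t') *: (1, us).
  have wE h : zs + h *: w = (t' * (s - h), ys - (h * t') *: us).
    congr (_, _); rewrite /=; last by rewrite scalerA mulrN scaleNr.
    by rewrite /GRing.scale/= mulr1 mulrBr mulrN [h * _]mulrC.
  have Dw : 'D_w b zs = t' * (k * b zs * div u zs).
    rewrite deriveE ?linearZ/=; last exact: C1_differentiable.
    rewrite -deriveE; last exact: C1_differentiable.
    rewrite (derive_b_line fl) big1 ?sub0r; last by move=> j _; rewrite subrr mul0r.
    by rewrite scalerN scaleNr opprK.
  pose phi (h : R) := b (zs + h *: w) * expR (K * h + - K * s).
  pose D := b zs * (K * expR (- K * s)) + expR (- K * s) * 'D_w b zs.
  have phiD : is_derive (0 : R) (1 : R) phi D.
    have h1 : is_derive (0 : R) (1 : R) (fun h : R => b (zs + h *: w)) ('D_w b (zs + 0 *: w)).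
      by apply: is_derive_line; exact: C1_derivable.
    have h2 : is_derive (0 : R) (1 : R) (fun h => expR (K * h + - K * s)) (K * expR (- K * s)).
      have h3 : is_derive (0 : R) (1 : R) (fun h => K * h + - K * s) K.
        by apply: is_derive_eq; rewrite addr0 [_ *: _]mulr1 ?scaler0 ?addr0.
      have H := @is_derive1_comp _ expR (fun h => K * h + - K * s) 0 _ _ (is_derive_expR _) h3.
      by apply: (is_derive_eq H); rewrite mulr0 add0r mulrC.
    have h4 := is_deriveM h1 h2; rewrite scale0r addr0 mulr0 add0r in h4.
    exact: h4.
  have Dgt0 : 0 < D.
    have -> : D = expR (- K * s) * b zs * (K + t' * (k * div u zs)) by rewrite /D Dw; ring.
    rewrite mulr_gt0 ?mulr_gt0 ?expR_gt0//.
    have sl : k * `|div u zs| <= M.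
      apply: le_trans (sM _ _ st ysr); rewrite /slope lerDr.
      rewrite !addr_ge0 ?mulr_ge0 ?sumr_ge0// ?(ltW k_gt0)// => i _.
      by rewrite sumr_ge0.
    have tk : `|t' * (k * div u zs)| <= La.
      by rewrite !normrM (gtr0_norm k_gt0) ler_pM// mulr_ge0// ltW.
    by move: tk; rewrite ler_norml /K -/La => /andP[]; lra.
  have phile h : 0 < h -> h <= s -> phi h <= phi 0.
    move=> h0 hs; rewrite /phi wE scale0r addr0 mulr0 add0r.
    have Qh : Q (s - h, ys - (h * t') *: us).
      split => /=; [by rewrite subr_ge0|by rewrite lerBlDr (le_trans s1)// lerDl ltW|].
      have -> : ys - (h * t') *: us - l (t' * (s - h)) = (ys - l (t' * s)) - (h * t') *: (us - v).
        rewrite /l scalerBr mulrBr scalerBl [t' * h]mulrC !opprD !opprK !addrA.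
        by rewrite -!addrA; congr (_ + _); rewrite addrC -!addrA; congr (_ + (_ + _)); rewrite addrC.
      rewrite (le_trans (ler_normB _ _))// normrZ normrM (gtr0_norm h0).
      set r0 := `|ys - l (t' * s)| in ysl *.
      have hl : h * `|t'| * `|us - v| <= h * La * r0.
        rewrite -!mulrA ler_wpM2l// ?(ltW h0)// /La -?mulrA ler_pM//.
        exact: Lip.
      apply: (@le_trans _ _ ((1 + La * h) * r0)); first lra.
      have -> : - La * (s - h) = La * h + - La * s by ring.
      rewrite expRD mulrCA; apply: ler_pM.
      - by rewrite addr_ge0// mulr_ge0// ltW.
      - exact: normr_ge0.
      - exact: expR_ge1Dx.
      - exact: ysl.
    have := cmax (s - h, ys - (h * t') *: us); rewrite inE => /(_ Qh).
    rewrite /G /= -/zs; congr (_ * expR _ <= _); ring.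
  have [/cvg_ex[/= L phiL] phiE] := phiD.
  have : (fun h : R => h^-1 *: (phi (h *: 1 + 0) - phi 0)) @ (0^')%classic --> D.
    by rewrite -phiE; apply/cvg_ex; exists L.
  move=> /cvgr_gt/(_ 0 Dgt0) [r /= r_gt0 hr].
  pose h := Num.min (r / 2) s.
  have h0 : 0 < h by rewrite lt_min sp divr_gt0.
  have := hr h; rewrite /= sub0r normrN (gtr0_norm h0) gt_eqF// => /(_ _ isT).
  have -> : h < r by rewrite gt_min ltr_pdivrMr// ltr_pMr// ltr1n.
  move=> /(_ isT); rewrite [h *: 1]mulr1 addr0 ltNge => /negP; apply.
  rewrite [_ *: _]/(_ * _) pmulr_rle0 ?invr_gt0// subr_le0 phile// ge_min lexx orbT //.
have n1 : \forall z \near (t, l t), `|z.2 - l z.1| < e * expR (- La).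
  by apply: (cvgr_lt _ (cn (t, l t))); rewrite subrr normr0 mulr_gt0 ?expR_gt0.
have n2 : \forall z \near (t, l t), `|z.1| < tau.
  apply: (cvgr_lt _ (cvg_norm (@cvg_fst _ _ (nbhs t) (nbhs (l t)) _))).
  by rewrite ltrDl.
near=> z; rewrite (surjective_pairing z); apply: main; apply: ltW.
  by near: z.
by near: z.
Unshelve. all: by end_near. Qed.

(** Used instead of the norm of row vectors, which is the sup norm and not
    differentiable. *)
Definition sqn (x : E) : R := \sum_i x 0 i ^+ 2.

Lemma sqn_continuous : continuous sqn.
Proof.
apply: continuous_sum_ord => i x.
by apply: (@cvg_comp _ _ _ (fun x : E => x 0 i) (fun y => y ^+ 2) _ _ _ (@coord_continuous _ _ _ 0 i x)); exact: exprn_continuous.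
Qed.

Lemma sqn_norm (x : E) r : 0 <= r -> sqn x <= r -> `|x| <= r + 1.
Proof.
move=> r0 xr; apply: norm_le_coord => [|i]; first by rewrite addr_ge0.
have xi : x 0 i ^+ 2 <= r.
  by apply: le_trans xr; rewrite /sqn (bigD1 i)//= lerDl sumr_ge0// => j _; exact: sqr_ge0.
rewrite leNgt; apply/negP => h; have : (r + 1) * (r + 1) < `|x 0 i| ^+ 2.
  by rewrite expr2 ltr_pM// addr_ge0.
by rewrite real_normK ?num_real//; nra.
Qed.

(** For a far away y, the set of s in [0, 1] for which (s t, y) is a vacuum
    point with label outside the initial ball contains 0. It is open by
    [vacuum_tube]. It is closed because a label on the sphere of the ball would
    have a velocity bounded by M, hence could not have reached y. *)
Lemma finite_propagation (r tau : R) : 0 <= r -> (forall y, r < sqn y -> b (0, y) = 0) ->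
  exists rho, forall t y, `|t| <= tau -> rho < `|y| ->
    b (t, y) = 0 /\ r < sqn (y - t *: u (t, y)).
Proof.
move=> r0 b0; pose rho0 := r + 1.
have cu0 : continuous (fun x => `|u (0, x)|).
  by move=> x; exact: (cvg_norm (@slice_continuous R d _ u 0 (@C1_continuous _ _ _ u u_C1) x)).
have [M M0 uM] := compact_bound (@closed_ball_compact R d rho0) cu0.
exists (rho0 + tau * M) => t y tt yr.
pose P (s : R) := b (t * s, y) = 0 /\ r < sqn (y - (t * s) *: u (t * s, y)).
have cph : continuous (fun s : R => (t * s, y) : ST).
  move=> s; have h1 : (fun q : R => t * q) @ nbhs s --> t * s by apply: cvgMl_tmp; exact: cvg_id.
  exact: (cvg_pt h1 (cvg_cst y)).
have cb : continuous (fun s => b (t * s, y)).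
  by move=> s; exact: (cvg_comp _ _ (cph s) (@C1_continuous _ _ _ b b_C1 _)).
have cu : continuous (fun s => u (t * s, y)).
  by move=> s; exact: (cvg_comp _ _ (cph s) (@C1_continuous _ _ _ u u_C1 _)).
have ca : continuous (fun s => y - (t * s) *: u (t * s, y)).
  move=> s; apply: cvgB; first exact: cvg_cst.
  by apply: cvgZ; [apply: cvgMl_tmp; exact: cvg_id | exact: cu].
have cs : continuous (fun s => sqn (y - (t * s) *: u (t * s, y))).
  by move=> s; exact: (cvg_comp _ _ (ca s) (@sqn_continuous _)).
have strict s : 0 <= s <= 1 -> b (t * s, y) = 0 -> r <= sqn (y - (t * s) *: u (t * s, y)) -> P s.
  move=> /andP[s0 s1] bs; rewrite le_eqVlt => /orP[/eqP rs|//].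
  pose x := y - (t * s) *: u (t * s, y).
  have [_] := vacuum_line fl bs 0; rewrite /line sub0r scaleNr -/x => ux.
  have xr : `|x| <= rho0 by apply: sqn_norm => //; rewrite -rs.
  have := uM x xr; rewrite normr_id ux => uxM.
  have : `|y| <= rho0 + tau * M.
    rewrite -(subrK ((t * s) *: u (t * s, y)) y) (le_trans (ler_normD _ _))// lerD//.
    rewrite normrZ ler_pM// normrM (ger0_norm s0) (le_trans _ tt)//.
    by rewrite ler_piMr.
  by rewrite leNgt yr.
have PO s : P s -> \forall s' \near s, P s'.
  move=> [bs rs]; pose x := y - (t * s) *: u (t * s, y).
  have [bx] := vacuum_line fl bs 0; rewrite /line sub0r scaleNr -/x => ux.
  have nx : \forall x' \near x, b (0, x') = 0.
    have n0 : \forall x' \near x, r < sqn x' by exact: (cvgr_gt _ (@sqn_continuous x) _ rs).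
    by near=> x'; apply: b0; near: x'.
  have := @vacuum_tube x (t * s) nx; rewrite ux subrK => nz.
  have nb : \forall s' \near s, b (t * s', y) = 0 by exact: (cph s _ nz).
  have ns : \forall s' \near s, r < sqn (y - (t * s') *: u (t * s', y)).
    exact: (cvgr_gt _ (cs s) _ rs).
  by near=> s'; split; near: s'.
suff : P 1 by rewrite /P mulr1.
have := @segment_connected R 0 1 (`[0, 1] `&` [set s | P s])%classic.
move=> H; suff : (`[0, 1] `&` [set s | P s])%classic 1 by case.
rewrite H.
- by rewrite /= in_itv/= lexx ler01.
- exists 0; split; first by rewrite /= in_itv/= lexx ler01.
  rewrite /= /P mulr0 scale0r subr0.
  have ry : r < sqn y.
    rewrite ltNge; apply/negP => /(sqn_norm r0); rewrite leNgt => /negP; apply.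
    by apply: le_lt_trans yr; rewrite lerDl mulr_ge0// (le_trans _ tt).
  by split => //; exact: b0.
- exists (interior [set s | P s]); first exact: open_interior.
  apply/seteqP; split => s [s01 Ps]; split => //; first exact: PO.
  exact: interior_subset Ps.
- exists ([set s | b (t * s, y) = 0] `&` [set s | r <= sqn (y - (t * s) *: u (t * s, y))]).
    apply: closedI.
      apply: (@preimage_closed _ _ (fun s => b (t * s, y)) [set 0]); last exact: closed_eq.
      by move=> s _; exact: cb.
    apply: (@preimage_closed _ _ (fun s => sqn (y - (t * s) *: u (t * s, y))) [set z | r <= z]); last exact: closed_ge.
    by move=> s _; exact: cs.
  apply/seteqP; split => s /= [s01].
    by move=> [? ?]; split => //; split => //; exact: ltW.
  by move=> [? ?]; split => //; apply: strict => //; move: s01; rewrite in_itv.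
Unshelve. all: by end_near. Qed.

End propagation.

(** * Calculus of C^1 functions *)

Lemma near_eq_differentiable (R : realType) (V W : normedModType R) (f g : V -> W) z :
  (\near z, f z = g z) -> differentiable f z -> differentiable g z.
Proof.
move=> fg df; have fgz := nbhs_singleton fg.
apply/diffP => /=.
apply: (@getPex _ (fun (dg : {linear V -> W}) => continuous dg /\
  forall y, g y = g (lim (nbhs z)) + dg (y - lim (nbhs z))
                  +o_(y \near z) (y - lim (nbhs z)))).
exists ('d f z); split; first exact: diff_continuous.
have /diffP[_ H] := df.
pose L y := f (lim (nbhs z)) + 'd f z (y - lim (nbhs z)).
have /eqaddoP Hf : f = L +o_ (nbhs z) (fun y => y - lim (nbhs z)) by apply/funext.
suff Hg : g = L +o_ (nbhs z) (fun y => y - lim (nbhs z)).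
  have gl : g (lim (nbhs z)) = f (lim (nbhs z)) by rewrite lim_id.
  by move=> y; rewrite gl {1}Hg.
apply/eqaddoP => e e0; near=> y; have <- : (f - L) y = (g - L) y.
  by congr (_ - _); near: y.
by near: y; exact: Hf.
Unshelve. all: by end_near. Qed.

Section local_C1.
Variable R : realType.

Lemma C1_near (V W : normedModType R) (f : V -> W) :
  (forall z : V, exists g : V -> W, C1 g /\ \forall z' \near z, g z' = f z') -> C1 f.
Proof.
move=> H; apply: C1I => [z|v z]; have [g [cg gf]] := H z.
  exact: near_eq_differentiable gf (C1_differentiable z cg).
have nD : \forall z' \near z, 'D_v g z' = 'D_v f z'.
  have := near_join gf; apply: filterS => z' gf'; exact: near_eq_derive.
have Dz := nbhs_singleton nD; rewrite /continuous_at -Dz.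
exact: (cvg_trans (near_eq_cvg nD) (@C1_D _ _ _ g v cg z)).
Qed.

Lemma C1_cst (V W : normedModType R) (a : W) : C1 (fun _ : V => a).
Proof.
apply: C1I => [z|v]; first exact: differentiable_cst.
rewrite (_ : 'D_v _ = fun=> 0); first exact: cst_continuous.
by apply/funext => z; rewrite derive_cst.
Qed.

Lemma C1D (V : normedModType R) (f g : V -> R) : C1 f -> C1 g -> C1 (fun z => f z + g z).
Proof.
move=> cf cg; apply: C1I => [z|v].
  by apply: (@differentiableD _ _ _ f g); exact: C1_differentiable.
rewrite (_ : 'D_v _ = fun z => 'D_v f z + 'D_v g z); last first.
  by apply/funext => z; rewrite (@deriveD _ _ _ f g)//; exact: C1_derivable.
by move=> z; apply: (@continuousD _ _ _ ('D_v f) ('D_v g)); exact: C1_D.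
Qed.

Lemma derive_mul (V : normedModType R) (f g : V -> R) v z : C1 f -> C1 g ->
  'D_v (fun z => f z * g z) z = f z * 'D_v g z + g z * 'D_v f z.
Proof. by move=> cf cg; rewrite (@deriveM _ _ f g)//; exact: C1_derivable. Qed.

Lemma derive_add (V : normedModType R) (f g : V -> R) v z : C1 f -> C1 g ->
  'D_v (fun z => f z + g z) z = 'D_v f z + 'D_v g z.
Proof. by move=> cf cg; rewrite (@deriveD _ _ _ f g)//; exact: C1_derivable. Qed.

Lemma C1M (V : normedModType R) (f g : V -> R) : C1 f -> C1 g -> C1 (fun z => f z * g z).
Proof.
move=> cf cg; apply: C1I => [z|v].
  by apply: (@differentiableM _ _ f g); exact: C1_differentiable.
rewrite (_ : 'D_v _ = fun z => f z * 'D_v g z + g z * 'D_v f z); last first.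
  by apply/funext => z; rewrite derive_mul.
have cf' := @C1_continuous _ _ _ f cf; have cg' := @C1_continuous _ _ _ g cg.
have cDf := @C1_D _ _ _ f v cf; have cDg := @C1_D _ _ _ g v cg.
move=> z; apply: (@continuousD _ _ _ (fun z => f z * 'D_v g z) (fun z => g z * 'D_v f z)).
  by apply: (@continuousM _ _ f ('D_v g)); [exact: cf'|exact: cDg].
by apply: (@continuousM _ _ g ('D_v f)); [exact: cg'|exact: cDf].
Qed.

Lemma C1Z (V : normedModType R) a (f : V -> R) : C1 f -> C1 (fun z => a * f z).
Proof. by apply: C1M; exact: C1_cst. Qed.

Lemma deriveZ_C1 (V : normedModType R) a (f : V -> R) v z : C1 f ->
  'D_v (fun z => a * f z) z = a * 'D_v f z.
Proof.
by move=> cf; rewrite (derive_mul _ _ (@C1_cst V R a) cf) derive_cst mulr0 addr0.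
Qed.

Lemma C1_sum (V : normedModType R) I (r : seq I) (P : pred I) (f : I -> V -> R) :
  (forall i, C1 (f i)) -> C1 (fun z => \sum_(i <- r | P i) f i z).
Proof.
move=> cf; elim: r => [|i r ih].
  by rewrite (_ : (fun z => _) = fun=> 0); [exact: C1_cst|apply/funext => z; rewrite big_nil].
rewrite (_ : (fun z => _) = fun z => if P i then f i z + \sum_(j <- r | P j) f j z
  else \sum_(j <- r | P j) f j z); last by apply/funext => z; rewrite big_cons.
by case: (P i); [exact: (C1D (cf i) ih)|exact: ih].
Qed.

Lemma derive_sum_C1 (V : normedModType R) I (r : seq I) (P : pred I) (f : I -> V -> R) v z :
  (forall i, C1 (f i)) ->
  'D_v (fun z => \sum_(i <- r | P i) f i z) z = \sum_(i <- r | P i) 'D_v (f i) z.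
Proof.
move=> cf; elim: r => [|i r ih].
  rewrite big_nil (_ : (fun z => _) = fun=> 0); first exact: derive_cst.
  by apply/funext => y; rewrite big_nil.
rewrite big_cons (_ : (fun z => _) = fun z => if P i then f i z + \sum_(j <- r | P j) f j z
  else \sum_(j <- r | P j) f j z); last by apply/funext => y; rewrite big_cons.
by case: (P i); rewrite ?ih// (derive_add _ _ (cf i) (C1_sum _ _ cf)) ih.
Qed.

Section composition.
Variables (q q' : R -> R).
Hypothesis qD : forall x, is_derive x (1 : R) q (q' x).
Hypothesis q'c : continuous q'.

Lemma derive_compC1 (V : normedModType R) (f : V -> R) v z : C1 f ->
  'D_v (fun z => q (f z)) z = q' (f z) * 'D_v f z.
Proof.
move=> cf; have df := C1_differentiable z cf.
have dq : differentiable q (f z) by apply/derivable1_diffP; have [] := qD (f z).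
have lin y : 'd q (f z) y = y * q' (f z).
  rewrite -{1}[y]mulr1 -[y * 1]/(y *: 1) linearZ/= -deriveE//.
  by have [_ ->] := qD (f z).
rewrite (deriveE _ (differentiable_comp df dq)) (@diff_comp _ _ _ _ f q)//= lin mulrC.
by rewrite -deriveE.
Qed.

Lemma C1_comp (V : normedModType R) (f : V -> R) : C1 f -> C1 (fun z => q (f z)).
Proof.
move=> cf; apply: C1I => [z|v].
  apply: (@differentiable_comp _ _ _ _ f q); first exact: C1_differentiable.
  by apply/derivable1_diffP; have [] := qD (f z).
rewrite (_ : 'D_v _ = fun z => q' (f z) * 'D_v f z); last first.
  by apply/funext => z; exact: derive_compC1.
have cf' := @C1_continuous _ _ _ f cf; have cDf := @C1_D _ _ _ f v cf.
move=> z; apply: (@continuousM _ _ (fun z => q' (f z)) ('D_v f)); last exact: cDf.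
exact: (cvg_comp _ _ (cf' z) (@q'c _)).
Qed.
End composition.

End local_C1.

Section positive_power.
Variable R : realType.

(** The positive part to the power p, which is C^1 on the line when p >= 2. *)
Definition ppow (p x : R) : R := if x <= 0 then 0 else x `^ p.

Lemma ppow_ge0 (p x : R) : 0 <= ppow p x.
Proof. by rewrite /ppow; case: ifP => // _; exact: powR_ge0. Qed.

Lemma ppow_gt0 (p x : R) : 0 < x -> 0 < ppow p x.
Proof. by move=> x0; rewrite /ppow leNgt x0/= powR_gt0. Qed.

Lemma ppow0 (p x : R) : x <= 0 -> ppow p x = 0.
Proof. by rewrite /ppow => ->. Qed.

Lemma ppowS (p x : R) : ppow (p + 1) x = x * ppow p x.
Proof.
rewrite /ppow; case: (leP x 0) => x0; first by rewrite mulr0.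
by rewrite addrC powRD ?powRr1 ?ltW// (gt_eqF x0) implybT.
Qed.

Lemma ppow_derive_gt0 (p x : R) : 0 < x -> is_derive x (1 : R) (ppow p) (p * ppow (p - 1) x).
Proof.
move=> x0; have H := @is_derive1_powR R p x x0.
suff E : \near x, x `^ p = ppow p x.
  by have := near_eq_is_derive E H; rewrite {3}/ppow leNgt x0.
  near=> y; have y0 : 0 < y by near: y; exact: lt_nbhsr.
  by rewrite /ppow leNgt y0.
Unshelve. all: by end_near. Qed.

Lemma ppow_near0 (p e : R) : 1 <= p -> 0 < e -> \forall y \near (0 : R), `|ppow p y| <= e.
Proof.
move=> p1 e0; near=> y.
have y1 : `|y| < 1 by near: y; exact: (@nbhs0_lt _ R _ ltr01).
have ye : `|y| <= e by near: y; exact: (@nbhs0_le _ R _ e0).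
have [y0|y0] := leP y 0; first by rewrite ppow0// normr0 ltW.
rewrite (gtr0_norm y0) in y1 ye; rewrite ger0_norm ?ppow_ge0// /ppow (lt_geF y0).
by apply: le_trans ye; apply: ge1r_powR => //; rewrite y0 ltW.
Unshelve. all: by end_near. Qed.

Lemma ppow_continuous (p : R) : 1 <= p -> continuous (ppow p).
Proof.
move=> p1 x; have [x0|x0|->] := ltgtP x 0.
- apply: (cvg_trans (near_eq_cvg _)); last first.
    by rewrite ppow0 ?ltW//; exact: (cvg_cst (0 : R)).
  near=> y; rewrite ppow0// ltW//; near: y; exact: lt_nbhsl.
- apply: differentiable_continuous; apply/derivable1_diffP.
  by have [] := ppow_derive_gt0 p x0.
- suff : ppow p @ nbhs (0 : R) --> (0 : R) by rewrite /continuous_at ppow0.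
  by apply/cvgr0Pnorm_le => e e0; exact: ppow_near0.
Unshelve. all: by end_near. Qed.

Lemma ppow_derive (p : R) : 2 <= p -> forall x : R, is_derive x (1 : R) (ppow p) (p * ppow (p - 1) x).
Proof.
move=> p2 x; have [x0|x0|->] := ltgtP x 0.
- rewrite (ppow0 (p - 1) (ltW x0)) mulr0; apply: (@near_eq_is_derive _ _ _ (fun=> 0)).
    by near=> y; rewrite ppow0// ltW//; near: y; exact: lt_nbhsl.
- exact: ppow_derive_gt0.
- rewrite ppow0// mulr0.
  have H : (fun h : R => h^-1 *: (ppow p (h *: 1 + 0) - ppow p 0)) @ (0^')%classic --> (0 : R).
    apply: (cvg_trans (near_eq_cvg (f := ppow (p - 1)) _)).
      near=> h; have h0 : h != 0 by near: h; exact: nbhs_dnbhs_neq.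
      rewrite (ppow0 _ (lexx 0)) subr0 addr0 [h *: 1]mulr1.
      have -> : ppow p h = h * ppow (p - 1) h by rewrite -ppowS subrK.
      by rewrite [_ *: _]mulrA mulVf// mul1r.
    have c : ppow (p - 1) @ (0 : R) --> (0 : R).
      by have := @ppow_continuous (p - 1) _ 0; rewrite /continuous_at ppow0//; apply; lra.
    exact: (cvg_trans (cvg_app _ (@nbhs_dnbhs _ _)) c).
  by split; [apply/cvg_ex; exists 0|exact: cvg_lim H].
Unshelve. all: by end_near. Qed.

End positive_power.

(** * A transported cutoff *)

Section det_lipschitz.
Variable R : realType.

Lemma prod_lipschitz n (f g : 'I_n -> R) B e : 1 <= B -> 0 <= e ->
  (forall i, `|f i| <= B) -> (forall i, `|g i| <= B) -> (forall i, `|f i - g i| <= e) ->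
  `|\prod_i f i - \prod_i g i| <= n%:R * B ^+ n * e.
Proof.
move=> B1 e0; have B0 : 0 <= B by lra.
elim: n f g => [|n ih] f g fB gB fg; first by rewrite !big_ord0 subrr normr0 !mul0r.
rewrite !big_ord_recl; set F := \prod_(i < n) _; set G := \prod_(i < n) _.
have -> : f ord0 * F - g ord0 * G = f ord0 * (F - G) + (f ord0 - g ord0) * G by ring.
have GB : `|G| <= B ^+ n.
  rewrite /G normr_prod -[X in _ ^+ X](card_ord n) -prodr_const.
  by apply: ler_prod => i _; rewrite normr_ge0 gB.
have Bn : 1 <= B ^+ n by exact: exprn_ege1.
rewrite (le_trans (ler_normD _ _))// !normrM.
have h1 : `|f ord0| * `|F - G| <= B * (n%:R * B ^+ n * e).
  by apply: ler_pM => //; apply: ih.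
have h2 : `|f ord0 - g ord0| * `|G| <= e * (B * B ^+ n).
  apply: ler_pM => //; apply: le_trans GB _; rewrite ler_peMl//; lra.
rewrite (le_trans (lerD h1 h2))// exprS -natr1; lra.
Qed.

Lemma det_lipschitz n (M N : 'M[R]_n) B e : 1 <= B -> 0 <= e ->
  (forall i j, `|M i j| <= B) -> (forall i j, `|N i j| <= B) ->
  (forall i j, `|M i j - N i j| <= e) ->
  `|\det M - \det N| <= n`!%:R * (n%:R * B ^+ n) * e.
Proof.
move=> B1 e0 MB NB MN; rewrite /determinant -sumrB (le_trans (ler_norm_sum _ _ _))//.
have -> : n`!%:R * (n%:R * B ^+ n) * e = \sum_(s : 'S_n) n%:R * B ^+ n * e.
  rewrite sumr_const -[RHS]mulr_natl [RHS]mulrA; congr (_%:R * _ * _).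
  by rewrite -card_Sn; apply: eq_card.
apply: ler_sum => s _; rewrite -mulrBr normrM normrX normrN1 expr1n mul1r.
exact: prod_lipschitz.
Qed.

End det_lipschitz.

Section volume.
Variables (R : realType) (d : nat).
Local Notation E := 'rV[R]_d.
Local Notation ST := (R * E)%type.
Variables (k : R) (b : ST -> R) (u : ST -> E) (r0 : R).
Hypothesis fl : euler_flow k b u.
Hypothesis r0_ge0 : 0 <= r0.
Hypothesis b0 : forall y, r0 < sqn y -> b (0, y) = 0.

Local Notation uc i := (fun y : ST => u y 0 i).

Let k_gt0 := flow_gt0 fl.
Let b_C1 := flow_b_C1 fl.
Let u_C1 := flow_u_C1 fl.
Let b_ge0 := flow_b_ge0 fl.
Let uc_C1 i : C1 (uc i). Proof. exact: C1_coord. Qed.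

Lemma C1_linear (V W : normedModType R) (f : {linear V -> W}) : continuous f -> C1 f.
Proof.
move=> cf; apply: C1I => [z|v]; first exact: linear_differentiable.
rewrite (_ : 'D_v _ = fun=> f v); first exact: cst_continuous.
by apply/funext => z; rewrite deriveE ?diff_lin//; exact: linear_differentiable.
Qed.

Lemma C1_time : C1 (fun z : ST => z.1).
Proof. by apply: (@C1_linear ST R fst) => z; exact: cvg_fst. Qed.

Lemma C1_space i : C1 (fun z : ST => z.2 0 i).
Proof. by apply: (@C1_coord R d snd); apply: (@C1_linear ST E snd) => z; exact: cvg_snd. Qed.

Lemma derive_time (v z : ST) : 'D_v (fun z : ST => z.1) z = v.1.
Proof.
rewrite deriveE; last exact: C1_differentiable C1_time.
by rewrite (@diff_lin _ ST R fst)// => y; exact: cvg_fst.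
Qed.

Lemma derive_space (v z : ST) i : 'D_v (fun z : ST => z.2 0 i) z = v.2 0 i.
Proof.
have cs : C1 (snd : ST -> E) by apply: (@C1_linear ST E snd) => y; exact: cvg_snd.
rewrite -(@derive_coord R d snd i v z cs) deriveE; last exact: C1_differentiable.
by rewrite (@diff_lin _ ST E snd)// => y; exact: cvg_snd.
Qed.

(** The position at time 0 of a particle moving freely with velocity u z. *)
Definition label (z : ST) : E := z.2 - z.1 *: u z.
Definition sqlabel (z : ST) : R := sqn (label z).

Lemma labelE z i : label z 0 i = z.2 0 i + -1 * (z.1 * u z 0 i).
Proof. by rewrite /label !mxE mulN1r. Qed.

Lemma label_C1 i : C1 (fun z => label z 0 i).
Proof.
rewrite (_ : (fun z => _) = fun z : ST => z.2 0 i + -1 * (z.1 * u z 0 i)).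
  by apply: C1D; [exact: C1_space|apply: C1Z; apply: C1M; [exact: C1_time|exact: uc_C1]].
by apply/funext => z; rewrite labelE.
Qed.

Lemma sqlabel_C1 : C1 sqlabel.
Proof.
rewrite (_ : sqlabel = fun z => \sum_i label z 0 i * label z 0 i).
  by apply: C1_sum => i; apply: C1M; exact: label_C1.
by apply/funext => z; apply: eq_bigr => i _; rewrite expr2.
Qed.

Lemma vacuum_burgers z i : b z = 0 -> 'D_((1, u z) : ST) (uc i) z = 0.
Proof.
move=> bz; rewrite (derive_uc_line fl) bz mulr0 mul0r subr0.
by rewrite big1// => j _; rewrite subrr mul0r.
Qed.

(** In vacuum u is constant along (1, u), so x - t u is as well. *)
Lemma vacuum_label z i : b z = 0 -> 'D_((1, u z) : ST) (fun z => label z 0 i) z = 0.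
Proof.
move=> bz; rewrite (_ : (fun z => _) = fun z : ST => z.2 0 i + -1 * (z.1 * u z 0 i)); last first.
  by apply/funext => y; rewrite labelE.
have c1 : C1 (fun z : ST => z.1 * u z 0 i) by apply: C1M; [exact: C1_time|exact: uc_C1].
rewrite (derive_add _ _ (C1_space i) (C1Z _ c1)) (deriveZ_C1 _ _ _ c1).
rewrite (derive_mul _ _ C1_time (uc_C1 i)) derive_space derive_time vacuum_burgers//=.
by ring.
Qed.

Lemma vacuum_sqlabel z : b z = 0 -> 'D_((1, u z) : ST) sqlabel z = 0.
Proof.
move=> bz; rewrite (_ : sqlabel = fun z => \sum_i label z 0 i * label z 0 i); last first.
  by apply/funext => y; apply: eq_bigr => i _; rewrite expr2.
rewrite derive_sum_C1; last by move=> i; apply: C1M; exact: label_C1.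
rewrite big1// => i _; rewrite derive_mul; [|exact: label_C1..].
by rewrite vacuum_label// mulr0 addr0.
Qed.

(** A C^1 cutoff on the line: 1 up to r0 + 2, and 0 from r0 + 3 on. *)
Definition chi (s : R) : R := ppow 2 (1 - ppow 2 (s - (r0 + 2))).

Lemma chi1 s : s <= r0 + 2 -> chi s = 1.
Proof.
move=> s2; rewrite /chi (ppow0 2 (x := s - _)) ?subr0; last by lra.
by rewrite /ppow (lt_geF ltr01) powR1.
Qed.

Lemma chi0 s : r0 + 3 <= s -> chi s = 0.
Proof.
move=> s3; rewrite /chi ppow0// subr_le0 /ppow ifF; last by apply/negbTE; rewrite -ltNge; lra.
by apply: (@le_trans _ _ (s - (r0 + 2))); [lra | apply: le1r_powR; lra].
Qed.

Lemma chi_ge0 s : 0 <= chi s. Proof. exact: ppow_ge0. Qed.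

Definition dchi (s : R) : R :=
  2 * ppow (2 - 1) (1 - ppow 2 (s - (r0 + 2))) * - (2 * ppow (2 - 1) (s - (r0 + 2))).

Lemma chi_derive s : is_derive s (1 : R) chi (dchi s).
Proof.
have D2 := ppow_derive (lexx (2 : R)).
have h1 : is_derive s (1 : R) (fun x : R => x - (r0 + 2)) 1.
  exact: (is_derive_eq (is_deriveB (is_derive_id s 1) (is_derive_cst (r0 + 2) s 1)) (subr0 _)).
have h2 := @is_derive1_comp _ (ppow 2) (fun x => x - (r0 + 2)) s _ _ (D2 _) h1.
have h3 := is_deriveB (is_derive_cst (1 : R) s 1) h2; rewrite sub0r mulr1 in h3.
exact: (@is_derive1_comp _ (ppow 2) (fun x => 1 - ppow 2 (x - (r0 + 2))) s _ _ (D2 _) h3).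
Qed.

Lemma dchi_continuous : continuous dchi.
Proof.
have c1 : continuous (fun x : R => 2 * ppow (2 - 1) x).
  by move=> x; apply: cvgMl_tmp; apply: ppow_continuous; lra.
have c2 : continuous (ppow (2 : R)) by apply: ppow_continuous; lra.
move=> s; have h1 : (fun x : R => x - (r0 + 2)) @ s --> s - (r0 + 2).
  by apply: cvgB; [exact: cvg_id|exact: cvg_cst].
have h2 := cvg_comp _ _ h1 (c2 _).
have h3 : (fun x : R => 1 - ppow 2 (x - (r0 + 2))) @ s --> 1 - ppow 2 (s - (r0 + 2)).
  by apply: cvgB; [exact: cvg_cst|exact: h2].
apply: cvgM; first exact: (cvg_comp _ _ h3 (c1 _)).
by apply: cvgN; exact: (cvg_comp _ _ h1 (c1 _)).
Qed.

Lemma chi_sqlabel_C1 : C1 (fun z => chi (sqlabel z)).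
Proof. exact: (C1_comp chi_derive dchi_continuous sqlabel_C1). Qed.

Lemma vacuum_chi z : b z = 0 -> 'D_((1, u z) : ST) (fun z => chi (sqlabel z)) z = 0.
Proof.
by move=> bz; rewrite (derive_compC1 chi_derive _ _ sqlabel_C1) vacuum_sqlabel// mulr0.
Qed.

(** Equal to 1 on the fluid, and a transported function of the label in the
    vacuum which was outside the initial ball. The threshold r0 + 1 lies
    strictly between r0 and the place r0 + 2 where chi starts to decrease: this
    leaves room for gluing. *)
Definition psi (z : ST) : R := if `[< b z = 0 /\ r0 + 1 < sqlabel z >] then chi (sqlabel z) else 1.

Lemma exterior_open z : b z = 0 -> r0 < sqlabel z -> \forall z' \near z, b z' = 0.
Proof.
case: z => t y bz rz; pose x := y - t *: u (t, y).
have [bx] := vacuum_line fl bz 0; rewrite /line sub0r scaleNr -/x => ux.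
have n0 : \forall x' \near x, r0 < sqn x' by exact: (cvgr_gt _ (@sqn_continuous _ _ x) _ rz).
have nx : \forall x' \near x, b (0, x') = 0 by near=> x'; apply: b0; near: x'.
by have := @vacuum_tube R d k b u fl x t nx; rewrite ux subrK.
Unshelve. all: by end_near. Qed.

(** Both cases are open: the first by [exterior_open]; in the second z is
    outside the closed set of vacuum points with squared label at least r0 + 2,
    off which psi is 1. *)
Lemma psi_near z : (b z = 0 /\ \forall z' \near z, chi (sqlabel z') = psi z') \/
  \forall z' \near z, 1 = psi z'.
Proof.
have csq := @C1_continuous _ _ _ _ sqlabel_C1.
have cb := @C1_continuous _ _ _ _ b_C1.
have [[bz rz]|nz] := pselect (b z = 0 /\ r0 + 1 < sqlabel z).
  left; split => //.
  have n1 : \forall z' \near z, r0 + 1 < sqlabel z' by exact: (cvgr_gt _ (csq z) _ rz).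
  have n2 : \forall z' \near z, b z' = 0 by apply: exterior_open => //; lra.
  near=> z'; rewrite /psi asboolT//; split; by near: z'.
right; pose A := [set z | b z = 0] `&` [set z | r0 + 2 <= sqlabel z].
have cA : closed A.
  apply: closedI.
    apply: (@preimage_closed _ _ b [set 0]); last exact: closed_eq.
    by move=> y _; exact: cb.
  apply: (@preimage_closed _ _ sqlabel [set y | r0 + 2 <= y]); last exact: closed_ge.
  by move=> y _; exact: csq.
have nA : \forall z' \near z, (~` A) z'.
  apply: open_nbhs_nbhs; split; first exact: closed_openC.
  by move=> [/= bz rz]; apply: nz; split => //; lra.
near=> z'; have : (~` A) z' by near: z'.
rewrite /psi; case: asboolP => [[bz' rz'] nAz|//].
rewrite chi1// leNgt; apply/negP => h; apply: nAz; split => //=; exact: ltW.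
Unshelve. all: by end_near. Qed.

Lemma psi_C1 : C1 psi.
Proof.
apply: C1_near => z; have [[_ h]|h] := psi_near z.
  by exists (fun z => chi (sqlabel z)); split; [exact: chi_sqlabel_C1|exact: h].
by exists (fun=> 1); split; [exact: C1_cst|exact: h].
Qed.

Lemma psi_tcs : tcs psi.
Proof.
move=> tau; have r3 : 0 <= r0 + 3 by have := r0_ge0; lra.
have [|rho H] := @finite_propagation _ _ _ _ _ fl (r0 + 3) tau r3.
  by move=> y ry; apply: b0; lra.
exists rho => t x tt rx; have [bz rz] := H t x tt rx.
have rz' : r0 + 3 < sqlabel (t, x) by exact: rz.
by rewrite /psi asboolT ?chi0//; [exact: ltW|split => //; lra].
Qed.

Lemma psi_ge0 z : 0 <= psi z.
Proof. by rewrite /psi; case: ifP => // _; exact: chi_ge0. Qed.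

Lemma psi_fluid z : b z != 0 -> psi z = 1.
Proof. by move=> bz; rewrite /psi asboolF// => -[b0z]; rewrite b0z eqxx in bz. Qed.

End volume.

(** * The fluid volume grows slower than t^d *)

Lemma norm_le_of_opposite (R : realDomainType) (a c v e : R) :
  0 <= a -> c <= 0 -> `|a - v| <= e -> `|c - v| <= e -> `|v| <= e.
Proof. by move=> a0 c0; rewrite !ler_norml => /andP[h1 h2] /andP[h3 h4]; apply/andP; split; lra. Qed.

Section volume_bound.
Variables (R : realType) (d : nat).
Local Notation E := 'rV[R]_d.
Local Notation ST := (R * E)%type.
Variables (k : R) (b : ST -> R) (u : ST -> E) (r0 : R).
Hypothesis fl : euler_flow k b u.
Hypothesis r0_ge0 : 0 <= r0.
Hypothesis b0 : forall y, r0 < sqn y -> b (0, y) = 0.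

Local Notation uc i := (fun y : ST => u y 0 i).
Local Notation psi := (psi b u r0).

Let u_C1 := flow_u_C1 fl.
Let uc_C1 i : C1 (uc i). Proof. exact: C1_coord. Qed.
Let psiC := psi_C1 fl b0.
Let psiT := psi_tcs fl r0_ge0 b0.

(** The position at time tau of a particle moving freely from z. *)
Definition target (tau : R) (i : 'I_d) (z : ST) : R := z.2 0 i + (tau + -1 * z.1) * u z 0 i.

Lemma affine_time_C1 tau : C1 (fun z : ST => tau + -1 * z.1).
Proof. by apply: C1D; [exact: C1_cst|apply: C1Z; exact: C1_time]. Qed.

Lemma target_C1 tau i : C1 (target tau i).
Proof.
apply: C1D; first exact: C1_space.
by apply: C1M; [exact: affine_time_C1|exact: uc_C1].
Qed.

Lemma derive_target tau i (v : ST) z : 'D_v (target tau i) z =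
  v.2 0 i + (tau + -1 * z.1) * 'D_v (uc i) z - u z 0 i * v.1.
Proof.
rewrite /target (derive_add _ _ (@C1_space R d i) (C1M (affine_time_C1 tau) (uc_C1 i))).
rewrite (derive_mul _ _ (affine_time_C1 tau) (uc_C1 i)).
rewrite (derive_add _ _ (@C1_cst R _ _ tau) (C1Z (-1) (@C1_time R d))) derive_cst.
rewrite (deriveZ_C1 _ _ _ (@C1_time R d)) derive_time derive_space; ring.
Qed.

(** The functions whose spacetime Jacobian vanishes: psi and the positions at
    time tau. *)
Definition carried tau (j : 'I_d.+1) : ST -> R :=
  if unlift ord0 j is Some i then target tau i else psi.

Lemma carried0 tau : carried tau ord0 = psi.
Proof. by rewrite /carried unlift_none. Qed.

Lemma carriedS tau i : carried tau (lift ord0 i) = target tau i.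
Proof. by rewrite /carried liftK. Qed.

Lemma carried_C1 tau j : C1 (carried tau j).
Proof.
have [i ->|->] := unliftP ord0 j; last by rewrite carried0; exact: psiC.
by rewrite carriedS; exact: target_C1.
Qed.

(** Either psi is locally constant, or z lies in vacuum and all these functions
    have derivative 0 in the direction (1, u z). *)
Lemma carried_jacobian tau z : \det (st_jacobian (carried tau) z) = 0.
Proof.
have [[bz pz]|pz] := psi_near fl b0 z; last first.
  rewrite (expand_det_row _ ord0) big1// => j _; rewrite mxE carried0.
  by rewrite -(near_eq_derive _ pz) derive_cst mul0r.
apply/eqP; rewrite -det_tr; apply/det0P.
exists (\row_j (if unlift ord0 j is Some i then u z 0 i else 1)).
  by apply/negP => /eqP/rowP/(_ ord0); rewrite !mxE unlift_none => /eqP; rewrite oner_eq0.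
apply/rowP => i; rewrite !mxE.
have -> : \sum_j (\row_j (if unlift ord0 j is Some i then u z 0 i else 1)) 0 j *
    (st_jacobian (carried tau) z)^T j i = 'D_((1, u z) : ST) (carried tau i) z.
  rewrite derive_split; last exact: carried_C1.
  rewrite big_ord_recl !mxE unlift_none dir0; congr (_ * _ + _).
  by apply: eq_bigr => j _; rewrite !mxE liftK dirS.
have [j ->|->] := unliftP ord0 i; last first.
  by rewrite carried0 -(near_eq_derive _ pz) (vacuum_chi r0 fl).
by rewrite carriedS derive_target (vacuum_burgers fl)// mulr0 addr0 mulr1 subrr.
Qed.

Definition vol (t : R) : R := Lint (fun x => psi (t, x)).

Definition Du0 (x : E) : 'M[R]_d := \matrix_(i, j) dx j (uc i) (0, x).

(** The invariance applied between times tau, where the targets are the space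
    coordinates, and 0, where their Jacobian is 1 + tau Du(0). *)
Lemma vol_det tau : vol tau = Lint (fun x => psi (0, x) * \det (1%:M + tau *: Du0 x)).
Proof.
have := transport_invariance (carried_C1 tau) (f := carried tau).
rewrite carried0 => /(_ psiT (carried_jacobian tau) tau 0) H.
rewrite /vol -[RHS](_ : Lint (fun x => psi (0, x) * \det (sp_jacobian (carried tau) (0, x))) = _); last first.
  congr Lint; apply/funext => x; congr (_ * \det _); apply/matrixP => i j.
  rewrite !mxE carriedS /dx derive_target/= mulr0 mulr0 addr0 subr0.
  by rewrite !mxE eqxx/= eq_sym.
rewrite -H; congr Lint; apply/funext => x.
have J1 : sp_jacobian (carried tau) (tau, x) = 1%:M.
  apply/matrixP => i j.
  rewrite !mxE carriedS /dx derive_target/= mulN1r subrr mul0r mulr0 addr0 subr0.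
  by rewrite !mxE eqxx/= eq_sym.
by rewrite J1 det1 mulr1.
Qed.

Lemma vol_ge0 t : 0 <= vol t.
Proof.
apply: Lint_ge0; last by move=> x; exact: psi_ge0.
by apply: slice_ccf => //; exact: C1_continuous psiC.
Qed.

(** vol tau / tau^d, as a function of e = 1 / tau; it extends to e = 0, where
    its value is the leading coefficient of vol. *)
Definition vol_slope (e : R) : R := Lint (fun x => psi (0, x) * \det (e%:M + Du0 x)).

Lemma vol_slope_ccf (e : R) : ccf (fun x => psi (0, x) * \det (e%:M + Du0 x)).
Proof.
apply: ccfMr.
  by apply: slice_ccf; [exact: C1_continuous psiC|exact: psiT].
apply: continuous_det => i j.
rewrite (_ : (fun x => _) = fun x => (e%:M : 'M[R]_d) i j + dx j (uc i) (0, x)).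
  move=> x; apply: (@continuousD _ _ _ (fun=> (e%:M : 'M[R]_d) i j) (fun x => dx j (uc i) (0, x))).
    exact: cst_continuous.
  exact: (@slice_continuous R d _ (dx j (uc i)) 0 (@C1_D _ _ _ (uc i) _ (uc_C1 i)) x).
by apply/funext => x; rewrite !mxE.
Qed.

Lemma vol_scale tau : tau != 0 -> vol tau = tau ^+ d * vol_slope tau^-1.
Proof.
move=> t0; rewrite vol_det /vol_slope -LintZ; last exact: vol_slope_ccf.
congr Lint; apply/funext => x; rewrite mulrCA -detZ; congr (_ * \det _).
by rewrite scalerDr scale_scalar_mx mulfV.
Qed.

Lemma vol_slope_lipschitz : exists2 C, 0 <= C &
  forall e, `|e| <= 1 -> `|vol_slope e - vol_slope 0| <= C * `|e|.
Proof.
have cp := @slice_ccf R d psi 0 (@C1_continuous _ _ _ _ psiC) psiT.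
have [rho [B [rho0 [pB pr]]]] := ccf_bsupp cp.
have [M M0 Mb] := compact_bound (@closed_ball_compact R d rho)
  (@slice_continuous R d _ (slope k b u) 0 (@slope_continuous _ _ _ _ _ fl)).
pose K := d`!%:R * (d%:R * (M + 1) ^+ d).
have K0 : 0 <= K by rewrite !mulr_ge0 ?ler0n ?exprn_ge0//; lra.
have B0 : 0 <= B by apply: le_trans (pB 0); exact: normr_ge0.
exists (B * K * (2 * rho + 1) ^+ d).
  by rewrite !mulr_ge0 ?exprn_ge0//; lra.
move=> e e1; rewrite /vol_slope -LintB; [|exact: vol_slope_ccf..].
rewrite mulrAC; apply: (@Lint_bound _ _ _ rho) => //; first by apply: ccfB; exact: vol_slope_ccf.
split => x; last by move=> xr; rewrite pr// !mul0r subrr.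
have [xr|xr] := leP `|x| rho; last first.
  by rewrite pr// !mul0r subrr normr0 mulr_ge0// mulr_ge0.
rewrite -mulrBr normrM -mulrA; apply: ler_pM => //.
have DM i j : `|Du0 x i j| <= M.
  apply: le_trans (Mb x xr); rewrite mxE [leRHS]ger0_norm; last exact: slope_ge0.
  rewrite /slope (bigD1 i)//= (bigD1 j)//= -!addrA lerDl.
  rewrite !addr_ge0 ?mulr_ge0 ?sumr_ge0// ?(ltW (flow_gt0 fl))// => l _.
  by rewrite sumr_ge0.
have eM i j (a : R) : `|a| <= 1 -> `|(a%:M : 'M[R]_d) i j| <= `|a|.
  by move=> a1; rewrite mxE; case: (i == j); rewrite ?mulr1n// mulr0n normr0.
apply: det_lipschitz => //; first lra.
- move=> i j; rewrite !mxE; have := DM i j; have := eM i j e e1; rewrite !mxE => h1 h2.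
  by apply: le_trans (ler_normD _ _) _; lra.
- move=> i j; rewrite !mxE mul0rn add0r; have := DM i j; rewrite mxE => h; lra.
- move=> i j; rewrite !mxE mul0rn add0r addrK; have := eM i j e e1; rewrite mxE; exact.
Qed.

(** As d is odd, vol_slope has opposite signs on the two sides of 0 and thus
    vanishes at 0. This uses the volumes at negative times. *)
Lemma vol_bound : odd d -> exists2 C, 0 <= C &
  forall tau, 1 <= tau -> vol tau <= C * tau ^+ d.-1.
Proof.
move=> dodd; have [C C0 CL] := vol_slope_lipschitz.
have dpos : (0 < d)%N by case: (d) dodd.
have pos e : 0 < e -> 0 <= vol_slope e.
  move=> e0; have := vol_ge0 e^-1; rewrite vol_scale ?invrK ?invr_neq0 ?gt_eqF//.
  by rewrite pmulr_rge0// exprn_gt0// invr_gt0.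
have neg e : e < 0 -> vol_slope e <= 0.
  move=> e0; have := vol_ge0 e^-1; rewrite vol_scale ?invrK ?invr_neq0 ?lt_eqF//.
  by rewrite nmulr_rge0// exprn_odd_lt0// invr_lt0.
have vs0 : vol_slope 0 = 0.
  have small e : 0 < e -> e <= 1 -> `|vol_slope 0| <= C * e.
    move=> e0 e1; have := CL e; have := CL (- e); rewrite normrN gtr0_norm//.
    move=> /(_ e1) + /(_ e1); have := pos e e0; have := neg (- e); rewrite oppr_lt0 => /(_ e0).
    by move=> h1 h2 h3 h4; exact: norm_le_of_opposite h2 h1 h4 h3.
  apply/eqP; rewrite -normr_le0; apply/ler_addgt0Pl => e e0; rewrite addr0.
  pose e' := Num.min 1 (e / (C + 1)).
  have C1 : 0 < C + 1 by lra.
  have e'0 : 0 < e' by rewrite lt_min ltr01 divr_gt0.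
  apply: le_trans (small e' e'0 _) _; first by rewrite ge_min lexx.
  have : (C + 1) * e' <= e.
    by rewrite mulrC -ler_pdivlMr// ge_min lexx orbT.
  by have := ltW e'0; lra.
exists C => // tau t1; have t0 : 0 < tau by lra.
rewrite vol_scale ?gt_eqF// -{1}(prednK dpos) exprSr.
have := CL tau^-1; rewrite vs0 subr0 [`|tau^-1|]gtr0_norm ?invr_gt0//.
rewrite invf_le1// => /(_ t1) h.
rewrite -mulrA mulrC ler_pM2r ?exprn_gt0//.
rewrite -ler_pdivlMl// mulrC; apply: le_trans h; exact: ler_norm.
Qed.

End volume_bound.

(** * Conservation laws and the dispersion energy *)

Section transport.
Variables (R : realType) (d : nat).
Local Notation E := 'rV[R]_d.
Local Notation ST := (R * E)%type.
Variables (k : R) (b : ST -> R) (u : ST -> E).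
Hypothesis fl : euler_flow k b u.
Local Notation uc i := (fun y : ST => u y 0 i).
Let u_C1 := flow_u_C1 fl.
Let b_C1 := flow_b_C1 fl.
Let uc_C1 i : C1 (uc i). Proof. exact: C1_coord. Qed.

Lemma tcsMl (f g : ST -> R) : tcs g -> tcs (fun z => f z * g z).
Proof.
by move=> tg tau; have [r gr] := tg tau; exists r => t x tt rx; rewrite gr// mulr0.
Qed.

Lemma tcsD (f g : ST -> R) : tcs f -> tcs g -> tcs (fun z => f z + g z).
Proof.
move=> tf tg tau; have [r fr] := tf tau; have [s gs] := tg tau.
exists (Num.max r s) => t x tt; rewrite gt_max => /andP[rx sx].
by rewrite fr// gs// addr0.
Qed.

Definition material (f : ST -> R) (z : ST) : R := 'D_((1, u z) : ST) f z.

Lemma divergence_material (f : ST -> R) z : C1 f ->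
  dt f z + \sum_j dx j (fun z => u z 0 j * f z) z = material f z + f z * div u z.
Proof.
move=> cf; rewrite /material derive_split// mul1r -addrA; congr (_ + _).
rewrite mulr_sumr -big_split/=; apply: eq_bigr => j _.
exact: (derive_mul _ _ (uc_C1 j) cf).
Qed.

Lemma Lint_sum_dx (F : 'I_d -> ST -> R) t : (forall j, C1 (F j)) -> (forall j, tcs (F j)) ->
  Lint (fun x => \sum_j dx j (F j) (t, x)) = 0.
Proof.
move=> cF tF; rewrite (Lint_sum _ _ (f := fun j x => dx j (F j) (t, x))).
  by apply: big1 => j _; exact: (Lint_dx _ _ (cF j) (tF j)).
move=> j; exact: (slice_ccf _ (@C1_D _ _ _ (F j) _ (cF j)) (@tcs_D _ _ (F j) _ (tF j))).
Qed.

(** The divergences of u f and of the flux F integrate to zero. *)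
Lemma Lint_transport (f : ST -> R) (g : R -> E -> R) (F : 'I_d -> ST -> R) (t : R) :
  C1 f -> tcs f -> (forall j, C1 (F j)) -> (forall j, tcs (F j)) ->
  (forall x, material f (t, x) + f (t, x) * div u (t, x) =
     g t x + \sum_j dx j (F j) (t, x)) ->
  is_derive t (1 : R) (fun s => Lint (fun x => f (s, x))) (Lint (g t)).
Proof.
move=> cf tf cF tF H; have H0 := is_derive_Lint t cf tf; apply: (is_derive_eq H0).
have sc (h : 'I_d -> ST -> R) : (forall j, C1 (h j)) -> (forall j, tcs (h j)) ->
    ccf (fun x => \sum_j dx j (h j) (t, x)).
  move=> ch th; apply: (ccf_sum _ _ (f := fun j x => dx j (h j) (t, x))) => j.
  exact: (slice_ccf _ (@C1_D _ _ _ (h j) _ (ch j)) (@tcs_D _ _ (h j) _ (th j))).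
have cuf j : C1 (fun z => u z 0 j * f z) by exact: (C1M (uc_C1 j) cf).
have tuf j : tcs (fun z => u z 0 j * f z) by exact: tcsMl.
have cdt : ccf (fun x => dt f (t, x)).
  exact: (slice_ccf _ (@C1_D _ _ _ f _ cf) (@tcs_D _ _ f _ tf)).
have -> : g t = fun x => (dt f (t, x) + \sum_j dx j (fun z => u z 0 j * f z) (t, x))
    - \sum_j dx j (F j) (t, x).
  by apply/funext => x; rewrite (divergence_material _ cf) H addrK.
have sc1 := sc _ cuf tuf; have sc2 := sc _ cF tF.
rewrite (LintB (ccfD cdt sc1) sc2) (LintD cdt sc1).
by rewrite (Lint_sum_dx _ cuf tuf) (Lint_sum_dx _ cF tF) addr0 subr0.
Qed.

Lemma material_b z : material b z = - (k * b z * div u z).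
Proof.
rewrite /material (derive_b_line fl) big1 ?sub0r// => j _.
by rewrite subrr mul0r.
Qed.

Lemma material_u z i : material (uc i) z = - (k * b z * dx i b z).
Proof.
rewrite /material (derive_uc_line fl) big1 ?sub0r// => j _.
by rewrite subrr mul0r.
Qed.

Lemma material_label z i : material (fun z => label u z 0 i) z = z.1 * (k * b z * dx i b z).
Proof.
rewrite /material (_ : (fun z => _) = fun z : ST => z.2 0 i + -1 * (z.1 * u z 0 i)); last first.
  by apply/funext => y; rewrite labelE.
have c1 : C1 (fun z : ST => z.1 * u z 0 i) by exact: (C1M (@C1_time R d) (uc_C1 i)).
rewrite (derive_add _ _ (@C1_space R d i) (C1Z _ c1)) (deriveZ_C1 _ _ _ c1).
rewrite (derive_mul _ _ (@C1_time R d) (uc_C1 i)) derive_space derive_time.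
by rewrite -/(material _ _) material_u/=; ring.
Qed.

Lemma dx_label z i j : dx j (fun z => label u z 0 i) z = (i == j)%:R - z.1 * dx j (uc i) z.
Proof.
rewrite /dx (_ : (fun z => _) = fun z : ST => z.2 0 i + -1 * (z.1 * u z 0 i)); last first.
  by apply/funext => y; rewrite labelE.
have c1 : C1 (fun z : ST => z.1 * u z 0 i) by exact: (C1M (@C1_time R d) (uc_C1 i)).
rewrite (derive_add _ _ (@C1_space R d i) (C1Z _ c1)) (deriveZ_C1 _ _ _ c1).
rewrite (derive_mul _ _ (@C1_time R d) (uc_C1 i)) derive_space derive_time/= !mxE/=.
by rewrite mulr0 addr0 mulN1r.
Qed.

End transport.

Section decay.
Variables (R : realType) (d : nat).
Local Notation E := 'rV[R]_d.
Local Notation ST := (R * E)%type.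
Variables (m : R) (b : ST -> R) (u : ST -> E) (r0 : R).
Hypothesis m2 : 2 <= m.
Hypothesis fl : euler_flow m^-1 b u.
Hypothesis r0_ge0 : 0 <= r0.
Hypothesis b0 : forall y, r0 < sqn y -> b (0, y) = 0.
Local Notation uc i := (fun y : ST => u y 0 i).
Local Notation Mat := (material u).
Local Notation lab i := (fun z : ST => label u z 0 i).
Let u_C1 := flow_u_C1 fl.
Let b_C1 := flow_b_C1 fl.
Let b_ge0 := flow_b_ge0 fl.
Let uc_C1 i : C1 (uc i). Proof. exact: C1_coord. Qed.
Let lab_C1 i : C1 (lab i). Proof. exact: label_C1 fl i. Qed.
Let m0 : 0 < m. Proof. by have := m2; lra. Qed.

Lemma ppow_C1 p : 2 <= p -> C1 (fun z => ppow p (b z)).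
Proof.
move=> p2; apply: (C1_comp (ppow_derive p2)) => // x.
by apply: cvgMl_tmp; apply: ppow_continuous; lra.
Qed.

Lemma derive_ppow p v z : 2 <= p ->
  'D_v (fun z => ppow p (b z)) z = p * ppow (p - 1) (b z) * 'D_v b z.
Proof. by move=> p2; rewrite (derive_compC1 (ppow_derive p2)). Qed.

Lemma b_tcs : tcs b.
Proof.
move=> tau; have [rho H] := @finite_propagation _ _ _ _ _ fl r0 tau r0_ge0 b0.
by exists rho => t x tt rx; have [] := H t x tt rx.
Qed.

Lemma ppow_tcs p : tcs (fun z => ppow p (b z)).
Proof.
by move=> tau; have [r br] := b_tcs tau; exists r => t x tt rx; rewrite br// ppow0.
Qed.

(** The density and the pressure, up to constant factors: c is proportional to
    rho^kappa, and m = 1 / kappa. *)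
Definition dens z := ppow m (b z).
Definition pres z := ppow (m + 2) (b z).

Let m22 : 2 <= m + 2. Proof. by have := m2; lra. Qed.
Let dens_C1 : C1 dens. Proof. exact: ppow_C1. Qed.
Let pres_C1 : C1 pres. Proof. exact: ppow_C1. Qed.

Lemma material_dens z : Mat dens z = - (dens z * div u z).
Proof.
rewrite /material derive_ppow// -/(Mat b z) (material_b fl) /dens.
have -> : ppow m (b z) = b z * ppow (m - 1) (b z) by rewrite -ppowS subrK.
field.
by rewrite gt_eqF.
Qed.

Lemma presE z : pres z = b z * (b z * dens z).
Proof.
rewrite /pres /dens (_ : m + 2 = m + 1 + 1) ?ppowS//; ring.
Qed.

Lemma derive_pres v z : 'D_v pres z = (m + 2) * (b z * dens z) * 'D_v b z.
Proof.
rewrite derive_ppow// (_ : m + 2 - 1 = m + 1) ?ppowS//; ring.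
Qed.

(** The kinetic energy of the deviation x - t u from free flow, together with
    t^2 times the internal energy. *)
Definition energy (z : ST) : R :=
  2^-1 * (dens z * sqlabel u z) + (2 * (m + 2))^-1 * (z.1 * z.1 * pres z).

Let sq_C1 : C1 (sqlabel u). Proof. exact: sqlabel_C1 fl. Qed.
Let ds_C1 : C1 (fun z => dens z * sqlabel u z). Proof. exact: (C1M dens_C1 sq_C1). Qed.
Let t_C1 : C1 (fun z : ST => z.1). Proof. exact: C1_time. Qed.
Let tt_C1 : C1 (fun z : ST => z.1 * z.1). Proof. exact: (C1M t_C1 t_C1). Qed.
Let ttp_C1 : C1 (fun z : ST => z.1 * z.1 * pres z). Proof. exact: (C1M tt_C1 pres_C1). Qed.

Lemma energy_C1 : C1 energy.
Proof. exact: (C1D (C1Z _ ds_C1) (C1Z _ ttp_C1)). Qed.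

Lemma energy_tcs : tcs energy.
Proof.
apply: tcsD; apply: tcsMl; last by apply: tcsMl; exact: ppow_tcs.
move=> tau; have [r br] := ppow_tcs m tau; exists r => t x tt rx.
by rewrite /dens br// mul0r.
Qed.

Definition flux (j : 'I_d) (z : ST) : R := (m * (m + 2))^-1 * (z.1 * (label u z 0 j * pres z)).

Let lp_C1 j : C1 (fun z => label u z 0 j * pres z). Proof. exact: (C1M (lab_C1 j) pres_C1). Qed.
Let tlp_C1 j : C1 (fun z : ST => z.1 * (label u z 0 j * pres z)). Proof. exact: (C1M t_C1 (lp_C1 j)). Qed.

Lemma flux_C1 j : C1 (flux j).
Proof. exact: (C1Z _ (tlp_C1 j)). Qed.

Lemma flux_tcs j : tcs (flux j).
Proof. by apply: tcsMl; apply: tcsMl; apply: tcsMl; exact: ppow_tcs. Qed.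

Lemma material_sqlabel z :
  Mat (sqlabel u) z = 2 * (z.1 * (m^-1 * b z * \sum_i label u z 0 i * dx i b z)).
Proof.
rewrite /material (_ : sqlabel u = fun z => \sum_i label u z 0 i * label u z 0 i); last first.
  by apply/funext => y; apply: eq_bigr => i _; rewrite expr2.
rewrite derive_sum_C1; last by move=> i; exact: (C1M (lab_C1 i) (lab_C1 i)).
rewrite !mulr_sumr; apply: eq_bigr => i _.
rewrite (derive_mul _ _ (lab_C1 i) (lab_C1 i)) -/(Mat _ z) (material_label fl); ring.
Qed.

(** The work of the pressure against x - t u is a divergence, up to the
    multiple d - t div u of the pressure. The terms with div u cancel, and the
    explicit t^2 contributes m / d times the opposite of the term with d. *)
Lemma material_energy z : Mat energy z + energy z * div u z =
  (m - d%:R) / (m * (m + 2)) * z.1 * pres z + \sum_j dx j (flux j) z.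
Proof.
have Mds : Mat (fun z => dens z * sqlabel u z) z =
    dens z * Mat (sqlabel u) z - sqlabel u z * (dens z * div u z).
  by rewrite /material (derive_mul _ _ dens_C1 sq_C1) -/(Mat dens z) material_dens mulrN.
have Mp : Mat pres z = - ((m + 2) * m^-1 * pres z * div u z).
  rewrite /material derive_pres -/(Mat b z) (material_b fl) presE; ring.
have Mtp : Mat (fun z => z.1 * z.1 * pres z) z =
    z.1 * z.1 * Mat pres z + pres z * (2 * z.1).
  rewrite /material (derive_mul _ _ tt_C1 pres_C1) (derive_mul _ _ t_C1 t_C1) derive_time/=.
  by congr (_ + _ * _); ring.
have -> : Mat energy z = 2^-1 * (dens z * Mat (sqlabel u) z - sqlabel u z * (dens z * div u z))
   + (2 * (m + 2))^-1 * (z.1 * z.1 * Mat pres z + pres z * (2 * z.1)).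
  rewrite -Mds -Mtp /material (derive_add _ _ (C1Z _ ds_C1) (C1Z _ ttp_C1)).
  by rewrite (deriveZ_C1 _ _ _ ds_C1) (deriveZ_C1 _ _ _ ttp_C1).
pose S := \sum_i label u z 0 i * dx i b z.
have -> : \sum_j dx j (flux j) z = (m * (m + 2))^-1 * z.1 *
    ((d%:R - z.1 * div u z) * pres z + (m + 2) * (b z * dens z) * S).
  have dxf j : dx j (flux j) z = (m * (m + 2))^-1 * (z.1 *
      (label u z 0 j * ((m + 2) * (b z * dens z) * dx j b z)
       + pres z * (1 - z.1 * dx j (uc j) z))).
    rewrite /dx /flux (deriveZ_C1 _ _ _ (tlp_C1 j)) (derive_mul _ _ t_C1 (lp_C1 j)).
    rewrite (derive_mul _ _ (lab_C1 j) pres_C1) derive_time mulr0 addr0 derive_pres.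
    by rewrite -/(dx j (lab j) z) (dx_label fl) eqxx.
  rewrite (eq_bigr _ (fun j _ => dxf j)) -mulr_sumr -mulr_sumr -mulrA.
  congr (_ * (_ * _)); rewrite big_split/= -mulr_sumr sumrB sumr_const card_ord.
  rewrite -mulr_sumr -/(div u z) addrC mulrC; congr (_ * _ + _).
  by rewrite /S mulr_sumr; apply: eq_bigr => j _; ring.
rewrite material_sqlabel -/S Mp /energy presE; field.
have h1 : m != 0 by rewrite gt_eqF.
have h2 : m + 2 != 0 by rewrite gt_eqF//; have := m0; lra.
by rewrite h1 h2.
Qed.

End decay.

(** * Dispersion contradicts slow growth of the volume *)

Lemma third_le (R : realType) (a c : R) : 0 < a -> c <= (a + 3 * c) / 3.
Proof. by lra. Qed.

Lemma third_add_lt (R : realType) (a : R) : 0 < a -> a <= a / 3 + a / 3 -> False.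
Proof. by lra. Qed.

Section dispersion.
Variables (R : realType) (d : nat).
Local Notation E := 'rV[R]_d.
Local Notation ST := (R * E)%type.
Variables (m : R) (b : ST -> R) (u : ST -> E) (r0 : R).
Hypothesis m2 : 2 <= m.
Hypothesis dm : d%:R <= m.
Hypothesis fl : euler_flow m^-1 b u.
Hypothesis r0_ge0 : 0 <= r0.
Hypothesis b0 : forall y, r0 < sqn y -> b (0, y) = 0.
Local Notation dens := (dens m b).
Local Notation pres := (pres m b).
Local Notation energy := (energy m b u).
Let b_ge0 := flow_b_ge0 fl.
Let m0 : 0 < m. Proof. by have := m2; lra. Qed.
Let m22 : 2 <= m + 2. Proof. by have := m2; lra. Qed.
Let dens_C1 : C1 dens. Proof. exact: (ppow_C1 fl m2). Qed.
Let pres_C1 : C1 pres. Proof. exact: (ppow_C1 fl m22). Qed.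
Let dens_tcs : tcs dens. Proof. exact: (ppow_tcs fl r0_ge0 b0). Qed.
Let pres_tcs : tcs pres. Proof. exact: (ppow_tcs fl r0_ge0 b0). Qed.
Let energyC : C1 energy. Proof. exact: (energy_C1 m2 fl). Qed.
Let energyT : tcs energy. Proof. exact: (energy_tcs fl r0_ge0 b0). Qed.

Definition mass (t : R) : R := Lint (fun x => dens (t, x)).
Definition pressure (t : R) : R := Lint (fun x => pres (t, x)).
Definition energy_at (t : R) : R := Lint (fun x => energy (t, x)).

Let dens_ccf t : ccf (fun x => dens (t, x)).
Proof. by apply: slice_ccf => //; exact: C1_continuous dens_C1. Qed.

Let pres_ccf t : ccf (fun x => pres (t, x)).
Proof. by apply: slice_ccf => //; exact: C1_continuous pres_C1. Qed.

Lemma mass_const s t : mass s = mass t.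
Proof.
have cz : C1 (fun _ : ST => 0 : R) by exact: C1_cst.
have tz : tcs (fun _ : ST => 0 : R) by move=> tau; exists 0.
have D r : is_derive r (1 : R) mass 0.
  have H := @Lint_transport R d m^-1 b u fl dens (fun _ _ => 0) (fun _ _ => 0) r
    dens_C1 dens_tcs (fun=> cz) (fun=> tz).
  rewrite Lint0 in H; apply: H => x.
  rewrite (material_dens m2 fl) addNr add0r big1// => j _; exact: derive_cst.
by rewrite (is_derive_0_is_cst s t D).
Qed.

Lemma mass_gt0 t x : b (t, x) != 0 -> 0 < mass t.
Proof.
move=> bn0; apply: (@Lint_gt0 _ _ _ x) => //; first by move=> y; exact: ppow_ge0.
by apply: ppow_gt0; rewrite lt_def bn0 b_ge0.
Qed.

Lemma energy_at_derive t : is_derive t (1 : R) energy_at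
  ((m - d%:R) / (m * (m + 2)) * t * pressure t).
Proof.
have H := @Lint_transport R d m^-1 b u fl energy
  (fun t x => (m - d%:R) / (m * (m + 2)) * t * pres (t, x)) (flux m b u) t
  energyC energyT (flux_C1 m2 fl) (flux_tcs fl r0_ge0 b0).
rewrite /pressure -LintZ//; apply: H => x.
exact: (material_energy m2 fl).
Qed.

Lemma pressure_energy t : (2 * (m + 2))^-1 * (t * t * pressure t) <= energy_at t.
Proof.
rewrite mulrA /pressure -LintZ//; apply: le_Lint.
- exact: ccfZ.
- by apply: slice_ccf => //; exact: C1_continuous energyC.
- move=> x; rewrite /energy /= !mulrA lerDr !mulr_ge0 ?invr_ge0//; first exact: ppow_ge0.
  by rewrite /sqlabel /sqn sumr_ge0// => i _; exact: sqr_ge0.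
Qed.

Definition rate : R := 2 * (m - d%:R) / m.

(** By [pressure_energy] the logarithmic derivative of the energy is at most
    rate / t, a bound that needs d <= m. *)
Lemma energy_growth t : 1 <= t -> energy_at t <= energy_at 1 * t `^ rate.
Proof.
move=> t1; pose h s := - (energy_at s * s `^ (- rate)).
pose dh s := - (energy_at s * (- rate * s `^ (- rate - 1)) +
   s `^ (- rate) * ((m - d%:R) / (m * (m + 2)) * s * pressure s)).
have := @le_of_derive R h dh 1 t t1; rewrite /h powR1 mulr1 lerN2 => H.
have t0 : 0 < t by lra.
rewrite -ler_pdivrMr ?powR_gt0// -powRN; apply: H => s /andP[s1 st].
  have s0 : 0 < s by lra.
  have h1 := energy_at_derive s; have h2 := @is_derive1_powR R (- rate) s s0.
  have h3 := is_deriveN (is_deriveM h1 h2).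
  exact: h3.
have s0 : 0 < s by lra.
rewrite /dh oppr_ge0.
have -> : s `^ (- rate) = s * s `^ (- rate - 1).
  by rewrite -[X in X * _](powRr1 (ltW s0)) -powRD ?(gt_eqF s0) ?implybT// addrC subrK.
have := pressure_energy s; set P := pressure s; set J := energy_at s => PJ.
set X := s `^ (- rate - 1); have X0 : 0 <= X by exact: powR_ge0.
have -> : J * (- rate * X) + s * X * ((m - d%:R) / (m * (m + 2)) * s * P) =
   X * (rate * ((2 * (m + 2))^-1 * (s * s * P) - J)).
  rewrite /rate; field.
  have h1 : m != 0 by rewrite gt_eqF.
  have h2 : m + 2 != 0 by rewrite gt_eqF//; have := m0; lra.
  by rewrite h1 h2.
rewrite mulr_ge0_le0// mulr_ge0_le0 ?subr_le0//.
by rewrite /rate divr_ge0 ?mulr_ge0 ?subr_ge0// ltW.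
Qed.

(** The exponent is rate - 2. *)
Lemma pressure_decay : exists2 C, 0 <= C & forall t, 1 <= t ->
  pressure t <= C * t `^ (- (2 * d%:R / m)).
Proof.
have m2p : 0 < 2 * (m + 2) by have := m0; lra.
have E0 : 0 <= energy_at 1.
  apply: le_trans (pressure_energy 1); rewrite !mulr_ge0 ?invr_ge0 ?(ltW m2p)//.
  by apply: Lint_ge0 => // x; exact: ppow_ge0.
exists (2 * (m + 2) * energy_at 1); first by rewrite mulr_ge0// ltW.
move=> t t1; have t0 : 0 < t by lra.
have tt0 : 0 < t * t by rewrite mulr_gt0.
have := le_trans (pressure_energy t) (energy_growth t1).
rewrite ler_pdivrMl// => h; rewrite -(ler_pM2l tt0) (le_trans h)// mulrA.
rewrite le_eqVlt; apply/orP; left; apply/eqP; rewrite mulrCA -[RHS]mulrA mulrA; congr (_ * _).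
have -> : t * t = t `^ 2.
  by rewrite (_ : 2 = 1 + 1)// powRD ?powRr1 ?ltW// (gt_eqF t0) implybT.
rewrite -powRD; last by rewrite (gt_eqF t0) implybT.
congr (_ `^ _); rewrite /rate; field; by rewrite gt_eqF.
Qed.

(** Where b >= s, b^m <= (b/s)^2 b^m; where 0 < b < s, b^m <= s^m and psi =
    1. *)
Lemma dens_young (s : R) z : 0 < s ->
  dens z <= (s * s)^-1 * pres z + s `^ m * psi b u r0 z.
Proof.
move=> s0; have sm : 0 <= s `^ m by exact: powR_ge0.
have [bz|bz] := eqVneq (b z) 0.
  rewrite /dens /pres bz !ppow0// mulr0 add0r mulr_ge0//; exact: psi_ge0.
have bp : 0 < b z by rewrite lt_def bz b_ge0.
rewrite psi_fluid// mulr1 presE.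
have d0 : 0 <= dens z by exact: ppow_ge0.
have p0 : 0 <= (s * s)^-1 * (b z * (b z * dens z)).
  by rewrite !mulr_ge0 ?invr_ge0 ?mulr_ge0// ltW.
have [sb|bs] := leP s (b z).
  apply: ler_wpDr => //; rewrite ler_pdivlMl ?mulr_gt0// mulrA.
  by rewrite ler_wpM2r// ler_pM// ?(ltW s0).
apply: ler_wpDl => //; rewrite /dens /ppow (lt_geF bp).
by apply: ge0_ler_powR => //; rewrite ?inE ?nnegrE; rewrite ltW.
Qed.

(** The mass is estimated with [dens_young] at s = e t^(-(d-1)/m), where t is
    chosen after e, so that each of the two terms is at most a third of the
    mass. *)
Theorem no_dispersion t0 x0 : odd d -> b (t0, x0) != 0 -> False.
Proof.
move=> dodd bn0; have dpos : (0 < d)%N by case: (d) dodd.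
have M0 := mass_gt0 bn0; set M := mass t0 in M0.
have [CP CP0 HP] := pressure_decay.
have [CV CV0 HV] := vol_bound fl r0_ge0 b0 dodd.
have psi_ccf t : ccf (fun x => psi b u r0 (t, x)).
  exact: (slice_ccf _ (@C1_continuous _ _ _ _ (psi_C1 fl b0)) (psi_tcs fl r0_ge0 b0)).
have key (s t : R) : 0 < s -> 1 <= t -> M <= (s * s)^-1 * pressure t + s `^ m * vol b u r0 t.
  move=> s0 t1; rewrite /M (mass_const t0 t) /pressure /vol -!LintZ//.
  rewrite -LintD; [|exact: ccfZ..].
  apply: le_Lint => // [|x]; first by apply: ccfD; exact: ccfZ.
  exact: dens_young.
(* e^m CV < M / 3, and T is so large that e^(-2) CP / T <= M / 3; t = T^(m/2)
   turns the decay t^(-2/m) into 1 / T. *)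
pose e := (M / (3 * (CV + 1))) `^ m^-1.
have CV1 : 0 < CV + 1 by lra.
have q0 : 0 < M / (3 * (CV + 1)) by rewrite divr_gt0// mulr_gt0.
have e0 : 0 < e by exact: powR_gt0.
have em : e `^ m = M / (3 * (CV + 1)).
  by rewrite -powRrM mulVf ?powRr1 ?ltW// gt_eqF.
pose T := 1 + 3 * CP / (e * e * M).
have eeM : 0 < e * e * M by rewrite !mulr_gt0.
have T1 : 1 <= T by rewrite lerDl divr_ge0 ?mulr_ge0// ltW.
have T0 : 0 < T by lra.
pose t := T `^ (m / 2).
have t1 : 1 <= t.
  have mh : 0 <= m / 2 by rewrite divr_ge0// ltW.
  by have := ler_powR T1 mh; rewrite powRr0.
have tp : 0 < t by lra.
have tT : t `^ (- (2 / m)) = T^-1.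
  rewrite -powRrM (_ : m / 2 * - (2 / m) = -1); last by field; rewrite gt_eqF.
  by rewrite powRN powRr1// ltW.
pose s := e * t `^ (- (d.-1%:R / m)).
have s0 : 0 < s by rewrite mulr_gt0 ?powR_gt0.
have tn a c : t `^ a * t `^ c = t `^ (a + c).
  by rewrite powRD// (gt_eqF tp) implybT.
have dE : d%:R = d.-1%:R + 1 :> R by rewrite natr1 prednK.
have h1 : (s * s)^-1 * pressure t <= CP / (e * e) * T^-1.
  apply: (@le_trans _ _ ((s * s)^-1 * (CP * t `^ (- (2 * d%:R / m))))).
    by apply: ler_wpM2l; [rewrite invr_ge0 mulr_ge0 ?(ltW s0)|exact: HP].
  rewrite le_eqVlt; apply/orP; left; apply/eqP.
  pose X := t `^ (- (d.-1%:R / m) + - (d.-1%:R / m)).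
  have X0 : 0 < X by exact: powR_gt0.
  have -> : t `^ (- (2 * d%:R / m)) = T^-1 * X.
    rewrite /X -tT tn; congr (_ `^ _); rewrite dE; field; by rewrite gt_eqF.
  have -> : s * s = e * e * X by rewrite /s mulrACA tn.
  by field; rewrite !gt_eqF.
have h2 : s `^ m * vol b u r0 t <= CV * (M / (3 * (CV + 1))).
  apply: (@le_trans _ _ (s `^ m * (CV * t ^+ d.-1))).
    by apply: ler_wpM2l; [exact: powR_ge0|exact: HV].
  rewrite le_eqVlt; apply/orP; left; apply/eqP.
  have -> : s `^ m = M / (3 * (CV + 1)) * t `^ (- (d.-1%:R / m) * m).
    by rewrite /s (powRM _ (ltW e0) (powR_ge0 _ _)) em -powRrM.
  have tt1 : t `^ (- (d.-1%:R / m) * m) * t ^+ d.-1 = 1.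
    rewrite -powR_mulrn ?(ltW tp)// tn.
    by rewrite (_ : _ + _ = 0) ?powRr0//; field; rewrite gt_eqF.
  by rewrite mulrACA tt1 mulr1 mulrC.
have h3 : CV * (M / (3 * (CV + 1))) <= M / 3.
  have -> : CV * (M / (3 * (CV + 1))) = M / 3 * CV / (CV + 1) by field; rewrite gt_eqF.
  rewrite ler_pdivrMr// mulrDr mulr1 lerDl divr_ge0//; exact: ltW.
have h4 : CP / (e * e) * T^-1 <= M / 3.
  rewrite ler_pdivrMr// ler_pdivrMr ?mulr_gt0//.
  have -> : M / 3 * T * (e * e) = (e * e * M) * T / 3 by ring.
  rewrite /T mulrDr mulr1 [_ * (3 * CP / _)]mulrC divfK ?gt_eqF//.
  exact: third_le.
have big := le_trans (key s t s0 t1) (lerD (le_trans h1 h4) (le_trans h2 h3)).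
exact: third_add_lt big.
Qed.

End dispersion.

(** * One space dimension *)

Section riccati.
Variable R : realType.

(** If f t0 > 0, then 1 / f decreases at rate at least K and would reach 0
    within the time 1 / (K f t0). *)
Lemma riccati_le0 (f df : R -> R) (K : R) : 0 < K ->
  (forall t, is_derive t (1 : R) f (df t)) -> (forall t, K * f t ^+ 2 <= df t) ->
  forall t, f t <= 0.
Proof.
move=> K0 fD fK t0; rewrite leNgt; apply/negP => y0.
have df0 t : 0 <= df t by apply: le_trans (fK t); rewrite mulr_ge0 ?sqr_ge0// ltW.
have fmono t : t0 <= t -> f t0 <= f t by move=> tt; apply: (@le_of_derive R f df).
pose T := t0 + (K * f t0)^-1.
have tT : t0 <= T by rewrite lerDl invr_ge0 mulr_ge0 // ltW.
have fp t : t0 <= t -> 0 < f t by move=> tt; exact: lt_le_trans (fmono t tt).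
have := @le_of_derive R (fun t => - (f t)^-1 - K * t) (fun t => df t / f t ^+ 2 - K) t0 T tT.
have H1 x : t0 <= x <= T ->
    is_derive x (1 : R) (fun t => - (f t)^-1 - K * t) (df x / f x ^+ 2 - K).
  move=> /andP[tx _]; have fx := fp x tx; have fx0 : f x != 0 by rewrite gt_eqF.
  have [fv fE] := fD x.
  have h1 : is_derive x (1 : R) (fun t => (f t)^-1) (- f x ^- 2 *: df x).
    split; first exact: (derivableV fx0 fv).
    by rewrite (deriveV fx0 fv) fE.
  have h2 : is_derive x (1 : R) (fun t => K * t) K.
    by apply: is_derive_eq; rewrite [_ *: _]mulr1 ?scaler0 ?addr0.
  apply: (is_derive_eq (is_deriveB (is_deriveN h1) h2)).
  by rewrite scaleNr opprK [_ *: _]mulrC.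
move=> /(_ H1) /(_ _)/Wrap[].
  move=> x /andP[tx _]; have fx := fp x tx.
  by rewrite subr_ge0 ler_pdivlMr ?exprn_gt0.
have fT : 0 < (f T)^-1 by rewrite invr_gt0 fp.
have KT : K * T = K * t0 + (f t0)^-1 by rewrite /T mulrDr invfM mulrA mulfV ?mul1r ?gt_eqF.
by rewrite KT; lra.
Qed.

(** Time reversal t |-> - f (- t) preserves the inequality. *)
Lemma riccati_eq0 (f df : R -> R) (K : R) : 0 < K ->
  (forall t, is_derive t (1 : R) f (df t)) -> (forall t, K * f t ^+ 2 <= df t) ->
  forall t, f t = 0.
Proof.
move=> K0 fD fK t; apply/eqP; rewrite eq_le (riccati_le0 K0 fD fK)/=.
have := @riccati_le0 (fun s => - f (- s)) (fun s => df (- s)) K K0 _ _ (- t).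
rewrite opprK oppr_le0; apply => s; last by rewrite sqrrN.
have h := @is_derive1_comp _ f -%R s _ _ (fD (- s)) (is_deriveNid s 1).
apply: (is_derive_eq (is_deriveN h)).
by rewrite mulrN mulr1 opprK.
Qed.

End riccati.

Section one_dimension.
Variable R : realType.
Local Notation E := 'rV[R]_1.
Local Notation ST := (R * E)%type.
Variables (k : R) (b : ST -> R) (u : ST -> E) (r0 : R).
Hypothesis fl : euler_flow k b u.
Hypothesis r0_ge0 : 0 <= r0.
Hypothesis b0 : forall y, r0 < sqn y -> b (0, y) = 0.
Local Notation uc := (fun y : ST => u y 0 0).
Let u_C1 := flow_u_C1 fl.
Let b_C1 := flow_b_C1 fl.
Let b_ge0 := flow_b_ge0 fl.
Let k_gt0 := flow_gt0 fl.
Let uc_C1 : C1 uc. Proof. exact: C1_coord. Qed.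

(** Two lines of different slopes in the plane meet, at time s. *)
Lemma vacuum_velocity z z' : b z = 0 -> b z' = 0 -> u z = u z'.
Proof.
case: z z' => [t y] [t' y'] bz bz'; set v := u (t, y); set v' := u (t', y').
have [//|vv] := eqVneq v v'.
have v0 : v 0 0 - v' 0 0 != 0.
  rewrite subr_eq0; apply: contraNN vv => /eqP vv; apply/eqP/rowP => i.
  by rewrite ord1 vv.
pose s := (y' 0 0 - y 0 0 + t * v 0 0 - t' * v' 0 0) / (v 0 0 - v' 0 0).
have [_ us] := vacuum_line fl bz s; have [_ us'] := vacuum_line fl bz' s.
rewrite -/v in us; rewrite -/v' in us'; rewrite -us -us'; congr u; congr (_, _).
by apply/rowP => i; rewrite ord1 !mxE /s; field.
Qed.

(* Any point outside the initial fluid shows the common velocity U of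
   vacuum. *)
Let y0 : E := const_mx (r0 + 1).
Let U : E := u (0, y0).
Let U0 : R := U 0 0.

Let b_y0 : b (0, y0) = 0.
Proof. by apply: b0; rewrite /sqn big_ord1 mxE; have := r0_ge0; nra. Qed.

Lemma vacuum_U z : b z = 0 -> u z = U.
Proof. by move=> bz; rewrite (vacuum_velocity bz b_y0). Qed.

(** Position and velocity in the frame moving with the vacuum. *)
Definition offset (z : ST) : R := z.2 0 0 + - U0 * z.1.
Definition relvel (z : ST) : R := u z 0 0 + - U0.

Lemma relvel0 z : b z = 0 -> relvel z = 0.
Proof. by move=> bz; rewrite /relvel (vacuum_U bz) subrr. Qed.

(** In that frame the vacuum outside the initial interval is at rest. *)
Lemma offset_bound z : b z != 0 -> offset z * offset z <= r0.
Proof.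
case: z => t y bz; rewrite leNgt; apply/negP => h.
pose x := y - t *: U.
have bx : b (0, x) = 0.
  by apply: b0; rewrite /sqn big_ord1 !mxE expr2 [t * _]mulrC -mulNr.
have [] := vacuum_line fl bx t; rewrite (vacuum_U bx) /line subr0 subrK => bt _.
by rewrite bt eqxx in bz.
Qed.

Lemma offset_C1 : C1 offset.
Proof. exact: (C1D (@C1_space R 1 0) (C1Z _ (@C1_time R 1))). Qed.

Lemma relvel_C1 : C1 relvel.
Proof. exact: (C1D uc_C1 (@C1_cst R _ _ (- U0))). Qed.

Lemma derive_offset (v z : ST) : 'D_v offset z = v.2 0 0 - U0 * v.1.
Proof.
rewrite /offset (derive_add _ _ (@C1_space R 1 0) (C1Z _ (@C1_time R 1))).
by rewrite (deriveZ_C1 _ _ _ (@C1_time R 1)) derive_time derive_space mulNr.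
Qed.

Lemma derive_relvel (v z : ST) : 'D_v relvel z = 'D_v uc z.
Proof.
by rewrite /relvel (derive_add _ _ uc_C1 (@C1_cst R _ _ (- U0))) derive_cst addr0.
Qed.

Lemma far_vacuum (tau : R) : exists r, forall t (x : E), `|t| <= tau -> r < `|x| ->
  r0 + 3 < offset (t, x) * offset (t, x).
Proof.
exists (r0 + 3 + `|U0| * tau) => t x tt rx.
have x0 : `|x| <= `|x 0 0|.
  by apply: norm_le_coord => // i; rewrite ord1.
have ut : `|U0 * t| <= `|U0| * tau by rewrite normrM ler_wpM2l.
have h : r0 + 3 < `|offset (t, x)|.
  have := ler_normB (x 0 0) (U0 * t).
  have := ler_distD (U0 * t) (x 0 0) 0; rewrite !subr0 /offset /= mulNr; lra.
have := r0_ge0; rewrite -expr2 -real_normK ?num_real// expr2; nra.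
Qed.

Lemma fluid_tcs (f : ST -> R) : (forall z, b z = 0 -> f z = 0) -> tcs f.
Proof.
move=> fb tau; have [r H] := far_vacuum tau; exists r => t x tt rx.
apply: fb; apply/eqP/negPn/negP => /offset_bound.
by have := H t x tt rx; lra.
Qed.

(** A C^1 majorant of offset^2 on the fluid, at rest in the moving frame, so
    that its integral does not depend on time. *)
Definition bump (z : ST) : R := (r0 + 1) * chi r0 (offset z * offset z).

Let oo_C1 : C1 (fun z => offset z * offset z).
Proof. exact: (C1M offset_C1 offset_C1). Qed.

Let chi_C1 : C1 (fun z => chi r0 (offset z * offset z)).
Proof. exact: (C1_comp (chi_derive r0) (@dchi_continuous R r0) oo_C1). Qed.

Lemma bump_C1 : C1 bump.
Proof. exact: (C1Z _ chi_C1). Qed.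

Lemma bump_tcs : tcs bump.
Proof.
move=> tau; have [r H] := far_vacuum tau; exists r => t x tt rx.
by rewrite /bump chi0 ?mulr0//; exact: ltW (H t x tt rx).
Qed.

Lemma derive_bump (v z : ST) : 'D_v bump z =
  (r0 + 1) * (dchi r0 (offset z * offset z) * (2 * offset z * (v.2 0 0 - U0 * v.1))).
Proof.
rewrite /bump (deriveZ_C1 _ _ _ chi_C1) (derive_compC1 (chi_derive r0) _ _ oo_C1).
rewrite (derive_mul _ _ offset_C1 offset_C1) derive_offset; congr (_ * (_ * _)); ring.
Qed.

Lemma bump_int_const s t : Lint (fun x => bump (s, x)) = Lint (fun x => bump (t, x)).
Proof.
have D r : is_derive r (1 : R) (fun s => Lint (fun x => bump (s, x))) 0.
  apply: (is_derive_eq (is_derive_Lint r bump_C1 bump_tcs)).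
  have -> : (fun x => dt bump (r, x)) = (fun x => - U0 * dx 0 bump (r, x)).
    apply/funext => x; rewrite /dt /dx !derive_bump/= !mxE/=; ring.
  have cD := slice_ccf r (@C1_D _ _ _ bump (0, delta_mx 0 0) bump_C1) (@tcs_D _ _ bump _ bump_tcs).
  rewrite (LintZ _ cD).
  by have := Lint_dx r 0 bump_C1 bump_tcs => ->; rewrite mulr0.
exact: (is_derive_0_is_cst s t D).
Qed.

(** By [material_virial] the time derivative of the integral of the virial is
    the integral of the action. *)
Definition virial (z : ST) : R := offset z * relvel z.
Definition action (z : ST) : R := 2^-1 * (relvel z * relvel z) + 2^-1 * (k * (b z * b z)).
Definition virial_flux (z : ST) : R :=
  2^-1 * (offset z * (relvel z * relvel z)) + - (2^-1 * k) * (offset z * (b z * b z)).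

Let virial_C1 : C1 virial. Proof. exact: (C1M offset_C1 relvel_C1). Qed.
Let ww_C1 : C1 (fun z => relvel z * relvel z). Proof. exact: (C1M relvel_C1 relvel_C1). Qed.
Let bb_C1 : C1 (fun z => b z * b z). Proof. exact: (C1M b_C1 b_C1). Qed.
Let kbb_C1 : C1 (fun z => k * (b z * b z)). Proof. exact: (C1Z _ bb_C1). Qed.
Let action_C1 : C1 action. Proof. exact: (C1D (C1Z _ ww_C1) (C1Z _ kbb_C1)). Qed.
Let xww_C1 : C1 (fun z => offset z * (relvel z * relvel z)). Proof. exact: (C1M offset_C1 ww_C1). Qed.
Let xbb_C1 : C1 (fun z => offset z * (b z * b z)). Proof. exact: (C1M offset_C1 bb_C1). Qed.
Let flux_C1' : C1 virial_flux. Proof. exact: (C1D (C1Z _ xww_C1) (C1Z _ xbb_C1)). Qed.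

Let virial_tcs : tcs virial.
Proof. by apply: fluid_tcs => z bz; rewrite /virial relvel0// mulr0. Qed.
Let action_tcs : tcs action.
Proof. by apply: fluid_tcs => z bz; rewrite /action relvel0// bz !mulr0 addr0. Qed.
Let flux_tcs' : tcs virial_flux.
Proof. by apply: fluid_tcs => z bz; rewrite /virial_flux relvel0// bz !mulr0 addr0. Qed.

Lemma material_virial z : material u virial z + virial z * div u z =
  action z + dx 0 virial_flux z.
Proof.
have mo : material u offset z = relvel z by rewrite /material derive_offset/= mulr1.
have mr : material u relvel z = - (k * b z * dx 0 b z).
  by rewrite /material derive_relvel -/(material u uc z) (material_u fl).
have -> : material u virial z = offset z * material u relvel z + relvel z * material u offset z.
  exact: (derive_mul _ _ offset_C1 relvel_C1).
have -> : div u z = dx 0 uc z by rewrite /div big_ord1.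
have -> : dx 0 virial_flux z =
    2^-1 * (offset z * (2 * relvel z * dx 0 uc z) + relvel z * relvel z)
    + - (2^-1 * k) * (offset z * (2 * b z * dx 0 b z) + b z * b z).
  rewrite /dx /virial_flux (derive_add _ _ (C1Z _ xww_C1) (C1Z _ xbb_C1)).
  rewrite (deriveZ_C1 _ _ _ xww_C1) (deriveZ_C1 _ _ _ xbb_C1).
  rewrite (derive_mul _ _ offset_C1 ww_C1) (derive_mul _ _ offset_C1 bb_C1).
  rewrite (derive_mul _ _ relvel_C1 relvel_C1) (derive_mul _ _ b_C1 b_C1).
  rewrite derive_relvel derive_offset/= !mxE/=; ring.
by rewrite mo mr /virial /action; field.
Qed.

Lemma virial_derive t : is_derive t (1 : R) (fun s => Lint (fun x => virial (s, x)))
  (Lint (fun x => action (t, x))).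
Proof.
have H := @Lint_transport R 1 k b u fl virial (fun t x => action (t, x)) (fun=> virial_flux) t
  virial_C1 virial_tcs (fun=> flux_C1') (fun=> flux_tcs').
by apply: H => x; rewrite big_ord1; exact: material_virial.
Qed.

Let scc (f : ST -> R) t : C1 f -> tcs f -> ccf (fun x => f (t, x)).
Proof. by move=> cf tf; exact: (slice_ccf t (@C1_continuous _ _ _ _ cf) tf). Qed.

(** Cauchy-Schwarz, in the form of the nonnegativity of the integral of
    (relvel - s offset)^2 / 2 at the best value s = Y / C. *)
Lemma virial_square_le (C : R) t : 0 < C -> Lint (fun x => bump (0, x)) <= C ->
  (2 * C)^-1 * Lint (fun x => virial (t, x)) ^+ 2 <= Lint (fun x => action (t, x)).
Proof.
move=> C0 bC; set Y := Lint (fun x => virial (t, x)); pose s := Y / C.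
have cv := scc t virial_C1 virial_tcs; have ca := scc t action_C1 action_tcs.
have cb := scc t bump_C1 bump_tcs.
have : 0 <= Lint (fun x => (action (t, x) - s * virial (t, x)) + 2^-1 * (s * s) * bump (t, x)).
  apply: Lint_ge0; first by apply: ccfD; [apply: ccfB => //; exact: ccfZ|exact: ccfZ].
  move=> x; set z := (t, x); have ss : 0 <= s * s by rewrite -expr2 sqr_ge0.
  have [bz|bz] := eqVneq (b z) 0.
    rewrite /action /virial relvel0// bz !mulr0 addr0 subr0 add0r.
    have B0 : 0 <= bump z by rewrite /bump mulr_ge0 ?chi_ge0// addr_ge0.
    by rewrite mulr_ge0// mulr_ge0.
  have ob := offset_bound bz.
  rewrite /bump chi1 ?mulr1; last by lra.
  have kb : 0 <= k * (b z * b z) by rewrite mulr_ge0 ?mulr_ge0// ltW.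
  have h1 := sqr_ge0 (relvel z - s * offset z).
  have h2 : 0 <= s * s * (r0 + 1 - offset z * offset z) by rewrite mulr_ge0//; lra.
  rewrite /action /virial; lra.
rewrite (LintD (ccfB ca (ccfZ s cv)) (ccfZ _ cb)) (LintB ca (ccfZ s cv)) (LintZ _ cv) (LintZ _ cb).
rewrite (bump_int_const t 0) -/Y => h.
have h3 : 2^-1 * (s * s) * Lint (fun x => bump (0, x)) <= 2^-1 * (s * s) * C.
  by apply: ler_wpM2l => //; rewrite mulr_ge0// -expr2 sqr_ge0.
have -> : (2 * C)^-1 * Y ^+ 2 = s * Y - 2^-1 * (s * s) * C.
  by rewrite /s; field; rewrite gt_eqF.
lra.
Qed.

(** The integral Y of the virial vanishes at all times by [riccati_eq0], and
    hence so does its derivative, which is positive at t0 because of the term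
    k b^2 / 2. *)
Theorem no_1d_flow t0 x0 : b (t0, x0) != 0 -> False.
Proof.
move=> bn0; pose C := Num.max 1 (Lint (fun x => bump (0, x))).
have C0 : 0 < C by rewrite lt_max ltr01.
have bC : Lint (fun x => bump (0, x)) <= C by rewrite le_max lexx orbT.
have K0 : 0 < (2 * C)^-1 by rewrite invr_gt0 mulr_gt0.
have Y0 := riccati_eq0 K0 virial_derive (fun t => virial_square_le t C0 bC).
have [_] := virial_derive t0.
rewrite (_ : (fun s => _) = cst 0); last by apply/funext => s; rewrite Y0.
rewrite derive_cst => A0.
have kb : 0 < k * (b (t0, x0) * b (t0, x0)).
  have bp : 0 < b (t0, x0) by rewrite lt_def bn0 b_ge0.
  by rewrite mulr_gt0 ?mulr_gt0.
have ag z : 2^-1 * (k * (b z * b z)) <= action z.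
  by rewrite /action lerDr mulr_ge0// -expr2 sqr_ge0.
have : 0 < Lint (fun x => action (t0, x)).
  apply: (@Lint_gt0 _ _ _ x0); first exact: (scc t0 action_C1 action_tcs).
    move=> x; apply: le_trans (ag _).
    by rewrite !mulr_ge0// ?ltW.
  by apply: lt_le_trans (ag _); rewrite mulr_gt0.
by rewrite -A0 ltxx.
Qed.

End one_dimension.

(** * The theorem *)

Lemma eternal_solution_flow (R : realType) (d : nat) (kappa : R)
    (c : R * 'rV[R]_d -> R) (u : R * 'rV[R]_d -> 'rV[R]_d) :
  0 < kappa -> eternal_solution kappa c u ->
  euler_flow kappa (fun z => c z / kappa) u.
Proof.
move=> k0 [cC uC c0 eqs].
have {}cC := class_C1 cC; have {}uC := class_C1 uC.
have bC : C1 (fun z => c z / kappa).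
  rewrite (_ : (fun z => _) = fun z => kappa^-1 * c z); first exact: (C1Z _ cC).
  by apply/funext => z; rewrite mulrC.
split => //.
- by move=> z; rewrite divr_ge0// ltW.
- by move=> z; have [] := eqs z.
- move=> z i; have [_ /rowP/(_ i)] := eqs z; rewrite !mxE.
  rewrite /dt /advect (derive_coord _ _ _ uC) summxE => H; rewrite -[RHS]H.
  congr (_ + _ + _); apply: eq_bigr => j _.
  by rewrite mxE /dx (derive_coord _ _ _ uC).
Qed.

Theorem theorem2p5 (R : realType) (d : nat) (gamma : R)
    (d_ge1 : (1 <= d)%N) (d_odd : odd d)
    (gamma_gt1 : 1 < gamma)
    (gamma_le : (1 < d)%N -> gamma <= 1 + 1 / (d%:R - 1)) :
  let kappa := (gamma - 1) / 2 in
  ~ exists (c : R * 'rV[R]_d -> R) (u : R * 'rV[R]_d -> 'rV[R]_d),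
      [/\ eternal_solution kappa c u, nontrivial c &
          exists K : set 'rV[R]_d,
            [/\ compact_domain K, has_smooth_boundary K &
                fsupport (fun x : 'rV[R]_d => c (0, x)) `<=` K]].
Proof.
move=> kappa [c [u [sol [z cz] [K [[cK _ _] _ suppK]]]]].
have k0 : 0 < kappa by rewrite divr_gt0// subr_gt0.
have fl := eternal_solution_flow k0 sol.
have [r0 r0_ge0 Kr] := compact_bound cK (@sqn_continuous R d).
have b0 y : r0 < sqn y -> c (0, y) / kappa = 0.
  move=> ry; apply/eqP; rewrite mulf_eq0; apply/orP; left; apply/negPn/negP => cy.
  have /Kr : K y by apply: suppK; apply: subset_closure.
  by move=> /(le_trans (ler_norm _)); rewrite leNgt ry.
case: z cz => t x cz.
have bz : c (t, x) / kappa != 0 by rewrite mulf_neq0// invr_neq0// gt_eqF.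
have [d1|d1] := leqP d 1.
  have dE : d = 1%N by apply/eqP; rewrite eqn_leq d1.
  move: c u fl sol b0 x cz bz {K cK suppK Kr d1 d_odd d_ge1 gamma_le}; rewrite dE => c u fl _ b0 x _ bz.
  exact: (no_1d_flow fl r0_ge0 b0 bz).
have d3 : (3 <= d)%N by case: (d) d1 d_odd => [|[|[|n]]].
have d3R : 3 <= d%:R :> R by rewrite ler_nat.
(* For odd d > 1, i.e. d >= 3, the bound on gamma gives m = 1 / kappa >=
   2 (d - 1) >= d. *)
have gk : gamma - 1 <= (d%:R - 1)^-1 by have := gamma_le d1; rewrite div1r; lra.
have mk : 2 * (d%:R - 1) <= kappa^-1.
  rewrite /kappa invf_div ler_pdivlMr ?subr_gt0// -mulrA ler_piMr//.
  by rewrite mulrC -ler_pdivlMr ?div1r//; lra.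
have fl' : euler_flow kappa^-1^-1 (fun z => c z / kappa) u by rewrite invrK.
have m2 : 2 <= kappa^-1 by lra.
have dm : d%:R <= kappa^-1 by lra.
exact: (no_dispersion m2 dm fl' r0_ge0 b0 d_odd bz).
Qed.
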